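(* Let $\nu>0$, $k>0$, $R>0$, $\mu>0$, let $N$ be a positive integer, $h\in L^2(\mathbb{R}^+;L^2(0,1))$, and $u_0,v_0\in H_0^1(0,1)$. Let $\xi>\frac{\lambda_1\nu}{2}$ and $\sigma=\xi-\frac{\lambda_1\nu}{2}$. Suppose that $$\mu>Q_1+\frac12\sigma,\qquad \frac{\nu}{2}>\lambda_{N+1}^{-1}(\sigma+2Q_1),$$ where $$Q_1:=\frac{4c_0^2}{\nu}(H_4+H_2)+R+k\lambda_1^{-1/2}(H_1+H_3)\sqrt{H_2}$$ and $c_0,H_1,H_2,H_3,H_4$ are the constants described in the context. Let $v$ be the strong solution of $$\begin{cases}\partial_tv-\nu\partial_x^2v+2v\,\partial_xv-Rv+kv\int_0^1v^2\,dx=h, & x\in(0,1),\ t>0,\\ v|_{x=0}=v|_{x=1}=0,\quad v|_{t=0}=v_0.\end{cases}$$ Then each strong solution $u$ of the controlled problem $$\begin{cases}\partial_tu-\nu\partial_x^2u+2u\,\partial_xu-Ru+k\|u\|^2u=-\mu\sum_{j=1}^N(u-v,w_j)w_j+h, & x\in(0,1),\ t>0,\\ u|_{x=0}=u|_{x=1}=0,\quad u|_{t=0}=u_0\end{cases}$$ approaches $v$ with exponential rate $e^{-\xi t}$ in the $H^1(0,1)$ sense; that is, there exist $t_0>0$ and $C\ge0$ such that $\|u(t)-v(t)\|_{H^1(0,1)}^2\le Ce^{-\xi t}$ for all $t\ge t_0$.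
   Context: $(\cdot,\cdot)$ and $\|\cdot\|$ are the inner product and norm of $L^2(0,1)$. $w_1,w_2,\dots$ are the eigenfunctions, orthonormal in $L^2(0,1)$, of $-\frac{d^2}{dx^2}$ on $(0,1)$ with homogeneous Dirichlet boundary conditions, corresponding to the eigenvalues $\lambda_1<\lambda_2<\cdots$. A strong solution of the uncontrolled problem (or of the controlled problem) is a function belonging, for every $T>0$, to $L^\infty(0,T;H_0^1(0,1))\cap L^2(0,T;H^2(0,1))$, satisfying the equation in the $L^2$ sense and attaining the initial condition. Constants. $c_0>0$ is a constant in the Sobolev inequality $\|\phi\|_{L^\infty(0,1)}\le c_0\|\partial_x\phi\|$ for all $\phi\in H_0^1(0,1)$. $H_1,H_2>0$ are constants, depending only on $\nu,k,R$ and $\int_0^\infty\|h(t)\|^2dt$, such that for every strong solution $v$ of the uncontrolled problem there is $T>0$ with $\|v(t)\|\le H_1$ and $\|\partial_xv(t)\|^2\le H_2$ for all $t\ge T$. $H_3,H_4>0$ are constants, depending only on $\nu,k,R,\mu$ and $\int_0^\infty\|h(t)\|^2dt$ (not on $N$ or the initial data), such that for every strong solution $u$ of the controlled problem there is $T>0$ with $\|u(t)\|\le H_3$ and $\|\partial_xu(t)\|^2\le H_4$ for all $t\ge T$. *)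

(* Defs.v *)
From HB Require Import structures.
From mathcomp Require Import all_boot all_order all_algebra.
From mathcomp Require Import all_classical all_reals all_analysis.
Set Implicit Arguments.
Unset Strict Implicit.
Unset Printing Implicit Defensive.
Import Order.TTheory GRing.Theory Num.Theory.
Import numFieldNormedType.Exports.
Local Open Scope classical_set_scope.
Local Open Scope ring_scope.

(* Elements of L^2(0,1) are represented by
   functions R -> R, of which only the restriction to ]0,1[, up to a.e.
   equality, matters.  A function of time and space is u : R -> R -> R,
   with u t the profile at time t. *)

Section Sobolev.
Variable R : realType.
Implicit Types (D : set R) (f g phi : R -> R).

Definition leb := @lebesgue_measure R.

Definition I01 : set R := `]0, 1[.

Definition Rplus : set R := `]0, +oo[.

Definition test_fun D phi : Prop :=
  [/\ forall n (x : R), derivable (derive1n n phi) x 1,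
      compact (closure [set x | phi x != 0]) &
      closure [set x | phi x != 0] `<=` D].

Definition weak_deriv D f g : Prop :=
  forall phi, test_fun D phi ->
    \int[leb]_(x in D) (f x * derive1 phi x) = - \int[leb]_(x in D) (g x * phi x).

Definition L2 : set (R -> R) :=
  [set f : R -> R | measurable_fun I01 f /\
           leb.-integrable I01 (fun x => (f x ^+ 2)%:E)].

Definition inner f g : R := \int[leb]_(x in I01) (f x * g x).

Definition l2norm f : R := Num.sqrt (inner f f).

(* Any L^2 weak derivative, all choices being a.e. equal on ]0,1[;
   only meaningful when f is in sob1. *)
Definition Dx f : R -> R :=
  xget (fun=> 0) [set g : R -> R | L2 g /\ weak_deriv I01 f g].

Definition sob1 : set (R -> R) :=
  [set f : R -> R | L2 f /\ exists g, L2 g /\ weak_deriv I01 f g].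

Definition sob2 : set (R -> R) := [set f : R -> R | sob1 f /\ sob1 (Dx f)].

Definition h1norm f : R := Num.sqrt (l2norm f ^+ 2 + l2norm (Dx f) ^+ 2).

Definition h2norm f : R :=
  Num.sqrt (l2norm f ^+ 2 + l2norm (Dx f) ^+ 2 + l2norm (Dx (Dx f)) ^+ 2).

(* H^1_0(0,1): closure of the test functions in H^1(0,1). *)
Definition sob10 : set (R -> R) :=
  [set f : R -> R | sob1 f /\ exists p : nat -> R -> R,
     (forall n, test_fun I01 (p n)) /\
     (fun n => h1norm (f \- p n)) @ \oo --> (0 : R)].

Definition sobolev_constant (c0 : R) : Prop :=
  0 < c0 /\
  forall phi, sob10 phi ->
    {ae leb, forall x, I01 x -> `|phi x| <= c0 * l2norm (Dx phi)}.

Definition dirichlet_eigenpair (l : R) f : Prop :=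
  [/\ sob2 f, sob10 f, l2norm f != 0 &
      {ae leb, forall x, I01 x -> - Dx (Dx f) x = l * f x}].

(* Indices start at 1; lam 0 and w 0 are irrelevant. *)
Definition dirichlet_spectrum (lam : nat -> R) (w : nat -> R -> R) : Prop :=
  [/\ forall i j, (0 < i)%N -> (i < j)%N -> lam i < lam j,
      forall j, (0 < j)%N -> dirichlet_eigenpair (lam j) (w j),
      forall l f, dirichlet_eigenpair l f -> exists2 j, (0 < j)%N & l = lam j &
      forall i j, (0 < i)%N -> (0 < j)%N -> inner (w i) (w j) = (i == j)%:R].

End Sobolev.

(* Bochner spaces over a time set D, with values in the space of functions X
   normed by nrm. *)
Section Bochner.
Variable R : realType.
Implicit Types (D : set R) (X : set (R -> R)) (nrm : (R -> R) -> R).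
Implicit Types (f s : R -> R -> R).

Definition simple_in_time X s : Prop :=
  exists (m : nat) (A : nat -> set R) (e : nat -> R -> R),
    [/\ forall i, measurable (A i), forall i, X (e i) &
        forall t x, s t x = \sum_(i < m) \1_(A i) t * e i x].

Definition strongly_measurable D X nrm f : Prop :=
  exists s : nat -> R -> R -> R,
    (forall n, simple_in_time X (s n)) /\
    {ae @leb R, forall t, D t ->
       (fun n => nrm (f t \- s n t)) @ \oo --> (0 : R)}.

Definition Linfty_time D X nrm f : Prop :=
  [/\ strongly_measurable D X nrm f,
      {ae @leb R, forall t, D t -> X (f t)} &
      exists M : R, {ae @leb R, forall t, D t -> nrm (f t) <= M}].

Definition L2_time D X nrm f : Prop :=
  [/\ strongly_measurable D X nrm f,
      {ae @leb R, forall t, D t -> X (f t)} &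
      (\int[@leb R]_(t in D) (nrm (f t) ^+ 2)%:E < +oo)%E].

Definition energy (h : R -> R -> R) : R :=
  \int[@leb R]_(t in @Rplus R) (l2norm (h t) ^+ 2).

(* u_t is the distributional time derivative of u with values in L^2(0,1). *)
Definition time_deriv (u ut : R -> R -> R) : Prop :=
  forall phi, @L2 R phi ->
    weak_deriv (@Rplus R) (fun t => inner (u t) phi) (fun t => inner (ut t) phi).

End Bochner.

Section Equation.
Variable R : realType.

(* Strong solution of u_t - nu u_xx + 2 u u_x - r u + k ||u||^2 u = f with
   homogeneous Dirichlet conditions and u = u0 at t = 0.  Since solutions are
   evaluated at individual times, u denotes the representative that is
   H^1_0-valued at every t >= 0 and continuous from [0, +oo[ to L^2(0,1);
   the initial condition is attained by this representative. *)
Definition strong_solution (nu k r : R) (f : R -> R -> R) (u0 : R -> R)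
    (u : R -> R -> R) : Prop :=
  [/\ (forall t, 0 <= t -> sob10 (u t)) /\
      (forall t, 0 <= t ->
         l2norm (u s \- u t) @[s --> within `[0, +oo[ (nbhs t)] --> (0 : R)),
      forall T : R, 0 < T ->
        Linfty_time `]0, T[ (@sob10 R) (@h1norm R) u /\
        L2_time `]0, T[ (@sob2 R) (@h2norm R) u,
      exists ut : R -> R -> R,
        [/\ forall T : R, 0 < T -> L2_time `]0, T[ (@L2 R) (@l2norm R) ut,
            time_deriv u ut &
            {ae @leb R, forall t, Rplus t ->
              {ae @leb R, forall x, I01 x ->
                ut t x - nu * Dx (Dx (u t)) x + 2 * u t x * Dx (u t) x
                - r * u t x + k * l2norm (u t) ^+ 2 * u t x = f t x}}] &
      {ae @leb R, forall x, I01 x -> u 0 x = u0 x}].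

Definition uncontrolled_solution (nu k r : R) (h : R -> R -> R) (v0 : R -> R)
    (v : R -> R -> R) : Prop :=
  strong_solution nu k r h v0 v.

Definition controlled_solution (nu k r mu : R) (N : nat) (w : nat -> R -> R)
    (h v : R -> R -> R) (u0 : R -> R) (u : R -> R -> R) : Prop :=
  strong_solution nu k r
    (fun t x => - mu * (\sum_(1 <= j < N.+1) inner (u t \- v t) (w j) * w j x)
                + h t x) u0 u.

Definition eventually_bounded (A B : R) (u : R -> R -> R) : Prop :=
  exists2 T : R, 0 < T &
    forall t, T <= t -> l2norm (u t) <= A /\ l2norm (Dx (u t)) ^+ 2 <= B.

(* Dependence on nu, k, r and the energy of h only: the same pair serves all
   forcings of energy E and all initial data. *)
Definition uncontrolled_bounds (nu k r E H1 H2 : R) : Prop :=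
  [/\ 0 < H1, 0 < H2 &
      forall (h : R -> R -> R) (v0 : R -> R) (v : R -> R -> R),
        L2_time (@Rplus R) (@L2 R) (@l2norm R) h -> energy h = E ->
        sob10 v0 -> uncontrolled_solution nu k r h v0 v ->
        eventually_bounded H1 H2 v].

Definition controlled_bounds (nu k r mu : R) (w : nat -> R -> R)
    (E H3 H4 : R) : Prop :=
  [/\ 0 < H3, 0 < H4 &
      forall (N : nat) (h v u : R -> R -> R) (u0 v0 : R -> R),
        (0 < N)%N ->
        L2_time (@Rplus R) (@L2 R) (@l2norm R) h -> energy h = E ->
        sob10 v0 -> uncontrolled_solution nu k r h v0 v ->
        sob10 u0 -> controlled_solution nu k r mu N w h v u0 u ->
        eventually_bounded H3 H4 u].

End Equation.

(* Main.v *)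
Require Import Defs.
From HB Require Import structures.
From mathcomp Require Import all_boot all_order all_algebra.
From mathcomp Require Import all_classical all_reals all_analysis.
From mathcomp Require Import measurable_realfun.
From mathcomp Require Import ring lra.

(** Let [z = u - v].  The theorem follows from an energy inequality for
    [|z_x|^2]: test the equation of [z] with [- z_xx].  The convection terms are
    bounded by the Sobolev inequality and Young's inequality, the cubic terms by
    Poincare's inequality ([convection_energy], [cubic_energy]); with the linear
    term they cost at most [2 Q1 |z_x|^2] and half of the viscous dissipation.  The
    feedback damps the modes up to [N], and the other half of the dissipation
    damps those beyond ([mode_damping]), whence
    [d/dt |z_x|^2 <= - xi |z_x|^2].  By Poincare's inequality the [H^1] norm
    decays at the same rate.

    The regularity of strong solutions does not say that [|z_x|^2] is
    differentiable in time.  The computation is therefore done with finitely many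
    modes.  The eigenfunctions are the sines, up to sign ([spectrum_lam],
    [spectrum_w]), and the coefficients [a_j = (z, sine j)] are better than those
    of [u] and [v]: the forcing [h], which is only square integrable in time,
    cancels in the difference ([weak_deriv_diff]), and what remains of the weak
    derivative of [a_j] is continuous, because an integration by parts turns the
    convection term into a quadratic functional that is continuous on [L^2]
    ([convection_coef]).  By a du Bois-Reymond argument [a_j] is continuously
    differentiable ([weak_deriv_is_derive], [coef_diff_derive]).

    The truncated energies [E M], the sums of [freq j ^ 2 * a_j ^ 2] for
    [1 <= j <= M], converge to [Y = |z_x|^2] by Parseval's identity
    ([parseval_Dx]).  As the nonlinear terms do not respect the truncation, their
    bounds involve [Y] in place of [E M], and the estimate reads
    [(E M)' <= - xi E M + 2 (Q1 - r) (Y - E M)] ([energy_estimate]).  The remainder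
    vanishes in the limit, and Gronwall's inequality passes to [Y]
    ([gronwall_limit]).

    Parseval's identity rests on the density of the sines: a test function is
    [sin (pi x)] times a continuous function of [cos (pi x)], which Bernstein's
    polynomials approximate ([test_sine_approx]). *)

Set Implicit Arguments.
Unset Strict Implicit.
Unset Printing Implicit Defensive.
Import Order.TTheory GRing.Theory Num.Theory.
Import numFieldNormedType.Exports.
Local Open Scope classical_set_scope.
Local Open Scope ring_scope.

#[local] Instance ae_leb_filter (R : realType) :
  Filter (nbhs (almost_everywhere (@leb R))).
Proof. exact: ae_filter_ringOfSetsType. Qed.

(** * Square integrable functions on the unit interval *)

Section L2space.
Variable R : realType.
Implicit Types f g : R -> R.
Local Notation mu := (@leb R).
Local Notation I := (@I01 R).

Lemma measurable_I01 : measurable (I : set (measurableTypeR R)).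
Proof. exact: measurable_itv. Qed.
Hint Resolve measurable_I01 : core.
Hint Extern 0 (measurable (I01 (R:=R))) => exact: measurable_itv : core.

Lemma leb_I01 : mu I = 1%:E.
Proof. by rewrite /leb /I01 lebesgue_measure_itv /= lte_fin ltr01 sube0. Qed.

Lemma leb_I01_lty : (mu I < +oo)%E.
Proof. by rewrite leb_I01 ltry. Qed.

Lemma L2_mul_integrable f g : L2 f -> L2 g ->
  mu.-integrable I (EFin \o (fun x => f x * g x)).
Proof.
move=> [mf f2] [mg g2].
have fg2 := integrableD measurable_I01 f2 g2.
apply: (le_integrable measurable_I01 _ _ fg2).
  by apply/measurable_EFinP; exact: measurable_funM.
move=> x _ /=; rewrite lee_fin [leRHS]ger0_norm ?addr_ge0 ?sqr_ge0//.
rewrite ler_norml; nra.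
Qed.

Lemma measurable_bounded_L2 f (M : R) : measurable_fun I f ->
  (forall x, I x -> `|f x| <= M) -> L2 f.
Proof.
move=> mf fM; split => //.
apply: (@measurable_bounded_integrable _ _ _ mu (fun x => f x ^+ 2)) => //.
- exact: leb_I01_lty.
- exact: measurable_funX.
- exists (M ^+ 2); split; first exact: num_real.
  move=> y My x Ix /=; rewrite normrX (le_trans _ (ltW My))//.
  by rewrite lerXn2r ?nnegrE ?(le_trans _ (fM _ Ix)) ?fM.
Qed.

Lemma L2_mul_bounded f g (M : R) : L2 f -> measurable_fun I g ->
  (forall x, I x -> `|g x| <= M) -> L2 (fun x => f x * g x).
Proof.
move=> [mf f2] mg gM; split; first exact: measurable_funM.
have f2M := integrableZl measurable_I01 (M ^+ 2) f2.
apply: (le_integrable measurable_I01 _ _ f2M).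
  by apply/measurable_EFinP/measurable_funX; exact: measurable_funM.
move=> x Ix /=; have : `|g x| ^+ 2 <= M ^+ 2 by rewrite lerXn2r ?nnegrE ?gM// (le_trans _ (gM _ Ix)).
rewrite real_normK ?num_real// => gM2.
rewrite lee_fin [leRHS]ger0_norm ?[leLHS]ger0_norm ?sqr_ge0//; last first.
  by rewrite mulr_ge0 ?sqr_ge0.
have -> : (f x * g x) ^+ 2 = g x ^+ 2 * f x ^+ 2 by rewrite mulrC exprMn.
by rewrite ler_wpM2r ?sqr_ge0.
Qed.

Lemma L2D f g : L2 f -> L2 g -> L2 (f \+ g).
Proof.
move=> Lf Lg; have [mf f2] := Lf; have [mg g2] := Lg.
split; first exact: measurable_funD.
have := integrableD measurable_I01 (integrableD measurable_I01 f2 g2)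
  (integrableZl measurable_I01 2 (L2_mul_integrable Lf Lg)).
apply: eq_integrable => // x _ /=; rewrite -!EFinM -!EFinD; congr EFin; ring.
Qed.

Lemma L2Z (c : R) f : L2 f -> L2 (fun x => c * f x).
Proof.
move=> [mf f2]; split; first exact: measurable_funM.
have := integrableZl measurable_I01 (c ^+ 2) f2.
by apply: eq_integrable => // x _ /=; rewrite -EFinM exprMn.
Qed.

Lemma L2B f g : L2 f -> L2 g -> L2 (f \- g).
Proof.
move=> Lf Lg; have := L2D Lf (L2Z (-1) Lg).
by congr L2; apply/funext => x /=; rewrite mulN1r.
Qed.

Lemma L2_0 : L2 (fun=> 0 : R).
Proof. by apply: (@measurable_bounded_L2 _ 0) => // x _; rewrite normr0. Qed.

Lemma L2_sum (T : Type) (s : seq T) (P : pred T) (F : T -> R -> R) :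
  (forall i, P i -> L2 (F i)) -> L2 (fun x => \sum_(i <- s | P i) F i x).
Proof.
move=> LF; elim: s => [|i s IH].
  by under eq_fun do rewrite big_nil; exact: L2_0.
have [Pi|nPi] := boolP (P i); under eq_fun do rewrite big_cons ?Pi ?(negbTE nPi).
  exact: L2D (LF _ Pi) IH.
exact: IH.
Qed.

Lemma innerC f g : inner f g = inner g f.
Proof. by apply: eq_Rintegral => x _; rewrite mulrC. Qed.

Lemma innerDl f g k : L2 f -> L2 g -> L2 k ->
  inner (f \+ g) k = inner f k + inner g k.
Proof.
move=> Lf Lg Lk; rewrite /inner -RintegralD//; try exact: L2_mul_integrable.
by apply: eq_Rintegral => x _ /=; rewrite mulrDl.
Qed.

Lemma innerZl (c : R) f g : L2 f -> L2 g ->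
  inner (fun x => c * f x) g = c * inner f g.
Proof.
move=> Lf Lg; rewrite /inner -RintegralZl//; last exact: L2_mul_integrable.
by apply: eq_Rintegral => x _ /=; rewrite mulrA.
Qed.

Lemma innerZr (c : R) f g : L2 f -> L2 g ->
  inner g (fun x => c * f x) = c * inner g f.
Proof. by move=> Lf Lg; rewrite innerC innerZl// innerC. Qed.

Lemma innerBl f g k : L2 f -> L2 g -> L2 k ->
  inner (f \- g) k = inner f k - inner g k.
Proof.
move=> Lf Lg Lk; rewrite /inner -RintegralB//; try exact: L2_mul_integrable.
by apply: eq_Rintegral => x _ /=; rewrite mulrBl.
Qed.

Lemma innerBr f g k : L2 f -> L2 g -> L2 k ->
  inner k (f \- g) = inner k f - inner k g.
Proof. by move=> Lf Lg Lk; rewrite innerC innerBl// innerC (innerC g). Qed.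

Lemma innerDr f g k : L2 f -> L2 g -> L2 k ->
  inner k (f \+ g) = inner k f + inner k g.
Proof. by move=> Lf Lg Lk; rewrite innerC innerDl// innerC (innerC g). Qed.

Lemma inner0l g : inner (fun=> 0) g = 0.
Proof.
rewrite /inner; under eq_Rintegral do rewrite mul0r.
by rewrite Rintegral_cst// mul0r.
Qed.

Lemma inner_suml (T : Type) (s : seq T) (P : pred T) (F : T -> R -> R) g :
  (forall i, P i -> L2 (F i)) -> L2 g ->
  inner (fun x => \sum_(i <- s | P i) F i x) g = \sum_(i <- s | P i) inner (F i) g.
Proof.
move=> LF Lg; elim: s => [|i s IH].
  by under eq_fun do rewrite big_nil; rewrite big_nil inner0l.
under eq_fun do rewrite big_cons; rewrite big_cons; case: ifPn => // Pi.
rewrite -IH -innerDl//; [exact: LF|exact: L2_sum].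
Qed.

Lemma inner_ae f f' g g' : L2 f -> L2 f' -> L2 g -> L2 g' ->
  {ae mu, forall x, I x -> f x = f' x} -> {ae mu, forall x, I x -> g x = g' x} ->
  inner f g = inner f' g'.
Proof.
move=> Lf Lf' Lg Lg' ff' gg'; congr fine; apply: ae_eq_integral => //.
- by have /measurable_int := L2_mul_integrable Lf Lg.
- by have /measurable_int := L2_mul_integrable Lf' Lg'.
- by apply: filterS2 ff' gg' => x fx gx Ix; rewrite fx// gx.
Qed.

Lemma inner_ge0 f : 0 <= inner f f.
Proof. by apply: Rintegral_ge0 => x _; rewrite -expr2 sqr_ge0. Qed.

Lemma sqr_l2norm f : l2norm f ^+ 2 = inner f f.
Proof. by rewrite sqr_sqrtr ?inner_ge0. Qed.

Lemma l2norm_ge0 f : 0 <= l2norm f.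
Proof. exact: sqrtr_ge0. Qed.

Lemma l2norm_ae f f' : L2 f -> L2 f' ->
  {ae mu, forall x, I x -> f x = f' x} -> l2norm f = l2norm f'.
Proof. by move=> Lf Lf' ff'; rewrite /l2norm; congr Num.sqrt; exact: inner_ae. Qed.

Lemma l2norm_sqrD f g : L2 f -> L2 g ->
  l2norm (f \+ g) ^+ 2 = l2norm f ^+ 2 + 2 * inner f g + l2norm g ^+ 2.
Proof.
move=> Lf Lg; have Lfg := L2D Lf Lg.
by rewrite !sqr_l2norm innerDl// !innerDr// (innerC g f); ring.
Qed.

Lemma l2norm_sqrB f g : L2 f -> L2 g ->
  l2norm (f \- g) ^+ 2 = l2norm f ^+ 2 - 2 * inner f g + l2norm g ^+ 2.
Proof.
move=> Lf Lg; have Lfg := L2B Lf Lg.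
by rewrite !sqr_l2norm innerBl// !innerBr// (innerC g f); ring.
Qed.

Lemma l2normZ (c : R) f : L2 f -> l2norm (fun x => c * f x) = `|c| * l2norm f.
Proof.
move=> Lf; have LZ := L2Z c Lf.
by rewrite /l2norm innerZl// innerZr// mulrA -expr2 sqrtrM ?sqr_ge0// sqrtr_sqr.
Qed.

(** The discriminant argument: [|a f - b g|^2 >= 0] with [a = |g|^2] and
    [b = (f, g)]. *)
Lemma cauchy_schwarz f g : L2 f -> L2 g -> `|inner f g| <= l2norm f * l2norm g.
Proof.
move=> Lf Lg; rewrite -(@ler_pXn2r _ 2) ?nnegrE ?mulr_ge0 ?l2norm_ge0//.
rewrite exprMn real_normK ?num_real// !sqr_l2norm.
have Lfa := L2Z (inner g g) Lf; have Lgb := L2Z (inner f g) Lg.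
have := inner_ge0 ((fun x => inner g g * f x) \- (fun x => inner f g * g x)).
rewrite innerBl ?innerBr ?innerZl ?innerZr//; last exact: L2B.
rewrite (innerC g f) => D0.
have := inner_ge0 g; rewrite le_eqVlt => /predU1P[g0|g0].
  have := inner_ge0 ((fun x => (1 + inner f f) * g x) \- (fun x => inner f g * f x)).
  have Lg1 := L2Z (1 + inner f f) Lg; have Lf1 := L2Z (inner f g) Lf.
  rewrite innerBl ?innerBr ?innerZl ?innerZr//; last exact: L2B.
  rewrite (innerC g f) -g0; have := inner_ge0 f; nra.
have : 0 <= inner g g * (inner f f * inner g g - inner f g ^+ 2) by nra.
by rewrite pmulr_rge0// subr_ge0.
Qed.

Lemma l2normD f g : L2 f -> L2 g -> l2norm (f \+ g) <= l2norm f + l2norm g.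
Proof.
move=> Lf Lg; rewrite -(@ler_pXn2r _ 2) ?nnegrE ?addr_ge0 ?l2norm_ge0//.
rewrite l2norm_sqrD//; have := le_trans (ler_norm _) (cauchy_schwarz Lf Lg); nra.
Qed.

Lemma l2normN f : l2norm (fun x => - f x) = l2norm f.
Proof. by congr Num.sqrt; apply: eq_Rintegral => x _; rewrite mulrNN. Qed.

Lemma l2normB f g : L2 f -> L2 g -> l2norm (f \- g) <= l2norm f + l2norm g.
Proof.
move=> Lf Lg; rewrite -(@ler_pXn2r _ 2) ?nnegrE ?addr_ge0 ?l2norm_ge0//.
rewrite l2norm_sqrB//; have := cauchy_schwarz Lf Lg; rewrite ler_norml => /andP[]; nra.
Qed.

Lemma l2norm_dist f g : L2 f -> L2 g -> `|l2norm f - l2norm g| <= l2norm (f \- g).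
Proof.
move=> Lf Lg; have Lfg := L2B Lf Lg; rewrite ler_norml; apply/andP; split.
  have := l2normB Lf Lfg.
  rewrite (_ : f \- (f \- g) = g); last by apply/funext => x /=; rewrite subKr.
  lra.
have := l2normD Lfg Lg.
rewrite (_ : (f \- g) \+ g = f); last by apply/funext => x /=; rewrite subrK.
lra.
Qed.

Lemma l2norm_eq0_ae f : L2 f -> l2norm f = 0 -> {ae mu, forall x, I x -> f x = 0}.
Proof.
move=> Lf; have [mf f2] := Lf; move=> f0.
have : (\int[mu]_(x in I) `|(f x ^+ 2)%:E| = 0)%E.
  have := sqr_l2norm f; rewrite f0 expr0n/= /inner /Rintegral => /esym fine0.
  under eq_integral do rewrite /= ger0_norm ?sqr_ge0//.
  rewrite -[LHS]fineK ?(integrable_fin_num _ f2)//; congr EFin.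
  by rewrite -[RHS]fine0; congr fine; apply: eq_integral => x _; rewrite expr2.
have mf2 : measurable_fun I (fun x => (f x ^+ 2)%:E).
  by apply/measurable_EFinP; exact: measurable_funX.
move/(ae_eq_integral_abs mu measurable_I01 mf2); apply: filterS => x /= h Ix.
by have [] := h Ix => /eqP; rewrite sqrf_eq0 => /eqP.
Qed.

Lemma l2norm_le f g : L2 f -> L2 g ->
  {ae mu, forall x, I x -> `|f x| <= `|g x|} -> l2norm f <= l2norm g.
Proof.
move=> Lf Lg fg; rewrite ler_sqrt ?inner_ge0// /inner /Rintegral.
rewrite fine_le ?(integrable_fin_num _ (L2_mul_integrable _ _))//.
apply: ae_ge0_le_integral => //.
- by move=> x _; rewrite lee_fin -expr2 sqr_ge0.
- by have /measurable_int := L2_mul_integrable Lf Lf.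
- by move=> x _; rewrite lee_fin -expr2 sqr_ge0.
- by have /measurable_int := L2_mul_integrable Lg Lg.
- apply: filterS fg => x h Ix; rewrite lee_fin -!expr2.
  by rewrite -[leLHS]real_normK ?num_real// -[leRHS]real_normK ?num_real// lerXn2r ?nnegrE ?h.
Qed.

Lemma continuous_L2 f : continuous f -> L2 f.
Proof.
move=> cf; have := @segment_compact R 0 1.
move=> /(continuous_compact (continuous_subspaceT cf)) /compact_bounded.
move=> [M [_ /(_ (M + 1))]]; rewrite ltrDl ltr01 => /(_ isT) fM.
apply: (@measurable_bounded_L2 _ (M + 1)).
  by apply: measurable_funTS; exact: continuous_measurable_fun.
move=> x; rewrite /I01 /= in_itv /= => /andP[x0 x1].
by apply: fM; exists x => //=; rewrite in_itv /= !ltW.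
Qed.

Lemma cvg_inner (p : nat -> R -> R) f g : L2 f -> L2 g -> (forall n, L2 (p n)) ->
  (fun n => l2norm (f \- p n)) @ \oo --> 0 ->
  (fun n => inner (p n) g) @ \oo --> inner f g.
Proof.
move=> Lf Lg Lp fp; apply/cvgrPdist_le => e e0 /=.
have fpg : (fun n => l2norm (f \- p n) * l2norm g) @ \oo --> 0.
  by rewrite -(mul0r (l2norm g)); apply: cvgMl.
move/cvgr0_norm_le : fpg => /(_ _ e0); apply: filterS => n.
rewrite ger0_norm ?mulr_ge0 ?l2norm_ge0//; apply: le_trans.
rewrite -innerBl//; apply: cauchy_schwarz => //; exact: L2B.
Qed.

End L2space.
#[global] Hint Resolve measurable_I01 : core.

(** * Smooth functions *)

Section Smooth.
Variable R : realType.
Implicit Types f g : R -> R.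

(** Existence of derivatives up to order [n + 1]; the recursion on the derivative
    suits inductive proofs of smoothness. *)
Fixpoint Ck (n : nat) f : Prop :=
  (forall x, derivable f x 1) /\ if n is n'.+1 then Ck n' (derive1 f) else True.

Lemma Ck_derivable n f : Ck n f -> forall x, derivable f x 1.
Proof. by case: n => [|n] []. Qed.
Arguments Ck_derivable {n f} _ x : rename.

Lemma CkS n f : Ck n.+1 f -> Ck n f.
Proof. by elim: n f => [|n IH] f [df Cf]; split => //; exact: IH. Qed.

Lemma smoothP f :
  (forall n x, derivable (derive1n n f) x 1) <-> (forall n, Ck n f).
Proof.
have iterC n g : derive1n n.+1 g = derive1n n (derive1 g).
  by rewrite /derive1n iterSr.
split => [df n|Cf n].
  elim: n f df => [|n IH] f df; first by split=> // x; exact: (df 0%N x).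
  split; first by move=> x; exact: (df 0%N x).
  by apply: IH => n' x; rewrite -iterC.
elim: n f Cf => [|n IH] f Cf x; first exact: (Ck_derivable (Cf 0%N)).
by rewrite iterC; apply: IH => m; have [] := Cf m.+1.
Qed.

Lemma is_derive_val (x a b : R) f : is_derive x (1 : R) f a -> a = b ->
  is_derive x (1 : R) f b.
Proof. by move=> h <-. Qed.

Lemma derive1_ext f (df : R -> R) : (forall x : R, is_derive x (1 : R) f (df x)) -> derive1 f = df.
Proof.
by move=> h; apply/funext => x; rewrite derive1E; apply: derive_val.
Qed.

Lemma derivable_is_derive f x : derivable f x 1 -> is_derive x (1 : R) f (derive1 f x).
Proof. by move=> df; rewrite derive1E; exact: derivableP. Qed.

Lemma Ck_ext n f (df : R -> R) : (forall x : R, is_derive x (1 : R) f (df x)) ->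
  Ck n df -> Ck n.+1 f.
Proof.
move=> h C; split => [x|]; first by have := h x => -[].
by rewrite (derive1_ext h).
Qed.

Lemma Ck_cst n (c : R) : Ck n (fun=> c).
Proof.
elim: n c => [|n IH] c; first by split => // x; exact: derivable_cst.
by apply: (@Ck_ext _ _ (fun=> 0)); exact: IH.
Qed.

Lemma Ck_id n : Ck n (fun x : R => x).
Proof.
case: n => [|n]; first by split => // x; exact: derivable_id.
by apply: (@Ck_ext _ _ (fun=> 1)); exact: Ck_cst.
Qed.

Lemma CkD n f g : Ck n f -> Ck n g -> Ck n (f \+ g).
Proof.
elim: n f g => [|n IH] f g [df Cf] [dg Cg].
  by split; last by []; move=> x; exact: derivableD.
apply: (@Ck_ext _ _ (derive1 f \+ derive1 g)); last exact: IH.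
by move=> x; apply: is_deriveD; exact: derivable_is_derive.
Qed.

Lemma CkM n f g : Ck n f -> Ck n g -> Ck n (f \* g).
Proof.
elim: n f g => [|n IH] f g.
  by move=> [df _] [dg _]; split; last by []; move=> x; exact: derivableM.
move=> Cf Cg; have [df Cf'] := Cf; have [dg Cg'] := Cg.
apply: (@Ck_ext _ _ ((f \* derive1 g) \+ (g \* derive1 f))).
  by move=> x; apply: is_deriveM; exact: derivable_is_derive.
by apply: CkD; apply: IH => //; exact: CkS.
Qed.

Lemma Ck_comp n f g : Ck n f -> Ck n g -> Ck n (f \o g).
Proof.
elim: n f g => [|n IH] f g.
  move=> [df _] [dg _]; split; last by []; move=> x.
  apply: ex_derive; apply: is_derive1_comp; exact: derivable_is_derive.
move=> Cf Cg; have [df Cf'] := Cf; have [dg Cg'] := Cg.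
apply: (@Ck_ext _ _ ((derive1 f \o g) \* derive1 g)); first last.
  by apply: CkM => //; apply: IH => //; exact: CkS.
by move=> x; apply: is_derive1_comp; exact: derivable_is_derive.
Qed.

Lemma Ck_sin_cos n (a : R) :
  Ck n (fun x => sin (a * x)) /\ Ck n (fun x => cos (a * x)).
Proof.
have ds x : is_derive x (1 : R) (fun x => sin (a * x)) (a * cos (a * x)).
  have -> : a * cos (a * x) = cos (a * x) * a by rewrite mulrC.
  apply: (@is_derive1_comp _ sin (fun x => a * x)).
  rewrite -[X in is_derive _ _ _ X]mulr1.
  exact: is_deriveZ.
have dc x : is_derive x (1 : R) (fun x => cos (a * x)) (- a * sin (a * x)).
  have -> : - a * sin (a * x) = (- sin (a * x)) * a by rewrite !mulNr mulrC.
  apply: (@is_derive1_comp _ cos (fun x => a * x)).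
  rewrite -[X in is_derive _ _ _ X]mulr1.
  exact: is_deriveZ.
elim: n => [|n [IHs IHc]].
  by split; split; do ?[exact: I|]; move=> x; [have [] := ds x|have [] := dc x].
split.
  by apply: (Ck_ext ds); apply: CkM => //; exact: Ck_cst.
by apply: (Ck_ext dc); apply: CkM => //; exact: Ck_cst.
Qed.

(** [flat k y = y^-k exp (-1/y)] for [y > 0], extended by zero.  The inverse
    powers make the family closed under differentiation. *)
Definition flat (k : nat) (y : R) : R :=
  if 0 < y then y ^- k * expR (- y^-1) else 0.

Lemma flat_le k y : `|flat k y| <= k.+2`!%:R * y ^+ 2.
Proof.
rewrite /flat; case: ifPn => [y0|_]; last by rewrite normr0 mulr_ge0 ?sqr_ge0.
rewrite ger0_norm ?mulr_ge0 ?expR_ge0 ?invr_ge0 ?exprn_ge0 ?(ltW y0)//.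
have yV0 : 0 <= y^-1 by rewrite invr_ge0 ltW.
(* [exp s >= s ^ (k + 2) / (k + 2)!] at [s = 1 / y] *)
have := expR_ge1Dxn k.+1 yV0.
have kf0 : 0 < (k.+2`!%:R : R) by rewrite ltr0n fact_gt0.
move=> /(le_trans (ler_wpDl ler01 (lexx _))).
rewrite ler_pdivrMr// exprVn => h.
rewrite expRN ler_pdivrMr ?expR_gt0// -mulrA [y ^+ 2 * _]mulrC mulrA.
have -> : y ^- k = y ^- k.+2 * y ^+ 2.
  by rewrite -addn2 exprD invfM -mulrA mulVf ?mulr1// sqrf_eq0 gt_eqF.
by rewrite ler_wpM2r ?sqr_ge0// mulrC.
Qed.

Lemma is_derive0_quadratic f (c : R) : (forall y, `|f y| <= c * y ^+ 2) ->
  is_derive (0 : R) (1 : R) f 0.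
Proof.
move=> fc; have f0 : f 0 = 0.
  by have := fc 0; rewrite expr0n /= mulr0 normr_le0 => /eqP.
have c0 : 0 <= c by have := le_trans (normr_ge0 _) (fc 1); rewrite expr1n mulr1.
have h : h^-1 *: ((f \o shift 0) (h *: (1 : R)) - f 0) @[h --> 0^'] --> (0 : R).
  apply: (@cvg_to_0_linear _ _ c 1) => // h /andP[h0 _].
  rewrite /= f0 subr0 addr0 /GRing.scale /= mulr1 normrM normfV.
  rewrite ler_pdivrMl//; apply: (le_trans (fc h)).
  by rewrite -[h ^+ 2]real_normK ?num_real// expr2 mulrCA.
apply: DeriveDef; first by apply/cvg_ex; exists 0.
exact: cvg_lim.
Qed.

Lemma is_derive_flat k (y : R) :
  is_derive y (1 : R) (flat k) (- k%:R * flat k.+1 y + flat k.+2 y).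
Proof.
have [y0|y0|y0] := ltgtP 0 y.
- have yn0 : y != 0 by rewrite gt_eqF.
  have h : is_derive y (1 : R) (fun y => (y^-1) ^+ k * expR (- y^-1))
      (- k%:R * flat k.+1 y + flat k.+2 y).
    rewrite /flat y0.
    have dV : is_derive y (1 : R) (fun z : R => z^-1) (- y ^- 2).
      have := @is_deriveV R (fun z : R => z) y 1 1 yn0 (is_derive_id _ _).
      by move/is_derive_val; apply; rewrite /GRing.scale /= mulr1.
    have dX : is_derive y (1 : R) (fun z : R => (z^-1) ^+ k) (- k%:R * y ^- k.+1).
      have := @is_deriveX _ _ (fun z : R => z^-1) k y 1 _ dV.
      rewrite exprfctE; move/is_derive_val; apply; rewrite /GRing.scale /=.
      case: k => [|k]; first by rewrite mulr0n !mul0r oppr0 mul0r.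
      by rewrite /= -!exprVn !exprS; ring.
    have dE : is_derive y (1 : R) (fun z : R => expR (- z^-1)) (expR (- y^-1) * y ^- 2).
      apply: (@is_derive1_comp _ expR (fun z : R => - z^-1)).
      by rewrite -[y ^- 2]opprK; exact: is_deriveN.
    have := is_deriveM dX dE; move/is_derive_val; apply; rewrite /GRing.scale /=.
    by rewrite -!exprVn !exprS; ring.
  apply: near_eq_is_derive h.
  have : \forall z \near y, 0 < z by exact: lt_nbhsr.
  by apply: filterS => z z0; rewrite /flat z0 exprVn.
- have h : is_derive y (1 : R) (fun=> 0 : R) (- k%:R * flat k.+1 y + flat k.+2 y).
    rewrite /flat (ltNge 0 y) (ltW y0) /= mulr0 addr0; exact: is_derive_cst.
  apply: near_eq_is_derive h.
  have : \forall z \near y, z < 0 by exact: lt_nbhsl.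
  by apply: filterS => z z0; rewrite /flat ltNge (ltW z0).
- rewrite -{}y0 /flat ltxx mulr0 addr0.
  apply: (@is_derive0_quadratic _ k.+2`!%:R) => z.
  exact: flat_le.
Qed.

Lemma Ck_flat n k : Ck n (flat k).
Proof.
elim: n k => [|n IH] k.
  by split; [move=> x; have [] := is_derive_flat k x|].
apply: (Ck_ext (is_derive_flat k)); apply: CkD; last exact: IH.
by apply: CkM; [exact: Ck_cst|exact: IH].
Qed.

End Smooth.
Arguments Ck_derivable {R n f} _ x : rename.

(** * Test functions and weak derivatives *)

Section TestFunctions.
Variable R : realType.
Implicit Types (f g phi : R -> R) (D : set R).
Local Notation mu := (@leb R).
Local Notation I := (@I01 R).

Lemma derivable_cont f : (forall x, derivable f x 1) -> continuous f.
Proof. by move=> df x; apply/differentiable_continuous/derivable1_diffP. Qed.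

Lemma Ck_continuous n f : Ck n f -> continuous f.
Proof. by move=> Cf; apply: derivable_cont; exact: Ck_derivable Cf. Qed.

Lemma Ck_continuous_derive1 n f : Ck n.+1 f -> continuous (derive1 f).
Proof. by move=> [_ Cf]; exact: Ck_continuous Cf. Qed.

Lemma test_Ck D phi n : test_fun D phi -> Ck n phi.
Proof. by move=> [/smoothP h _ _]. Qed.

Lemma test_out D phi x : test_fun D phi -> ~ D x -> phi x = 0.
Proof.
move=> [_ _ sD] nDx; apply/eqP/negP => /negP p0; apply: nDx.
by apply: sD; apply: subset_closure.
Qed.

(** A compact set that contains the nonzero points contains their closure. *)
Lemma test_mk D (K : set R) phi : (forall n, Ck n phi) -> compact K -> K `<=` D ->
  (forall x, phi x != 0 -> K x) -> test_fun D phi.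
Proof.
move=> Cp cK KD pK; have cl : closure [set x | phi x != 0] `<=` K.
  have clK : closed K by apply: compact_closed => //; exact: Rhausdorff.
  by rewrite [X in _ `<=` X]((closure_id K).1 clK); exact: closure_subset.
split; first exact/smoothP.
  by apply: subclosed_compact cK cl; exact: closed_closure.
exact: subset_trans cl KD.
Qed.

Lemma test_sub D phi psi : test_fun D phi -> test_fun D psi -> test_fun D (phi \- psi).
Proof.
move=> Tp Tq; have [_ cp pD] := Tp; have [_ cq qD] := Tq.
apply: (@test_mk _ (closure [set x | phi x != 0] `|` closure [set x | psi x != 0])).
- move=> n; have -> : phi \- psi = phi \+ ((fun=> -1) \* psi).
    by apply/funext => x /=; rewrite mulN1r.
  by apply: CkD; [exact: test_Ck Tp|apply: CkM; [exact: Ck_cst|exact: test_Ck Tq]].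
- exact: compactU.
- by move=> x [/pD|/qD].
- move=> x /= pq; have [p0|p0] := eqVneq (phi x) 0.
    by right; apply: subset_closure => /=; move: pq; rewrite p0 sub0r oppr_eq0.
  by left; apply: subset_closure.
Qed.

Lemma test_derive1 D phi : test_fun D phi -> test_fun D (derive1 phi).
Proof.
move=> Tp; have [_ cp pD] := Tp.
apply: (@test_mk _ (closure [set x | phi x != 0])) => //.
  by move=> n; have [_] := test_Ck n.+1 Tp.
move=> x; apply: contraPP => nx; apply/negP; rewrite negbK; apply/eqP.
have : \forall y \near x, phi y = 0.
  have : \forall y \near x, (~` closure [set x | phi x != 0]) y.
    by apply: open_nbhs_nbhs; split => //; apply: closed_openC; exact: closed_closure.
  apply: filterS => y ny; apply/eqP/negP => /negP p0; apply: ny.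
  exact: subset_closure.
move=> h; rewrite derive1E -(@near_eq_derive _ _ _ (fun=> 0) phi); last first.
  by apply: filterS h => y ->.
by rewrite derive_cst.
Qed.

Lemma continuous_integrable_itv f (a b : R) : continuous f ->
  mu.-integrable `[a, b] (EFin \o f).
Proof.
move=> cf; apply: continuous_compact_integrable; first exact: segment_compact.
exact: continuous_subspaceT.
Qed.

Lemma continuous_integrable_itvo f (a b : R) : continuous f ->
  mu.-integrable `]a, b[ (EFin \o f).
Proof.
move=> cf; apply: (@integrableS _ _ _ mu `[a, b]) => //.
- exact: subset_itv_oo_cc.
- exact: continuous_integrable_itv.
Qed.

Lemma integral_derive1 f (a b : R) : a < b -> Ck 1 f ->
  \int[mu]_(x in `]a, b[) derive1 f x = f b - f a.
Proof.
move=> ab [df Cf].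
have cf' : continuous (derive1 f) by exact: (@Ck_continuous 0).
rewrite Rintegral_itv_obnd_cbnd; last exact: continuous_integrable_itvo.
rewrite Rintegral_itv_bndo_bndc; last first.
  apply: (@integrableS _ _ _ mu `[a, b]) => //.
  - exact: subset_itv_co_cc.
  - exact: continuous_integrable_itv.
have cf : continuous f := derivable_cont df.
have cF : derivable_oo_LRcontinuous f a b.
  split; first by move=> x _; apply: df.
  - by apply: cvg_at_right_filter; exact: cf.
  - by apply: cvg_at_left_filter; exact: cf.
have FE : {in `]a, b[, derive1 f =1 derive1 f} by [].
by rewrite /Rintegral (continuous_FTC2 ab (continuous_subspaceT cf') cF FE).
Qed.

Lemma weak_deriv_Ck1 f : Ck 1 f -> weak_deriv I f (derive1 f).
Proof.
move=> Cf phi Tp.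
have Cp : Ck 1 phi by exact: test_Ck Tp.
have cf := Ck_continuous Cf; have cp := Ck_continuous Cp.
have cf' := Ck_continuous_derive1 Cf; have cp' := Ck_continuous_derive1 Cp.
have := integral_derive1 (@ltr01 R) (CkM Cf Cp).
rewrite /= !(test_out Tp) ?mulr0 ?subr0; last 2 first.
  by rewrite /I01/= in_itv/= ltxx.
  by rewrite /I01/= in_itv/= ltxx andbF.
have -> : derive1 (f \* phi) = (fun x => f x * derive1 phi x + derive1 f x * phi x).
  apply/funext => x; rewrite derive1E; apply: derive_val.
  have := is_deriveM (derivable_is_derive (Ck_derivable Cf x))
    (derivable_is_derive (Ck_derivable Cp x)).
  by move/is_derive_val; apply; rewrite /GRing.scale /= (mulrC (phi x)).
rewrite RintegralD//.
- by move=> /eqP; rewrite addr_eq0 => /eqP.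
- apply: continuous_integrable_itvo => x; apply: cvgM; [exact: cf|exact: cp'].
- apply: continuous_integrable_itvo => x; apply: cvgM; [exact: cf'|exact: cp].
Qed.

(** A smooth function supported in a compact part of [`]a, b[], equal to
    [exp (-1 / (n (x - a) (b - x) - 1))] there; it increases to the indicator
    of [`]a, b[] as [n] grows. *)
Definition bump (n : nat) (a b x : R) : R := flat 0 (n%:R * ((x - a) * (b - x)) - 1).

Lemma flat0_ge0 y : 0 <= flat 0 y :> R.
Proof. by rewrite /flat; case: ifP => // _; rewrite expr0 invr1 mul1r expR_ge0. Qed.

Lemma flat0_le1 y : flat 0 y <= 1 :> R.
Proof.
rewrite /flat; case: ifPn => // y0; rewrite expr0 invr1 mul1r expR_le1.
by rewrite oppr_le0 invr_ge0 ltW.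
Qed.

Lemma flat0_gt0 y : flat 0 y != 0 :> R -> 0 < y.
Proof. by rewrite /flat; case: ifP => //; rewrite eqxx. Qed.

Lemma bump_ge0 n a b x : 0 <= bump n a b x.
Proof. exact: flat0_ge0. Qed.

Lemma bump_le1 n a b x : bump n a b x <= 1.
Proof. exact: flat0_le1. Qed.

Lemma bump_supp n a b x : a <= b -> bump n a b x != 0 -> a < x < b.
Proof.
move=> ab /flat0_gt0; rewrite subr_gt0 => h.
have : 0 < (x - a) * (b - x).
  rewrite ltNge; apply/negP => h0; have := ler_wpM2l (ler0n R n) h0.
  by rewrite mulr0 leNgt (lt_trans ltr01 h).
move=> h0; have [xa|xa] := ltP a x; have [xb|xb] := ltP x b => //; nra.
Qed.

Lemma bump_Ck m n a b : Ck m (bump n a b).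
Proof.
rewrite (_ : bump n a b = flat 0 \o (((fun=> n%:R) \*
   ((id \+ (fun=> - a)) \* ((fun=> b) \+ ((fun=> -1) \* id)))) \+ (fun=> -1))).
  by apply: Ck_comp; [exact: Ck_flat|];
   repeat first [apply: CkD|apply: CkM|exact: Ck_cst|exact: Ck_id].
by apply/funext => x; rewrite /bump/= mulN1r.
Qed.

Lemma bump_closed n a b : a <= b ->
  compact [set x : R | n%:R * ((x - a) * (b - x)) - 1 >= 0] /\
  [set x | n%:R * ((x - a) * (b - x)) - 1 >= 0] `<=` `]a, b[.
Proof.
move=> ab; have sub : [set x | n%:R * ((x - a) * (b - x)) - 1 >= 0] `<=` `]a, b[.
  move=> x /=; rewrite in_itv /= subr_ge0 => h.
  have : 0 < (x - a) * (b - x).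
    rewrite ltNge; apply/negP => h0; have := ler_wpM2l (ler0n R n) h0.
    by rewrite mulr0 leNgt (lt_le_trans ltr01 h).
  by move=> h0; apply/andP; split; nra.
split => //; apply: (@subclosed_compact _ _ `[a, b]).
- apply: (@closed_comp _ _ (fun x => n%:R * ((x - a) * (b - x)) - 1) [set y | 0 <= y]).
    move=> x _; apply: cvgB; last exact: cvg_cst.
    apply: cvgMr; apply: cvgM; first by apply: cvgB; [exact: cvg_id|exact: cvg_cst].
    by apply: cvgB; [exact: cvg_cst|exact: cvg_id].
  exact: closed_ge.
- exact: segment_compact.
- by apply: subset_trans sub _; exact: subset_itv_oo_cc.
Qed.

Lemma test_bump D n a b : a <= b -> `]a, b[ `<=` D -> test_fun D (bump n a b).
Proof.
move=> ab abD; have [cK Kab] := bump_closed n ab.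
apply: (test_mk _ cK) => [m||x]; first exact: bump_Ck.
- exact: subset_trans Kab abD.
- by move=> /flat0_gt0/ltW.
Qed.

Lemma bump_arg_cvgy (q : R) : 0 < q -> (fun n => n%:R * q - 1) @ \oo --> +oo%R.
Proof.
move=> q0; apply/cvgryPge => A; near=> n.
rewrite lerBrDr -ler_pdivrMr//; near: n; exact: nbhs_infty_ger.
Unshelve. all: by end_near. Qed.

Lemma bump_arg_invr_cvg0 (q : R) : 0 < q ->
  (fun n => (n%:R * q - 1)^-1) @ \oo --> (0 : R).
Proof.
move=> /bump_arg_cvgy ynf; apply/gtr0_cvgV0 => //; near=> n.
by near: n; move/cvgryPgt : ynf; exact.
Unshelve. all: by end_near. Qed.

Lemma bump_cvg a b x : a < x < b -> (fun n => bump n a b x) @ \oo --> (1 : R).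
Proof.
move=> /andP[ax xb].
have q0 : 0 < (x - a) * (b - x) by rewrite mulr_gt0 // subr_gt0.
set q := (x - a) * (b - x) in q0 *.
have ynf := bump_arg_cvgy q0; have inv0 := bump_arg_invr_cvg0 q0.
have : (fun n => expR (- (n%:R * q - 1)^-1)) @ \oo --> (1 : R).
  have e0 : expR (- 0) = 1 :> R by rewrite oppr0 expR0.
  rewrite -[X in _ --> X]e0; apply: continuous_cvg; first exact: continuous_expR.
  exact: cvgN.
apply: cvg_trans; apply: near_eq_cvg; near=> n.
rewrite /bump /flat -/q ifT; first by rewrite expr0 invr1 mul1r.
have : 1 <= n%:R * q - 1 by near: n; move/cvgryPge : ynf; exact.
exact: lt_le_trans.
Unshelve. all: by end_near. Qed.

Lemma measurable_bump D n a b : measurable_fun D (bump n a b).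
Proof.
by apply: measurable_funTS; apply: continuous_measurable_fun; exact: Ck_continuous (bump_Ck 0 n a b).
Qed.

Lemma Rintegral_bump_restrict D g n a b : a <= b -> `]a, b[ `<=` D ->
  \int[mu]_(x in D) (g x * bump n a b x) = \int[mu]_(x in `]a, b[) (g x * bump n a b x).
Proof.
move=> ab abD; rewrite Rintegral_mkcond [RHS]Rintegral_mkcond.
apply: eq_Rintegral => x _; rewrite !patchE.
have [xab|xab] := boolP (x \in `]a, b[%classic).
  by rewrite ifT // inE; apply: abD; rewrite inE in xab.
case: ifP => // _; apply/eqP; rewrite mulf_eq0; apply/orP; right.
apply: contraNT xab => /(bump_supp ab) h; by rewrite inE /= in_itv.
Qed.

Lemma bump_integral_cvg D g a b : a <= b -> `]a, b[ `<=` D ->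
  mu.-integrable `]a, b[ (EFin \o g) ->
  (fun n => \int[mu]_(x in D) (g x * bump n a b x)) @ \oo -->
    \int[mu]_(x in `]a, b[) g x.
Proof.
move=> ab abD gi.
under eq_fun do rewrite (Rintegral_bump_restrict _ _ ab abD).
have mg : measurable_fun `]a, b[ g by move/integrableP: gi => [/measurable_EFinP].
have [] := @dominated_convergence _ _ _ mu `]a, b[ (measurable_itv _)
  (fun n x => (g x * bump n a b x)%:E) (EFin \o g) (fun x => `|g x|%:E).
- by move=> n; apply/measurable_EFinP; apply: measurable_funM => //; exact: measurable_bump.
- exact/measurable_EFinP.
- apply: aeW => x /=; rewrite in_itv /= => xab.
  apply: cvg_EFin; first by near=> n.
  rewrite -[X in _ --> X]mulr1; apply: cvgMr; exact: bump_cvg.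
- exact: integrable_norm gi.
- apply: aeW => x n _ /=; rewrite lee_fin normrM ler_piMr//.
  by rewrite ger0_norm ?bump_ge0 ?bump_le1.
move=> gi' _; rewrite -(fineK (integrable_fin_num _ gi)) => [/fine_cvg//|].
exact: measurable_itv.
Unshelve. all: by end_near. Qed.

(** The bumps increase to indicators of intervals, so that the integral of [g]
    over each subinterval is zero; almost everywhere its derivative is [g]. *)
Lemma orthogonal_test_ae0 g : L2 g ->
  (forall phi, test_fun I phi -> \int[mu]_(x in I) (g x * phi x) = 0) ->
  {ae mu, forall x, I x -> g x = 0}.
Proof.
move=> Lg h.
have gi : mu.-integrable I (EFin \o g).
  have L1 : L2 (fun=> 1 : R) by apply: continuous_L2 => x; exact: cvg_cst.
  have := L2_mul_integrable Lg L1; by apply: eq_integrable => // x _ /=; rewrite mulr1.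
have g0 a b : 0 <= a -> a <= b -> b <= 1 -> \int[mu]_(x in `]a, b[) g x = 0.
  move=> a0 ab b1; have abI : `]a, b[ `<=` I.
    move=> x; rewrite /I01 /= !in_itv /= => /andP[ax xb].
    by rewrite (le_lt_trans a0 ax) (lt_le_trans xb b1).
  have gab : mu.-integrable `]a, b[ (EFin \o g).
    by apply: integrableS gi => //; exact: measurable_itv.
  have := bump_integral_cvg ab abI gab.
  rewrite (_ : (fun _ => _) = (fun=> 0)); last first.
    by apply/funext => n; apply: h; exact: test_bump.
  by move=> /cvg_lim <-//; rewrite lim_cst.
have gT : mu.-integrable setT (EFin \o (g \_ I)).
  by have := (@integrable_mkcond _ _ _ mu I (EFin \o g) (@measurable_I01 R)).1 gi; rewrite restrict_EFin.
pose F (y : R) := \int[mu]_(t in [set` `]-oo, y]]) (g \_ I) t.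
have ftc : {ae mu, forall y : R, derivable F y (1 : R) /\ derive1 F y = (g \_ I) y}.
  apply: FTC1Ny.
    by move=> y; apply: integrableS gT => //; exact: measurable_itv.
  exact: (@integrable_locally R g I (@measurable_I01 R) gi).
move: ftc.
have -> : F = (fun=> 0).
  apply/funext => x; rewrite /F -Rintegral_mkcondr.
  have [x0|x0] := leP x 0.
    rewrite (_ : _ `&` _ = set0) ?Rintegral_set0//; apply/seteqP; split => y //=.
    by rewrite /I01 /= !in_itv /= => -[yx /andP[y0 _]]; have := lt_le_trans y0 (le_trans yx x0); rewrite ltxx.
  have [x1|x1] := leP 1 x.
    rewrite (_ : _ `&` _ = `]0, 1[%classic); first exact: g0.
    apply/seteqP; split => y /=; rewrite /I01 /= !in_itv /=; first by case.
    by move=> /andP[y0 y1]; rewrite y0 y1 (le_trans (ltW y1) x1).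
  rewrite (_ : _ `&` _ = `]0, x]%classic).
    rewrite -Rintegral_itv_bndo_bndc; first by rewrite g0// ltW.
    apply: integrableS gi => //.
    move=> y; rewrite /I01 /= !in_itv /= => /andP[-> yx]; exact: lt_trans yx x1.
  apply/seteqP; split => y /=; rewrite /I01 /= !in_itv /=.
    by move=> [-> /andP[-> _]].
  by move=> /andP[y0 yx]; rewrite y0 yx (le_lt_trans yx x1).
apply: filterS => x [_]; rewrite derive1E derive_cst patchE => /esym + Ix.
by rewrite ifT // inE.
Qed.

Lemma weak_deriv_unique f g g' : L2 g -> L2 g' ->
  weak_deriv I f g -> weak_deriv I f g' -> {ae mu, forall x, I x -> g x = g' x}.
Proof.
move=> Lg Lg' fg fg'; have : {ae mu, forall x, I x -> (g \- g') x = 0}.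
  apply: orthogonal_test_ae0; first exact: L2B.
  move=> phi Tp; have Lp : L2 phi by apply: continuous_L2; exact: Ck_continuous (test_Ck 0 Tp).
  have := innerBl Lg Lg' Lp; rewrite /inner => ->.
  by apply/eqP; rewrite subr_eq0; apply/eqP/oppr_inj; rewrite -(fg _ Tp) (fg' _ Tp).
by apply: filterS => x h Ix; apply/eqP; rewrite -subr_eq0; exact/eqP/h.
Qed.

End TestFunctions.

(** * The spaces H^1 and H^1_0 *)

Section Sobolev.
Variable R : realType.
Implicit Types (f g phi : R -> R) (D : set R).
Local Notation mu := (@leb R).
Local Notation I := (@I01 R).

Lemma Ck_L2 n f : Ck n f -> L2 f.
Proof. by move=> Cf; apply: continuous_L2; exact: Ck_continuous Cf. Qed.

Lemma test_L2 phi : test_fun I phi -> L2 phi.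
Proof. by move=> Tp; exact: Ck_L2 (test_Ck 0 Tp). Qed.

Lemma test_derive1_L2 phi : test_fun I phi -> L2 (derive1 phi).
Proof. by move=> Tp; apply: test_L2; exact: test_derive1. Qed.

Lemma weak_deriv_test phi : test_fun I phi -> weak_deriv I phi (derive1 phi).
Proof. by move=> Tp; apply: weak_deriv_Ck1; exact: test_Ck Tp. Qed.

Lemma sob1_Ck1 f : Ck 1 f -> sob1 f.
Proof.
move=> Cf; split; first exact: Ck_L2 Cf.
exists (derive1 f); split; last exact: weak_deriv_Ck1.
by apply: continuous_L2; exact: Ck_continuous_derive1 Cf.
Qed.

Lemma Dx_spec f : sob1 f -> L2 (Dx f) /\ weak_deriv I f (Dx f).
Proof.
move=> [_ fg]; have := @xgetPex _ (fun=> 0) [set g : R -> R | L2 g /\ weak_deriv I f g] fg.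
by [].
Qed.

Lemma sob1_L2 f : sob1 f -> L2 f. Proof. by case. Qed.

Lemma sob10_L2 f : sob10 f -> L2 f. Proof. by case=> -[]. Qed.

Lemma Dx_L2 f : sob1 f -> L2 (Dx f). Proof. by case/Dx_spec. Qed.

Lemma sob10_sob1 f : sob10 f -> sob1 f. Proof. by case. Qed.

Lemma Dx_ae f g : L2 f -> L2 g -> weak_deriv I f g ->
  {ae mu, forall x, I x -> Dx f x = g x}.
Proof.
move=> Lf Lg fg; have [LD wD] : L2 (Dx f) /\ weak_deriv I f (Dx f).
  by apply: Dx_spec; split => //; exists g.
exact: weak_deriv_unique wD fg.
Qed.

Lemma Dx_Ck1_ae f : Ck 1 f -> {ae mu, forall x, I x -> Dx f x = derive1 f x}.
Proof.
move=> Cf; apply: Dx_ae; [exact: Ck_L2 Cf| |exact: weak_deriv_Ck1].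
by apply: continuous_L2; exact: Ck_continuous_derive1 Cf.
Qed.

Lemma weak_deriv_inner f g phi : weak_deriv I f g -> test_fun I phi ->
  inner f (derive1 phi) = - inner g phi.
Proof. by move=> h /h. Qed.

Lemma weak_derivB f f' g g' : L2 f -> L2 f' -> L2 g -> L2 g' ->
  weak_deriv I f f' -> weak_deriv I g g' -> weak_deriv I (f \- g) (f' \- g').
Proof.
move=> Lf Lf' Lg Lg' wf wg phi Tp.
have Lp := test_L2 Tp; have Lp' := test_derive1_L2 Tp.
have := innerBl Lf Lg Lp'; rewrite {1}/inner => ->.
have := innerBl Lf' Lg' Lp; rewrite {1}/inner => ->.
by rewrite (weak_deriv_inner wf Tp) (weak_deriv_inner wg Tp) opprB opprK addrC.
Qed.

Lemma sob1B f g : sob1 f -> sob1 g -> sob1 (f \- g).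
Proof.
move=> sf sg; have [Lf' wf] := Dx_spec sf; have [Lg' wg] := Dx_spec sg.
have Lf := sob1_L2 sf; have Lg := sob1_L2 sg.
split; first exact: L2B.
by exists (Dx f \- Dx g); split; [exact: L2B|exact: weak_derivB].
Qed.

Lemma DxB_ae f g : sob1 f -> sob1 g ->
  {ae mu, forall x, I x -> Dx (f \- g) x = (Dx f \- Dx g) x}.
Proof.
move=> sf sg; have [Lf' wf] := Dx_spec sf; have [Lg' wg] := Dx_spec sg.
have Lf := sob1_L2 sf; have Lg := sob1_L2 sg.
by apply: Dx_ae; [exact: L2B|exact: L2B|exact: weak_derivB].
Qed.

Lemma l2norm_le_h1norm f : l2norm f <= h1norm f.
Proof.
rewrite /h1norm -[leLHS](ger0_norm (l2norm_ge0 f)) -sqrtr_sqr ler_sqrt.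
  by rewrite lerDl sqr_ge0.
by rewrite addr_ge0 ?sqr_ge0.
Qed.

Lemma l2normDx_le_h1norm f : l2norm (Dx f) <= h1norm f.
Proof.
rewrite /h1norm -[leLHS](ger0_norm (l2norm_ge0 _)) -sqrtr_sqr ler_sqrt.
  by rewrite lerDr sqr_ge0.
by rewrite addr_ge0 ?sqr_ge0.
Qed.

Lemma squeeze0 (a b : nat -> R) : (forall n, 0 <= a n) -> (forall n, a n <= b n) ->
  b @ \oo --> 0 -> a @ \oo --> 0.
Proof.
move=> a0 ab b0; apply: (squeeze_cvgr _ (cvg_cst 0) b0).
by apply: nearW => n; rewrite a0 ab.
Qed.

Lemma cvgD0 (a b : nat -> R) : a @ \oo --> 0 -> b @ \oo --> 0 ->
  (fun n => a n + b n) @ \oo --> 0.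
Proof. by move=> a0 b0; rewrite -[X in _ --> X](addr0 0); exact: cvgD. Qed.

(** The form in which membership in [H^1_0] is used: test functions converge
    to [f] together with their classical derivatives. *)
Definition test_approx f g (p : nat -> R -> R) :=
  [/\ forall n, test_fun I (p n),
      (fun n => l2norm (f \- p n)) @ \oo --> 0 &
      (fun n => l2norm (g \- derive1 (p n))) @ \oo --> 0].

Lemma sob10_approx f : sob10 f -> exists p, test_approx f (Dx f) p.
Proof.
move=> [sf [p [Tp fp]]]; exists p; split => //.
  by apply: squeeze0 fp => n; [exact: l2norm_ge0|exact: l2norm_le_h1norm].
apply: squeeze0 fp => n; first exact: l2norm_ge0.
have sp : sob1 (p n) by apply: sob1_Ck1; exact: test_Ck (Tp n).
rewrite (@l2norm_ae _ _ (Dx (f \- p n))).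
- exact: l2normDx_le_h1norm.
- by apply: L2B; [exact: Dx_L2|exact: test_derive1_L2].
- by apply: Dx_L2; exact: sob1B.
- apply: filterS2 (DxB_ae sf sp) (Dx_Ck1_ae (test_Ck 1 (Tp n))) => x h1 h2 Ix.
  by rewrite h1//= h2.
Qed.

Lemma approx_sob10 f g p : L2 f -> L2 g -> weak_deriv I f g ->
  test_approx f g p -> sob10 f.
Proof.
move=> Lf Lg fg [Tp fp gp].
have sf : sob1 f by split => //; exists g.
split => //; exists p; split => //.
have : (fun n => l2norm (f \- p n) + l2norm (g \- derive1 (p n))) @ \oo --> 0.
  exact: cvgD0.
apply: squeeze0 => n; first exact: sqrtr_ge0.
have sp : sob1 (p n) by apply: sob1_Ck1; exact: test_Ck (Tp n).
rewrite /h1norm (_ : l2norm (Dx (f \- p n)) = l2norm (g \- derive1 (p n))).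
  rewrite -[leRHS]ger0_norm ?addr_ge0 ?l2norm_ge0// -sqrtr_sqr ler_sqrt ?sqr_ge0//.
  by rewrite sqrrD lerD2r lerDl mulrn_wge0// mulr_ge0 ?l2norm_ge0.
apply: l2norm_ae.
- by apply: Dx_L2; exact: sob1B.
- by apply: L2B => //; exact: test_derive1_L2.
- apply: Dx_ae.
  + by apply: L2B => //; exact: test_L2.
  + by apply: L2B => //; exact: test_derive1_L2.
  + apply: weak_derivB => //; [exact: test_L2|exact: test_derive1_L2|exact: weak_deriv_test].
Qed.

Lemma test_sob10 phi : test_fun I phi -> sob10 phi.
Proof.
move=> Tp; apply: (@approx_sob10 _ (derive1 phi) (fun=> phi)).
- exact: test_L2.
- exact: test_derive1_L2.
- exact: weak_deriv_test.
- have h f : (fun n : nat => l2norm (f \- f)) @ \oo --> (0 : R).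
    rewrite (_ : f \- f = fun=> 0); last by apply/funext => x /=; rewrite subrr.
    by rewrite /l2norm inner0l sqrtr0; exact: cvg_cst.
  by split => //; exact: h.
Qed.

Lemma sob10B f g : sob10 f -> sob10 g -> sob10 (f \- g).
Proof.
move=> hf hg; have sf := sob10_sob1 hf; have sg := sob10_sob1 hg.
have [p [Tp fp fp']] := sob10_approx hf; have [q [Tq gq gq']] := sob10_approx hg.
have [Lf' wf] := Dx_spec sf; have [Lg' wg] := Dx_spec sg.
have Lf := sob1_L2 sf; have Lg := sob1_L2 sg.
apply: (@approx_sob10 _ (Dx f \- Dx g) (fun n => p n \- q n)).
- exact: L2B.
- exact: L2B.
- exact: weak_derivB.
have aux (a b c d : R -> R) : L2 a -> L2 b -> L2 c -> L2 d ->
    l2norm ((a \- b) \- (c \- d)) <= l2norm (a \- c) + l2norm (b \- d).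
  move=> La Lb Lc Ld; rewrite (_ : _ \- _ = (a \- c) \- (b \- d)).
    by apply: l2normB; exact: L2B.
  by apply/funext => x /=; ring.
split.
- by move=> n; exact: test_sub.
- have : (fun n => l2norm (f \- p n) + l2norm (g \- q n)) @ \oo --> 0.
    exact: cvgD0.
  by apply: squeeze0 => n; [exact: l2norm_ge0|apply: aux => //; exact: test_L2].
- have : (fun n => l2norm (Dx f \- derive1 (p n)) + l2norm (Dx g \- derive1 (q n))) @ \oo --> 0.
    exact: cvgD0.
  apply: squeeze0 => n; first exact: l2norm_ge0.
  rewrite (_ : derive1 (p n \- q n) = derive1 (p n) \- derive1 (q n)).
    by apply: aux => //; exact: test_derive1_L2.
  apply: derive1_ext => x.
  by apply: is_deriveB; apply: derivable_is_derive;
     [exact: (Ck_derivable (test_Ck 0 (Tp n)))|exact: (Ck_derivable (test_Ck 0 (Tq n)))].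
Qed.

(** Integration by parts without boundary terms: it holds for test functions
    by definition of the weak derivative, and both sides are continuous for the
    [H^1] convergence. *)
Lemma sob10_ibp f g : sob10 f -> sob1 g -> inner (Dx f) g = - inner f (Dx g).
Proof.
move=> hf sg; have [p [Tp fp fp']] := sob10_approx hf.
have [Lg' wg] := Dx_spec sg; have Lg := sob1_L2 sg.
have Lf := sob10_L2 hf; have Lf' := Dx_L2 (sob10_sob1 hf).
have h1 := cvg_inner Lf' Lg (fun n => test_derive1_L2 (Tp n)) fp'.
have h2 := cvg_inner Lf Lg' (fun n => test_L2 (Tp n)) fp.
have h3 : (fun n => inner (derive1 (p n)) g) @ \oo --> - inner f (Dx g).
  rewrite (_ : (fun _ => _) = (fun n => - inner (p n) (Dx g))); first exact: cvgN.
  by apply/funext => n; rewrite innerC (weak_deriv_inner wg (Tp n)) innerC.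
by rewrite -(cvg_lim _ h1)// (cvg_lim _ h3).
Qed.

End Sobolev.

(** * Sines and cosines *)

Section Sines.
Variable R : realType.
Implicit Types (f g phi : R -> R) (D : set R).
Local Notation mu := (@leb R).
Local Notation I := (@I01 R).

Lemma l2norm_bounded_cvg0 (F : nat -> R -> R) (K : R) :
  (forall n, measurable_fun I (F n)) ->
  (forall n x, I x -> `|F n x| <= K) ->
  (forall x, I x -> F ^~ x @ \oo --> 0) ->
  (fun n => l2norm (F n)) @ \oo --> 0.
Proof.
move=> mF FK F0.
have [] := @dominated_convergence _ _ _ mu I (@measurable_I01 R)
  (fun n x => (F n x * F n x)%:E) (fun=> 0%E) (fun=> (K ^+ 2)%:E).
- by move=> n; apply/measurable_EFinP; apply: measurable_funM; exact: mF.
- exact: measurable_cst.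
- apply: aeW => x Ix; apply: cvg_EFin; first by near=> n.
  by rewrite -[X in _ --> X](mulr0 0); apply: cvgM; exact: F0.
- apply: measurable_bounded_integrable => //; first exact: leb_I01_lty.
  by exists `|K ^+ 2|; split; [exact: num_real|move=> y Ky x _ /=; exact: ltW].
- apply: aeW => x n Ix; rewrite lee_fin -expr2 ger0_norm ?sqr_ge0//.
  rewrite -[leLHS]real_normK ?num_real// lerXn2r ?nnegrE ?FK//.
  exact: le_trans (FK n _ Ix).
move=> _ _; rewrite integral0 => /fine_cvg h.
have -> : (fun n => l2norm (F n)) = (fun n => Num.sqrt (inner (F n) (F n))) by [].
rewrite -[X in _ --> X]sqrtr0; apply: continuous_cvg; last exact: h.
exact: sqrt_continuous.
Unshelve. all: by end_near. Qed.

Lemma flat_bound k (y : R) : flat k y <= k`!%:R.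
Proof.
rewrite /flat; case: ifPn => [y0|_]; last by rewrite ler0n.
have yV0 : 0 <= y^-1 by rewrite invr_ge0 ltW.
rewrite expRN ler_pdivrMr ?expR_gt0// -exprVn.
case: k => [|k].
  by rewrite expr0 fact0 mul1r -[leLHS]expR0 ler_expR.
have := expR_ge1Dxn k yV0.
have kf0 : 0 < (k.+1`!%:R : R) by rewrite ltr0n fact_gt0.
move=> /(le_trans (ler_wpDl ler01 (lexx _))).
by rewrite ler_pdivrMr// mulrC.
Qed.

Lemma flat_ge0 k (y : R) : 0 <= flat k y.
Proof.
rewrite /flat; case: ifPn => // y0.
by rewrite mulr_ge0 ?expR_ge0 ?invr_ge0 ?exprn_ge0 ?ltW.
Qed.

Lemma flatS_mul k (y : R) : y * flat k.+1 y = flat k y.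
Proof.
rewrite /flat; case: ifPn => [y0|_]; last by rewrite mulr0.
by rewrite mulrA exprS invfM mulrA divff ?mul1r// gt_eqF.
Qed.

(** By the mean value theorem [f] grows at most linearly away from both end
    points, and [x] or [1 - x] is at most [2 x (1 - x)]. *)
Lemma smooth_boundary_bound f : Ck 1 f -> f 0 = 0 -> f 1 = 0 ->
  exists2 M : R, 0 <= M & forall x : R, 0 <= x <= 1 ->
    [/\ `|f x| <= M, `|derive1 f x| <= M & `|f x| <= 2 * M * (x * (1 - x))].
Proof.
move=> Cf f0 f1; have cf' := Ck_continuous_derive1 Cf; have cf := Ck_continuous Cf.
have [M M0 fM] : exists2 M : R, 0 <= M & forall x : R, 0 <= x <= 1 -> `|derive1 f x| <= M.
  have := @segment_compact R 0 1.
  move=> /(continuous_compact (continuous_subspaceT cf')) /compact_bounded.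
  move=> [M [_ /(_ (`|M| + 1))]]; rewrite (le_lt_trans (ler_norm _)) ?ltrDl// => /(_ isT) fM.
  exists (`|M| + 1); first by rewrite addr_ge0.
  by move=> x x01; apply: fM; exists x => //=; rewrite in_itv.
have mvt a b : 0 <= a -> a < b -> b <= 1 -> `|f b - f a| <= M * (b - a).
  move=> a0 ab b1.
  have [|c] := @MVT R f (derive1 f) a b ab _ (continuous_subspaceT cf).
    by move=> x _; apply: derivable_is_derive; exact: Ck_derivable Cf x.
  rewrite in_itv /= => /andP[ac cb] ->; rewrite normrM [X in _ * X]gtr0_norm ?subr_gt0//.
  by rewrite ler_wpM2r ?subr_ge0 ?(ltW ab)// fM// (le_trans a0 (ltW ac)) (le_trans (ltW cb) b1).
exists M => // x /andP[x0 x1].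
have fx : `|f x| <= M * x.
  move: x0; rewrite le_eqVlt => /predU1P[<-|x0]; first by rewrite f0 normr0 mulr0.
  by have := mvt _ _ (lexx 0) x0 x1; rewrite f0 !subr0.
have fx1 : `|f x| <= M * (1 - x).
  move: x1; rewrite le_eqVlt => /predU1P[->|x1]; first by rewrite f1 normr0 subrr mulr0.
  by have := mvt _ _ x0 x1 (lexx 1); rewrite f1 sub0r normrN.
split.
- by apply: (le_trans fx); rewrite ler_piMr.
- by apply: fM; rewrite x0.
- have [xh|xh] := leP x (1 / 2).
    apply: (le_trans fx); rewrite -mulrA mulrCA ler_wpM2l// mulrCA; nra.
  apply: (le_trans fx1); rewrite -mulrA mulrCA ler_wpM2l//; nra.
Qed.

Lemma derive1_bump n (x : R) :
  is_derive x (1 : R) (bump n 0 1) (n%:R * (1 - 2 * x) * flat 2 (n%:R * (x * (1 - x)) - 1)).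
Proof.
have -> : bump n 0 1 = flat 0 \o (fun x : R => n%:R * (x * (1 - x)) - 1).
  by apply/funext => y; rewrite /bump /= subr0.
have dq : is_derive x (1 : R) (fun x : R => n%:R * (x * (1 - x)) - 1) (n%:R * (1 - 2 * x)).
  have h1 : is_derive x (1 : R) (fun x : R => 1 - x) (-1).
    have := is_deriveB (is_derive_cst (1 : R) x (1 : R)) (is_derive_id x (1 : R)).
    by move/is_derive_val; apply; rewrite sub0r.
  have h2 := is_deriveM (is_derive_id x (1 : R)) h1.
  have h3 := is_deriveB (is_deriveZ n%:R h2) (is_derive_cst (1 : R) x (1 : R)).
  by move/is_derive_val: h3; apply; rewrite /GRing.scale /=; ring.
have df := is_derive_flat 0 (n%:R * (x * (1 - x)) - 1).
have := @is_derive1_comp _ _ (fun x : R => n%:R * (x * (1 - x)) - 1) _ _ _ df dq.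
by move/is_derive_val; apply; ring.
Qed.

(** Multiplication by the cutoff [bump n 0 1]: the product of [f] with the
    derivative of the cutoff stays bounded, because [f] vanishes linearly at
    the end points, and tends to zero pointwise. *)
Lemma smooth_sob10 f : (forall n, Ck n f) -> f 0 = 0 -> f 1 = 0 -> sob10 f.
Proof.
move=> Cf f0 f1; have Cf1 := Cf 1%N.
have [M M0 fM] := smooth_boundary_bound Cf1 f0 f1.
have I01W x : I x -> 0 <= x <= 1.
  by rewrite /I01/= in_itv/= => /andP[x0 x1]; rewrite !ltW.
have Cp m n : Ck m (f \* bump n 0 1) by apply: CkM => //; exact: bump_Ck.
have pE n : derive1 (f \* bump n 0 1) =
    (fun x => derive1 f x * bump n 0 1 x +
      f x * (n%:R * (1 - 2 * x) * flat 2 (n%:R * (x * (1 - x)) - 1))).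
  apply: derive1_ext => x.
  have := is_deriveM (derivable_is_derive (Ck_derivable Cf1 x)) (derive1_bump n x).
  by move/is_derive_val; apply; rewrite /GRing.scale /= addrC mulrC.
have Cf' : continuous (derive1 f) := Ck_continuous_derive1 Cf1.
have mC (h : R -> R) : continuous h -> measurable_fun I h.
  by move=> ch; apply: measurable_funTS; exact: continuous_measurable_fun.
(* [n x (1 - x) = y + 1] for the argument [y] of [flat], and [y * flat 2 y = flat 1 y] *)
have key n x : I x -> `|f x * (n%:R * (1 - 2 * x) * flat 2 (n%:R * (x * (1 - x)) - 1))|
    <= 2 * M * (flat 1 (n%:R * (x * (1 - x)) - 1) + flat 2 (n%:R * (x * (1 - x)) - 1)).
  move=> Ix; have [_ _ fxM] := fM x (I01W x Ix); have /andP[x0 x1] := I01W x Ix.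
  rewrite -(flatS_mul 1); set y := _ - 1; have -> : y * flat 2 y + flat 2 y = n%:R * (x * (1 - x)) * flat 2 y.
    by rewrite /y; ring.
  rewrite !normrM [X in _ * (_ * X)]ger0_norm ?flat_ge0// !mulrA ler_wpM2r ?flat_ge0//.
  rewrite (ger0_norm (ler0n R n)).
  have h1 : `|1 - 2 * x| <= 1 by rewrite ler_norml; apply/andP; split; lra.
  have h2 : `|f x| * `|1 - 2 * x| <= 2 * M * (x * (1 - x)) * 1 by apply: ler_pM.
  have := ler_wpM2l (ler0n R n) h2.
  by move: (`|f x|) (`|1 - 2 * x|) (n%:R : R) => a b c; lra.
apply: (@approx_sob10 _ _ (derive1 f) (fun n => f \* bump n 0 1)).
- exact: Ck_L2 Cf1.
- exact: continuous_L2.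
- exact: weak_deriv_Ck1.
split.
- move=> n; have [cK Kab] := @bump_closed R n 0 1 ler01.
  apply: (test_mk _ cK) => // x; rewrite mulf_eq0 negb_or => /andP[_].
  by move=> /flat0_gt0/ltW.
- apply: (@l2norm_bounded_cvg0 _ M).
  + by move=> n; apply: measurable_funB; apply: mC; [exact: Ck_continuous Cf1|exact: Ck_continuous (Cp 0%N n)].
  + move=> n x Ix; have [fxM _ _] := fM x (I01W x Ix).
    rewrite /= -[X in X - _]mulr1 -mulrBr normrM.
    apply: le_trans fxM; rewrite ler_piMr// ger0_norm ?subr_ge0 ?bump_le1//.
    by rewrite gerBl bump_ge0.
  + move=> x; rewrite /I01/= in_itv/= => Ix.
    rewrite -[X in _ --> X](subrr (f x)); apply: cvgB; first exact: cvg_cst.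
    by rewrite -[X in _ --> X]mulr1; apply: cvgMr; exact: bump_cvg.
- apply: (@l2norm_bounded_cvg0 _ (M + 6 * M)).
  + move=> n; apply: measurable_funB; apply: mC => //.
    exact: Ck_continuous_derive1 (Cp 1%N n).
  + move=> n x Ix; have [_ f'M fxM] := fM x (I01W x Ix).
    rewrite pE.
    rewrite (_ : (derive1 f \- _) x = derive1 f x * (1 - bump n 0 1 x) -
      f x * (n%:R * (1 - 2 * x) * flat 2 (n%:R * (x * (1 - x)) - 1))); last by rewrite /=; ring.
    apply: (le_trans (ler_normB _ _)); apply: lerD.
      rewrite normrM; apply: le_trans f'M; rewrite ler_piMr// ger0_norm ?subr_ge0 ?bump_le1//.
      by rewrite gerBl bump_ge0.
    apply: (le_trans (key n x Ix)).
    have := flat_bound 1 (n%:R * (x * (1 - x)) - 1).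
    have := flat_bound 2 (n%:R * (x * (1 - x)) - 1).
    rewrite (_ : 1`! = 1%N)// (_ : 2`! = 2%N)//.
    by move: M0; move: (flat 2 _) (flat 1 _) => a b; nra.
  + move=> x Ix; have q0 : 0 < x * (1 - x).
      by move: Ix; rewrite /I01/= in_itv/= => /andP[x0 x1]; rewrite mulr_gt0// subr_gt0.
    rewrite (_ : (fun n => _) = (fun n => (derive1 f x - derive1 f x * bump n 0 1 x) -
      f x * (n%:R * (1 - 2 * x) * flat 2 (n%:R * (x * (1 - x)) - 1)))); last first.
      by apply/funext => n; rewrite pE /= opprD addrA.
    rewrite -[X in _ --> X](subrr (0 : R)); apply: cvgB.
      rewrite -[X in _ --> X](subrr (derive1 f x)); apply: cvgB; first exact: cvg_cst.
      rewrite -[X in _ --> X]mulr1; apply: cvgMr; apply: bump_cvg.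
      by move: Ix; rewrite /I01/= in_itv.
    apply/norm_cvg0P; apply: (@squeeze_cvgr _ _ _ _ (fun=> 0)
        (fun n => 4 * M * (n%:R * (x * (1 - x)) - 1)^-1)); last 2 first.
    * exact: cvg_cst.
    * by rewrite -[X in _ --> X](mulr0 (4 * M)); apply: cvgMr; exact: bump_arg_invr_cvg0.
    near=> n; rewrite normr_ge0 /=; apply: (le_trans (key n x Ix)).
    have y0 : 0 < n%:R * (x * (1 - x)) - 1.
      by near: n; move/cvgryPgt : (bump_arg_cvgy q0); exact.
    set y := _ - 1 in y0 *.
    have b1 : flat 1 y <= y^-1.
      have := flatS_mul 0 y; have := flat0_le1 y.
      by rewrite -[y^-1]mulr1 ler_pdivlMl// => + ->.
    have b2 : flat 2 y <= y^-1.
      have := flatS_mul 1 y; have := flat_bound 1 y.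
      by rewrite -[y^-1]mulr1 ler_pdivlMl// => + ->.
    by move: M0 b1 b2; move: (flat 2 _) (flat 1 _) (y^-1) => a b c; nra.
Unshelve. all: by end_near. Qed.

Definition freq (j : nat) : R := j%:R * pi.
Definition sine (j : nat) (x : R) : R := Num.sqrt 2 * sin (freq j * x).
Definition cosine (j : nat) (x : R) : R := Num.sqrt 2 * cos (freq j * x).

Lemma sine_Ck n j : Ck n (sine j).
Proof. by apply: CkM; [exact: Ck_cst|exact: (Ck_sin_cos _ _).1]. Qed.

Lemma cosine_Ck n j : Ck n (cosine j).
Proof. by apply: CkM; [exact: Ck_cst|exact: (Ck_sin_cos _ _).2]. Qed.

Lemma is_derive_sine j (x : R) : is_derive x (1 : R) (sine j) (freq j * cosine j x).
Proof.
have dm : is_derive x (1 : R) (fun x => freq j * x) (freq j).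
  have := is_deriveZ (freq j) (is_derive_id x (1 : R)).
  by move/is_derive_val; apply; rewrite /GRing.scale /= mulr1.
have dt := @is_derive1_comp _ sin (fun x => freq j * x) _ _ _ (is_derive_sin _) dm.
have := is_deriveZ (Num.sqrt 2) dt.
by move/is_derive_val; apply; rewrite /GRing.scale /= /cosine; ring.
Qed.

Lemma is_derive_cosine j (x : R) : is_derive x (1 : R) (cosine j) (- freq j * sine j x).
Proof.
have dm : is_derive x (1 : R) (fun x => freq j * x) (freq j).
  have := is_deriveZ (freq j) (is_derive_id x (1 : R)).
  by move/is_derive_val; apply; rewrite /GRing.scale /= mulr1.
have dt := @is_derive1_comp _ cos (fun x => freq j * x) _ _ _ (is_derive_cos _) dm.
have := is_deriveZ (Num.sqrt 2) dt.
by move/is_derive_val; apply; rewrite /GRing.scale /= /sine; ring.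
Qed.

Lemma derive1_sine j : derive1 (sine j) = (fun x => freq j * cosine j x).
Proof. by apply: derive1_ext; exact: is_derive_sine. Qed.

Lemma derive1_cosine j : derive1 (cosine j) = (fun x => - freq j * sine j x).
Proof. by apply: derive1_ext; exact: is_derive_cosine. Qed.

Lemma sin_natpi j : sin (j%:R * pi) = 0 :> R.
Proof.
elim: j => [|j IH]; first by rewrite mul0r sin0.
by rewrite -natr1 mulrDl mul1r sinDpi IH oppr0.
Qed.

Lemma sine_sob10 j : sob10 (sine j).
Proof.
apply: smooth_sob10 => [n||]; first exact: sine_Ck.
- by rewrite /sine mulr0 sin0 mulr0.
- by rewrite /sine mulr1 sin_natpi mulr0.
Qed.

Lemma sine_L2 j : L2 (sine j). Proof. exact: Ck_L2 (sine_Ck 0 j). Qed.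

Lemma cosine_L2 j : L2 (cosine j). Proof. exact: Ck_L2 (cosine_Ck 0 j). Qed.

Lemma Dx_sine_ae j : {ae mu, forall x, I x -> Dx (sine j) x = freq j * cosine j x}.
Proof. by have := Dx_Ck1_ae (sine_Ck 1 j); rewrite derive1_sine. Qed.

Lemma Dx_cosine_ae j : {ae mu, forall x, I x -> Dx (cosine j) x = - freq j * sine j x}.
Proof. by have := Dx_Ck1_ae (cosine_Ck 1 j); rewrite derive1_cosine. Qed.

Lemma inner_aer f g g' : L2 f -> L2 g -> L2 g' ->
  {ae mu, forall x, I x -> g x = g' x} -> inner f g = inner f g'.
Proof. by move=> Lf Lg Lg' gg'; apply: inner_ae => //; exact: aeW. Qed.

(** The cosines do not vanish at the end points, but [f] does. *)
Lemma inner_Dx_cosine f j : sob10 f -> inner (Dx f) (cosine j) = freq j * inner f (sine j).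
Proof.
move=> hf; have Lf := sob10_L2 hf; have Lc : sob1 (cosine j) := sob1_Ck1 (cosine_Ck 1 j).
rewrite (sob10_ibp hf Lc) (inner_aer Lf (Dx_L2 Lc) _ (Dx_cosine_ae j)); last first.
  exact/L2Z/sine_L2.
by rewrite innerZr//; [rewrite mulNr opprK|exact: sine_L2].
Qed.

Lemma inner_sine_Dx f j : sob1 f -> inner (sine j) (Dx f) = - freq j * inner (cosine j) f.
Proof.
move=> sf; have := sob10_ibp (sine_sob10 j) sf.
have sj := sob10_sob1 (sine_sob10 j).
rewrite innerC (inner_aer (sob1_L2 sf) (Dx_L2 sj) _ (Dx_sine_ae j)); last first.
  exact/L2Z/cosine_L2.
rewrite innerZr ?(innerC f); [|exact: cosine_L2|exact: sob1_L2].
by rewrite mulNr => ->; rewrite opprK.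
Qed.

Lemma freq_gt0 j : (0 < j)%N -> 0 < freq j.
Proof. by move=> j0; rewrite mulr_gt0 ?pi_gt0// ltr0n. Qed.

Lemma sine_orthonormal i j : (0 < i)%N -> (0 < j)%N ->
  inner (sine i) (sine j) = (i == j)%:R.
Proof.
move=> i0 j0; have fi := freq_gt0 i0; have fj := freq_gt0 j0.
have cc k l : (0 < k)%N -> freq k * inner (cosine k) (cosine l) = freq l * inner (sine k) (sine l).
  move=> k0; rewrite -(inner_Dx_cosine l (sine_sob10 k)).
  rewrite (innerC (Dx _)) (inner_aer (cosine_L2 l) (Dx_L2 _) _ (Dx_sine_ae k)).
  - by rewrite innerZr ?(innerC (cosine l)); [|exact: cosine_L2|exact: cosine_L2].
  - exact: sob10_sob1 (sine_sob10 k).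
  - exact/L2Z/cosine_L2.
have [<-|ij] := eqVneq i j; last first.
  have h1 := cc _ j i0; have := cc _ i j0; rewrite (innerC (cosine j)) (innerC (sine j)) => h2.
  have h3 : (freq i ^+ 2 - freq j ^+ 2) * inner (sine i) (sine j) = 0 by nra.
  apply/eqP; move/eqP: h3; rewrite mulf_eq0 => /orP[|//].
  rewrite subr_eq0 eqrXn2 ?(ltW fi) ?(ltW fj)// => /eqP.
  by move/(mulIf (lt0r_neq0 (pi_gt0 R)))/eqP; rewrite eqr_nat (negbTE ij).
have := cc _ i i0 => /(mulfI (lt0r_neq0 fi)) cs.
have : inner (cosine i) (cosine i) + inner (sine i) (sine i) = 2.
  rewrite /inner -RintegralD//; try by apply: L2_mul_integrable; [exact: sine_L2|exact: sine_L2].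
    under eq_Rintegral => x _.
      rewrite /sine /cosine -!expr2 !exprMn sqr_sqrtr// -mulrDr cos2Dsin2 mulr1.
      over.
    by rewrite Rintegral_cst//; have /= -> := congr1 fine (leb_I01 R); rewrite mulr1.
  by apply: L2_mul_integrable; exact: cosine_L2.
by rewrite cs mulr1n; lra.
Qed.

Lemma sob1_ae f f' : L2 f' -> {ae mu, forall x, I x -> f x = f' x} -> sob1 f -> sob1 f'.
Proof.
move=> Lf' ff' sf; have [LD wD] := Dx_spec sf; have Lf := sob1_L2 sf.
split => //; exists (Dx f); split => // phi Tphi; rewrite -(wD _ Tphi).
by apply: inner_ae => //; try exact: test_derive1_L2; [apply: filterS ff' => x h /h|exact: aeW].
Qed.

Lemma Dx_ae_congr f f' : sob1 f -> L2 f' -> {ae mu, forall x, I x -> f x = f' x} ->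
  {ae mu, forall x, I x -> Dx f x = Dx f' x}.
Proof.
move=> sf Lf' ff'; have sf' := sob1_ae Lf' ff' sf.
have [LD' wD'] := Dx_spec sf'; have Lf := sob1_L2 sf.
apply: Dx_ae => // phi Tphi; rewrite -(wD' _ Tphi).
by apply: inner_ae => //; try exact: test_derive1_L2; exact: aeW.
Qed.

Lemma sine_eigenpair j : (0 < j)%N -> dirichlet_eigenpair (freq j ^+ 2) (sine j).
Proof.
move=> j0; have sj := sob10_sob1 (sine_sob10 j).
have Lc : L2 (fun x => freq j * cosine j x) by exact/L2Z/cosine_L2.
have Ck1 : Ck 1 (fun x => freq j * cosine j x).
  by apply: CkM; [exact: Ck_cst|exact: cosine_Ck].
have ae' : {ae mu, forall x, I x -> freq j * cosine j x = Dx (sine j) x}.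
  by apply: filterS (Dx_sine_ae j) => x h /h.
split.
- by split => //; apply: (sob1_ae (Dx_L2 sj) ae'); exact: sob1_Ck1.
- exact: sine_sob10.
- by rewrite /l2norm sine_orthonormal// eqxx sqrtr1 oner_eq0.
- apply: filterS2 (Dx_ae_congr (sob1_Ck1 Ck1) (Dx_L2 sj) ae') (Dx_Ck1_ae Ck1) => x h1 h2 Ix.
  rewrite -h1// h2//.
  have -> : derive1 (fun x => freq j * cosine j x) = (fun x => freq j * (- freq j * sine j x)).
    apply: derive1_ext => y.
    by have := is_deriveZ (freq j) (is_derive_cosine j y); move/is_derive_val; apply.
  by ring.
Qed.

End Sines.

(** * Completeness of the sines *)

Section Completeness.
Variable R : realType.
Implicit Types (f g phi : R -> R) (D : set R).
Local Notation mu := (@leb R).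
Local Notation I := (@I01 R).
Local Notation sine := (@sine R).
Local Notation cosine := (@cosine R).
Local Notation freq := (@freq R).

Lemma cosine_orthonormal i j : (0 < i)%N -> (0 < j)%N ->
  inner (cosine i) (cosine j) = (i == j)%:R.
Proof.
move=> i0 j0; have fi := freq_gt0 R i0.
have h := inner_Dx_cosine j (sine_sob10 R i).
move: h; rewrite innerC (inner_aer (cosine_L2 R j) (Dx_L2 _) _ (Dx_sine_ae R i)).
- rewrite innerZr ?(innerC (cosine j)); [|exact: cosine_L2|exact: cosine_L2].
  rewrite sine_orthonormal//; have [->|_] := eqVneq i j; rewrite ?mulr1 ?mulr0.
    by rewrite -[X in _ = X -> _]mulr1 => /mulfI; apply; rewrite gt_eqF ?freq_gt0.
  by move/eqP; rewrite mulf_eq0 gt_eqF//= => /eqP.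
- exact: sob10_sob1 (sine_sob10 R i).
- exact/L2Z/cosine_L2.
Qed.

(** Completing the square; Bessel's inequality and the best approximation
    property of the coefficients both follow. *)
Lemma orthonormal_dist (e : nat -> R -> R) (c : nat -> R) f M :
  (forall j, L2 (e j)) ->
  (forall i j, (0 < i)%N -> (0 < j)%N -> inner (e i) (e j) = (i == j)%:R) ->
  L2 f ->
  l2norm (f \- (fun x => \sum_(1 <= j < M.+1) c j * e j x)) ^+ 2 =
  l2norm f ^+ 2 - \sum_(1 <= j < M.+1) inner f (e j) ^+ 2
    + \sum_(1 <= j < M.+1) (inner f (e j) - c j) ^+ 2.
Proof.
move=> Le oe Lf; elim: M => [|M IH].
  rewrite !big_geq// subr0 addr0; congr (l2norm _ ^+ 2); apply/funext => x.
  by rewrite /= big_geq// subr0.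
have Lg m : L2 (fun x => \sum_(1 <= j < m.+1) c j * e j x).
  by apply: L2_sum => j _; exact: L2Z.
rewrite (_ : f \- _ = (f \- (fun x => \sum_(1 <= j < M.+1) c j * e j x)) \-
    (fun x => c M.+1 * e M.+1 x)); last first.
  by apply/funext => x /=; rewrite big_nat_recr//= opprD addrA.
have LfM := L2B Lf (Lg M); have LeM := L2Z (c M.+1) (Le M.+1).
rewrite l2norm_sqrB// IH innerZr// innerBl// inner_suml//; last by move=> j _; exact: L2Z.
rewrite [\sum_(1 <= i < M.+1) inner _ (e M.+1)]big1_seq ?subr0; last first.
  move=> j; rewrite mem_index_iota => /and3P[_ j1 jM]; rewrite innerZl// oe// (_ : (_ == _) = false) ?mulr0//.
  by apply/negbTE; rewrite neq_ltn jM.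
rewrite (sqr_l2norm (fun x => c M.+1 * e M.+1 x)) innerZl// innerZr// oe// eqxx mulr1.
rewrite [in RHS]big_nat_recr//= [in X in _ = _ + X]big_nat_recr//=; ring.
Qed.

(** The Bernstein operator, given by its recursion in the degree rather than
    by binomial coefficients: the expectation of [f] under the binomial law. *)
Fixpoint bern (n : nat) (f : nat -> R) (t : R) : R :=
  if n is n'.+1 then (1 - t) * bern n' f t + t * bern n' (f \o succn) t else f 0%N.

Lemma bern_le n (f g : nat -> R) t : 0 <= t <= 1 ->
  (forall k, (k <= n)%N -> f k <= g k) -> bern n f t <= bern n g t.
Proof.
move=> /andP[t0 t1]; elim: n f g => [|n IH] f g fg /=; first exact: fg.
apply: lerD; apply: ler_wpM2l => //; rewrite ?subr_ge0//; apply: IH => k kn.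
  by apply: fg; exact: leqW.
exact: fg.
Qed.

Lemma bern_affine n (f : nat -> R) a b t :
  bern n (fun k => a + b * f k) t = a + b * bern n f t.
Proof.
elim: n f => [//|n IH] f /=; rewrite IH.
by have /= -> := IH (f \o succn); ring.
Qed.

Lemma bern_variance n c t :
  bern n (fun k => (k%:R - c) ^+ 2) t = n%:R * (t * (1 - t)) + (n%:R * t - c) ^+ 2.
Proof.
elim: n c => [|n IH] c /=; first by ring.
rewrite IH (_ : _ \o _ = fun k => (k%:R - (c - 1)) ^+ 2); last first.
  by apply/funext => k /=; rewrite -natr1; congr (_ ^+ _); ring.
by rewrite IH -natr1; ring.
Qed.

(** Bernstein's proof: uniform continuity for [k / n] near [t], and the variance
    of the binomial law for the others. *)
Lemma bernstein_approx (q : R -> R) (e : R) : continuous q -> 0 < e ->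
  exists n, forall t, 0 <= t <= 1 -> `|q t - bern n (fun k => q (k%:R / n%:R)) t| <= e.
Proof.
move=> cq e0.
have [M M0 qM] : exists2 M : R, 0 < M & forall x, 0 <= x <= 1 -> `|q x| <= M.
  have := @segment_compact R 0 1.
  move=> /(continuous_compact (continuous_subspaceT cq)) /compact_bounded.
  move=> [M [_ /(_ (`|M| + 1))]]; rewrite (le_lt_trans (ler_norm _)) ?ltrDl// => /(_ isT) fM.
  exists (`|M| + 1); first by rewrite ltr_wpDl.
  by move=> x x01; apply: fM; exists x => //=; rewrite in_itv.
have [d d0 qd] : exists2 d : R, 0 < d & forall x y, 0 <= x <= 1 ->
    `|x - y| < d -> `|q x - q y| <= e / 2.
  have cvr (x : R) : `[0, 1]%classic x ->
      \forall x' \near x & d \near 0^'+, forall y : R, `|x' - y| < d -> `|q x' - q y| <= e / 2.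
    move=> _; have e4 : 0 < e / 4 by rewrite divr_gt0.
    have := cq x => /cvgrPdist_le/(_ _ e4)/nbhs_ballP[r /= r0 rq].
    near=> x' d => y /= x'y.
    have xx' : `|x - x'| < r / 2 by near: x'; apply: (nbhsx_ballx x (r / 2)); rewrite divr_gt0.
    have dr : d < r / 2 by near: d; apply: nbhs_right_lt; rewrite divr_gt0.
    have h1 := rq x' (lt_trans xx' _); have h2 := rq y.
    rewrite -(subrKA (q x)) [X in _ <= X](_ : _ = e / 4 + e / 4); last lra.
    apply: (le_trans (ler_normD _ _)); apply: lerD.
      by rewrite distrC; apply: h1; lra.
    apply: h2; rewrite /ball /= -(subrKA x').
    by apply: (le_lt_trans (ler_normD _ _)); lra.
  have := (compact_near_coveringP _).1 (@segment_compact R 0 1) _ _ _ _ cvr.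
  move=> h; near (0 : R)^'+ => d; exists d; first by near: d; exact: nbhs_right_gt.
  move=> x y x01; suff : `[0, 1] `<=` (fun x' : R => forall y : R, `|x' - y| < d ->
      `|q x' - q y| <= e / 2) by apply; rewrite /= in_itv.
  by near: d; apply: h.
(* [K (t - k / n) ^ 2] exceeds the oscillation [2 M] as soon as [|t - k / n| >= d] *)
pose K := 2 * M / d ^+ 2.
have K0 : 0 < K by rewrite divr_gt0 ?exprn_gt0 ?mulr_gt0.
pose n := (Num.truncn (2 * K / e)).+1.
have n0 : 0 < (n%:R : R) by rewrite ltr0n.
exists n => t t01.
have close k : (k <= n)%N -> `|q t - q (k%:R / n%:R)| <= e / 2 + K / n%:R ^+ 2 * (k%:R - n%:R * t) ^+ 2.
  move=> kn; have k01 : 0 <= (k%:R / n%:R : R) <= 1.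
    by rewrite divr_ge0//= ler_pdivrMr// mul1r ler_nat.
  have -> : K / n%:R ^+ 2 * (k%:R - n%:R * t) ^+ 2 = K * (t - k%:R / n%:R) ^+ 2.
    by field; rewrite gt_eqF.
  have [ltd|led] := ltP `|t - k%:R / n%:R| d.
    by apply: (le_trans (qd _ _ t01 ltd)); rewrite lerDl mulr_ge0 ?sqr_ge0 ?ltW.
  apply: (@le_trans _ _ (2 * M)).
    apply: (le_trans (ler_normB _ _)); have := qM _ t01; have := qM _ k01; lra.
  apply: ler_wpDl; first by rewrite divr_ge0 ?ltW.
  have : d ^+ 2 <= (t - k%:R / n%:R) ^+ 2.
    by rewrite -[leRHS]real_normK ?num_real// lerXn2r ?nnegrE ?(ltW d0).
  move=> /(ler_wpM2l (ltW K0)); apply: le_trans.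
  by rewrite /K divfK// gt_eqF ?exprn_gt0.
have var : K / n%:R ^+ 2 * bern n (fun k => (k%:R - n%:R * t) ^+ 2) t <= e / 2.
  rewrite bern_variance subrr expr0n /= addr0.
  have -> : K / n%:R ^+ 2 * (n%:R * (t * (1 - t))) = K * (t * (1 - t)) / n%:R.
    by field; rewrite gt_eqF.
  rewrite ler_pdivrMr//.
  have : 2 * K / e < n%:R := truncnS_gt _.
  rewrite ltr_pdivrMr// => h.
  have : t * (1 - t) <= 1 by case/andP: t01 => ? ?; nra.
  by move=> /(ler_wpM2l (ltW K0)); lra.
have up := @bern_le n (fun k => q (k%:R / n%:R))
  (fun k => (q t + e / 2) + K / n%:R ^+ 2 * (k%:R - n%:R * t) ^+ 2) t t01.
have lo := @bern_le n (fun k => (q t - e / 2) + - (K / n%:R ^+ 2) * (k%:R - n%:R * t) ^+ 2)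
  (fun k => q (k%:R / n%:R)) t t01.
rewrite (bern_affine n (fun k => (k%:R - n%:R * t) ^+ 2)) in up.
rewrite (bern_affine n (fun k => (k%:R - n%:R * t) ^+ 2)) mulNr in lo.
rewrite ler_norml; apply/andP; split.
  suff : bern n (fun k => q (k%:R / n%:R)) t <=
      q t + e / 2 + K / n%:R ^+ 2 * bern n (fun k => (k%:R - n%:R * t) ^+ 2) t by lra.
  by apply: up => k kn; have := close k kn; rewrite ler_norml => /andP[]; lra.
suff : q t - e / 2 - K / n%:R ^+ 2 * bern n (fun k => (k%:R - n%:R * t) ^+ 2) t <=
    bern n (fun k => q (k%:R / n%:R)) t by lra.
by apply: lo => k kn; have := close k kn; rewrite ler_norml mulNr => /andP[]; lra.
Unshelve. all: by end_near. Qed.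

(** Inductively generated, so that closure under multiplication by [cos (pi x)]
    is proved on generators. *)
Inductive sine_span : (R -> R) -> Prop :=
| sine_span_sine j : sine_span (sine j)
| sine_spanD f g : sine_span f -> sine_span g -> sine_span (f \+ g)
| sine_spanZ a f : sine_span f -> sine_span (fun x => a * f x).

Lemma sine_span_L2 f : sine_span f -> L2 f.
Proof.
elim=> [j|{}f g _ Lf _ Lg|a {}f _ Lf]; [exact: sine_L2|exact: L2D|exact: L2Z].
Qed.

Lemma sine0 : sine 0 = fun=> 0.
Proof. by apply/funext => x; rewrite /sine /freq !mul0r sin0 mulr0. Qed.

Lemma sine_span_coef g : sine_span g -> exists (c : nat -> R) M0, forall M, (M0 <= M)%N ->
  g = (fun x => \sum_(1 <= j < M.+1) c j * sine j x).
Proof.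
elim=> [j|{}f {}g _ [c [m cE]] _ [d [l dE]]|a f _ [c [m cE]]].
- exists (fun i => (i == j)%:R), j => M jM; apply/funext => x.
  case: j jM => [_|j jM].
    rewrite sine0 big_nat big1// => i /andP[i0 _].
    by rewrite (_ : (i == 0) = false) ?mul0r// gtn_eqF.
  rewrite (bigD1_seq j.+1) ?iota_uniq//=; last by rewrite mem_index_iota.
  rewrite eqxx mul1r big1 ?addr0// => i /negbTE ->.
  by rewrite mul0r.
- exists (fun j => c j + d j), (maxn m l) => M; rewrite geq_max => /andP[mM lM].
  apply/funext => x; rewrite /= {1}(cE M mM) {1}(dE M lM) -big_split /=.
  by apply: eq_bigr => i _; rewrite mulrDl.
- exists (fun j => a * c j), m => M mM; apply/funext => x.
  rewrite {1}(cE M mM) big_distrr /=.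
  by apply: eq_bigr => i _; rewrite mulrA.
Qed.

Lemma sine_span_cos g : sine_span g -> sine_span (fun x => cos (pi * x) * g x).
Proof.
elim=> [j|{}f {}g _ hf _ hg|a f _ hf].
- case: j => [|j].
    rewrite (_ : (fun x => _) = (fun x => 0 * sine 0 x)).
      by apply: sine_spanZ; exact: sine_span_sine.
    by apply/funext => x; rewrite sine0 !mulr0.
  have := sine_spanD (sine_spanZ (1 / 2) (sine_span_sine j.+2))
    (sine_spanZ (1 / 2) (sine_span_sine j)).
  congr sine_span; apply/funext => x; rewrite /= /sine /freq.
  have -> : j.+2%:R * pi * x = j.+1%:R * pi * x + pi * x by rewrite -[j.+2%:R]natr1; ring.
  have -> : j%:R * pi * x = j.+1%:R * pi * x - pi * x by rewrite -[j.+1%:R]natr1; ring.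
  by rewrite sinD sinB; field.
- rewrite (_ : (fun x => _) = (fun x => cos (pi * x) * f x) \+ (fun x => cos (pi * x) * g x)).
    exact: sine_spanD.
  by apply/funext => x /=; rewrite mulrDr.
- rewrite (_ : (fun x => _) = (fun x => a * (cos (pi * x) * f x))); first exact: sine_spanZ.
  by apply/funext => x; rewrite mulrCA.
Qed.

(** Polynomials in [cos (pi x)] times [sin (pi x)] are combinations of sines, by
    the product formula. *)
Lemma sine_span_bern n (f : nat -> R) :
  sine_span (fun x => sin (pi * x) * bern n f ((1 - cos (pi * x)) / 2)).
Proof.
elim: n f => [|n IH] f /=.
  have := sine_spanZ (f 0%N / Num.sqrt 2) (sine_span_sine 1).
  congr sine_span; apply/funext => x; rewrite /sine /freq mul1r.
  by field; rewrite gt_eqF// sqrtr_gt0.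
have := sine_spanD
  (sine_spanZ (1 / 2) (sine_spanD (IH f) (sine_span_cos (IH f))))
  (sine_spanZ (1 / 2) (sine_spanD (IH (f \o succn)) (sine_spanZ (-1) (sine_span_cos (IH (f \o succn)))))).
by congr sine_span; apply/funext => x /=; field.
Qed.

(** [phi / sin (pi x)] is, for a test function [phi], a continuous function of
    [t = (1 - cos (pi x)) / 2]: it vanishes near the end points, where the sine
    vanishes. *)
Definition sine_quotient phi (t : R) : R :=
  let x := acos (1 - 2 * t) / pi in
  if 0 < t < 1 then phi x / sin (pi * x) else 0.

Lemma test_away phi : test_fun I phi ->
  exists2 a : R, 0 < a < 1 / 2 & forall x, phi x != 0 -> a <= x <= 1 - a.
Proof.
move=> Tp; have [_ _ pD] := Tp.
have nb (x : R) : ~ I x -> exists2 r : R, 0 < r & forall y, `|x - y| < r -> phi y = 0.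
  move=> nIx; have : \forall y \near x, (~` closure [set x | phi x != 0]) y.
    apply: open_nbhs_nbhs; split; first by apply: closed_openC; exact: closed_closure.
    by move=> /pD.
  move=> /nbhs_ballP[r /= r0 rc]; exists r => // y xy.
  apply/eqP/negP => /negP p0; have := rc y xy; apply.
  exact: subset_closure.
have [|r r0 rp] := nb 0; first by rewrite /I01/= in_itv/= ltxx.
have [|s s0 sp] := nb 1; first by rewrite /I01/= in_itv/= ltxx andbF.
exists (Num.min (1 / 3) (Num.min r s)).
  by rewrite !lt_min r0 s0 gt_min; apply/andP; split; [lra|apply/orP; left; lra].
move=> x p0; have Ix : I x.
  by apply: contrapT => /(test_out Tp)/eqP; rewrite (negbTE p0).
move: Ix; rewrite /I01/= in_itv/= => /andP[x0 x1]; apply/andP; split.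
  rewrite !ge_min; apply/orP; right; apply/orP; left; rewrite leNgt; apply: contra p0 => xr.
  by rewrite rp// sub0r normrN gtr0_norm.
rewrite lerBrDl -lerBrDr !ge_min; apply/orP; right; apply/orP; right; rewrite leNgt; apply: contra p0 => xr.
by rewrite sp// gtr0_norm ?subr_gt0.
Qed.

Lemma sine_quotient_continuous phi : test_fun I phi -> continuous (sine_quotient phi).
Proof.
move=> Tp; have [a /andP[a0 a12] pa] := test_away Tp; have pi0 := pi_gt0 R.
have pin0 : pi != 0 :> R by rewrite gt_eqF.
have cp : continuous phi := Ck_continuous (test_Ck 0 Tp).
have pia : 0 < pi * a < pi / 2.
  by rewrite mulr_gt0//= ltr_pM2l//; apply: lt_le_trans a12 _; rewrite mul1r.
have k1 : cos (pi * a) < 1.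
  rewrite -cos0; case/andP: pia => p1 p2.
  by rewrite ltr_cos// in_itv/= ?lexx/=; lra.
have out (t : R) : cos (pi * a) < `|1 - 2 * t| -> sine_quotient phi t = 0.
  move=> h; rewrite /sine_quotient; case: ifPn => // /andP[t0 t1].
  have [->|px] := eqVneq (phi (acos (1 - 2 * t) / pi)) 0; first by rewrite mul0r.
  have /andP[h1 h2] := pa _ px.
  have t2 : -1 <= 1 - 2 * t <= 1 by apply/andP; split; lra.
  have [/andP[y0 ypi] cy] := acos_def t2.
  move: h1 h2; rewrite ler_pdivlMr// ler_pdivrMr// => h1 h2.
  case/andP: pia => p1 p2.
  have : `|1 - 2 * t| <= cos (pi * a).
    rewrite ler_norml -cy; apply/andP; split.
      have -> : - cos (pi * a) = cos (pi - pi * a).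
        by rewrite cosB cospi sinpi mul0r addr0 mulN1r.
      by rewrite leNgt ltr_cos ?in_itv/= ?y0 ?ypi// -?leNgt; lra.
    by rewrite leNgt ltr_cos ?in_itv/= ?y0 ?ypi// -?leNgt; lra.
  by rewrite leNgt h.
have cn (t : R) : {for t, continuous (fun s : R => 1 - 2 * s)}.
  by apply: cvgB; [exact: cvg_cst|apply: cvgMr; exact: cvg_id].
move=> t; have [ht|ht] := ltP (cos (pi * a)) `|1 - 2 * t|.
  have near0 : \forall s \near t, sine_quotient phi s = 0.
    have : \forall s \near t, cos (pi * a) < `|1 - 2 * s|.
      have cabs : {for t, continuous (fun s : R => `|1 - 2 * s|)} by exact: cvg_norm (cn t).
      by have := cvgr_gt _ cabs; apply.
    by apply: filterS => s /out.
  rewrite /continuous_at out//.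
  exact: cvg_near_cst.
have t1 : `|1 - 2 * t| < 1 := le_lt_trans ht k1.
have t01 : 0 < t < 1 by move: t1; rewrite ltr_norml => /andP[? ?]; apply/andP; split; lra.
have t2 : -1 < 1 - 2 * t < 1 by rewrite -ltr_norml.
pose G (s : R) := acos (1 - 2 * s) / pi.
have cG : {for t, continuous G}.
  apply: cvgMl; apply: (@continuous_comp _ _ _ (fun s : R => 1 - 2 * s) acos t (cn t)).
  exact: continuous_acos.
have sG : sin (pi * G t) != 0.
  case/andP: t2 => m1 m2; rewrite gt_eqF// sin_gt0_pi// /G mulrC divfK//.
  by rewrite acos_gt0 ?m2 ?(ltW m1)//= acos_ltpi ?m1 ?(ltW m2).
have cF : {for t, continuous (fun s => phi (G s) / sin (pi * G s))}.
  apply: cvgM; first by apply: (@continuous_comp _ _ _ G phi t cG); exact: cp.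
  apply: cvgV => //; apply: (@continuous_comp _ _ _ (fun s => pi * G s) sin t); last exact: continuous_sin.
  by apply: cvgMr; exact: cG.
have nearE : \forall s \near t, phi (G s) / sin (pi * G s) = sine_quotient phi s.
  case/andP: t01 => t0 t3; near=> s; rewrite /sine_quotient ifT//.
  by apply/andP; split; near: s; [exact: lt_nbhsr|exact: lt_nbhsl].
rewrite /continuous_at -(nbhs_singleton nearE).
by apply: cvg_trans cF; apply: near_eq_cvg.
Unshelve. all: by end_near. Qed.

Lemma sine_quotientE phi x : 0 < x < 1 ->
  phi x = sin (pi * x) * sine_quotient phi ((1 - cos (pi * x)) / 2).
Proof.
move=> /andP[x0 x1]; have pi0 := pi_gt0 R.
have px0 : 0 < pi * x < pi by rewrite mulr_gt0//= -[ltRHS]mulr1 ltr_pM2l.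
have s0 : sin (pi * x) != 0 by rewrite gt_eqF// sin_gt0_pi.
rewrite /sine_quotient (_ : 1 - 2 * ((1 - cos (pi * x)) / 2) = cos (pi * x)); last by field.
rewrite cosK; last by rewrite in_itv/= !ltW//; case/andP: px0.
rewrite mulrAC divff ?mul1r ?gt_eqF// ifT; last first.
  have := sin2cos2 (pi * x); have := sin_gt0_pi px0.
  by move: (sin _) (cos _) => a b a0 ab; apply/andP; split; nra.
by rewrite mulrCA divff ?mulr1.
Qed.

(** The Weierstrass theorem in the variable [t = (1 - cos (pi x)) / 2]. *)
Lemma test_sine_approx phi (e : R) : test_fun I phi -> 0 < e ->
  exists2 g, sine_span g & forall x, I x -> `|phi x - g x| <= e.
Proof.
move=> Tp e0; have [n qn] := bernstein_approx (sine_quotient_continuous Tp) e0.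
exists (fun x => sin (pi * x) *
  bern n (fun k => sine_quotient phi (k%:R / n%:R)) ((1 - cos (pi * x)) / 2)).
  exact: sine_span_bern.
move=> x; rewrite /I01/= in_itv/= => x01.
rewrite {1}(sine_quotientE phi x01) -mulrBr normrM.
have := sin_max (pi * x); have := cos_max (pi * x); rewrite ler_norml => /andP[c1 c2] s1.
rewrite -[leRHS]mul1r; apply: ler_pM => //; apply: qn; apply/andP; split; lra.
Qed.

Lemma sine_dense f (e : R) : sob10 f -> 0 < e ->
  exists2 g, sine_span g & l2norm (f \- g) <= e.
Proof.
move=> hf e0; have [p [Tp fp _]] := sob10_approx hf; have Lf := sob10_L2 hf.
have e2 : 0 < e / 2 by rewrite divr_gt0.
move/cvgr0_norm_le : fp => /(_ _ e2)/filter_ex[n].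
rewrite ger0_norm ?l2norm_ge0// => fpn.
have [g sg pg] := test_sine_approx (Tp n) e2.
exists g => //; have Lp := test_L2 (Tp n); have Lg := sine_span_L2 sg.
rewrite (_ : f \- g = (f \- p n) \+ (p n \- g)); last first.
  by apply/funext => x /=; rewrite addrA subrK.
apply: (le_trans (l2normD (L2B Lf Lp) (L2B Lp Lg))).
rewrite [leRHS](_ : _ = e / 2 + e / 2); last lra.
apply: lerD => //.
have L1 : L2 (fun=> 1 : R) by apply: continuous_L2 => x; exact: cvg_cst.
have Le : L2 (fun=> e / 2 * 1 : R) by exact: L2Z.
have l1 : l2norm (fun=> 1 : R) = 1.
  rewrite /l2norm /inner; under eq_Rintegral do rewrite mulr1.
  by rewrite Rintegral_cst//; have /= -> := congr1 fine (leb_I01 R); rewrite mulr1 sqrtr1.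
have le : l2norm (fun=> e / 2 * 1) = e / 2 by rewrite l2normZ// l1 mulr1 gtr0_norm.
rewrite -[leRHS]le; apply: l2norm_le => //; first exact: L2B.
by apply: aeW => x Ix /=; rewrite mulr1 [leRHS]gtr0_norm// pg.
Qed.

Definition sine_energy M f := \sum_(1 <= j < M.+1) inner f (sine j) ^+ 2.

Lemma sine_energy_le M f : L2 f -> sine_energy M f <= l2norm f ^+ 2.
Proof.
move=> Lf; have := orthonormal_dist (fun j => inner f (sine j)) M (sine_L2 R) (@sine_orthonormal R) Lf.
rewrite [X in _ + X]big1; last by move=> j _; rewrite subrr expr0n.
by rewrite addr0 -/(sine_energy M f) => h; rewrite -subr_ge0 -h sqr_ge0.
Qed.

(** The partial sums are best approximations, so that density suffices. *)
Lemma parseval f : sob10 f -> (fun M => sine_energy M f) @ \oo --> l2norm f ^+ 2.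
Proof.
move=> hf; have Lf := sob10_L2 hf; apply/cvgrPdist_le => e e0 /=.
have se0 : 0 < Num.sqrt e by rewrite sqrtr_gt0.
have [g sg fg] := sine_dense hf se0; have [c [M0 gE]] := sine_span_coef sg.
near=> M; have M0M : (M0 <= M)%N by near: M; exact: nbhs_infty_ge.
rewrite ger0_norm ?subr_ge0 ?sine_energy_le//.
have := orthonormal_dist c M (sine_L2 R) (@sine_orthonormal R) Lf.
rewrite -gE// -/(sine_energy M f) => h.
have fg2 : l2norm (f \- g) ^+ 2 <= e.
  by rewrite -[leRHS](sqr_sqrtr (ltW e0)) lerXn2r ?nnegrE ?l2norm_ge0// ltW.
apply: le_trans fg2; rewrite h lerDl; apply: sumr_ge0 => j _; exact: sqr_ge0.
Unshelve. all: by end_near. Qed.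

Lemma test_derive2 phi : test_fun I phi ->
  [/\ sob10 (derive1 (derive1 phi)), inner phi (derive1 (derive1 phi)) = - l2norm (derive1 phi) ^+ 2 &
   forall j, inner (derive1 (derive1 phi)) (sine j) = - freq j ^+ 2 * inner phi (sine j)].
Proof.
move=> Tp; have Tp' := test_derive1 Tp; have Tp'' := test_derive1 Tp'.
have ibp (f g : R -> R) : test_fun I f -> Ck 1 g -> inner (derive1 f) g = - inner f (derive1 g).
  by move=> Tf Cg; have := weak_deriv_Ck1 Cg Tf; rewrite -/(inner _ _) innerC => ->; rewrite innerC.
split.
- exact: test_sob10.
- by rewrite sqr_l2norm (ibp _ _ Tp (test_Ck 1 Tp')) opprK.
- move=> j; rewrite (ibp _ _ Tp' (sine_Ck R 1 j)) derive1_sine innerZr; [|exact: cosine_L2|exact: test_L2].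
  rewrite (ibp _ _ Tp (cosine_Ck R 1 j)) derive1_cosine innerZr; [|exact: sine_L2|exact: test_L2].
  by ring.
Qed.

Definition cosine_energy M f := \sum_(1 <= j < M.+1) inner f (cosine j) ^+ 2.

Lemma cosine_energy_Dx M f : sob10 f ->
  cosine_energy M (Dx f) = \sum_(1 <= j < M.+1) freq j ^+ 2 * inner f (sine j) ^+ 2.
Proof. by move=> hf; apply: eq_bigr => j _; rewrite inner_Dx_cosine// exprMn. Qed.

Lemma cosine_energy_le M f : L2 f -> cosine_energy M f <= l2norm f ^+ 2.
Proof.
move=> Lf; have := orthonormal_dist (fun j => inner f (cosine j)) M (cosine_L2 R) cosine_orthonormal Lf.
rewrite [X in _ + X]big1; last by move=> j _; rewrite subrr expr0n.
by rewrite addr0 -/(cosine_energy M f) => h; rewrite -subr_ge0 -h sqr_ge0.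
Qed.

(** [|phi'| ^ 2 = - (phi, phi'')], and by polarization Parseval's identity for
    [phi - phi''], [phi] and [phi''] computes this inner product. *)
Lemma parseval_test_derive phi : test_fun I phi ->
  (fun M => cosine_energy M (derive1 phi)) @ \oo --> l2norm (derive1 phi) ^+ 2.
Proof.
move=> Tp; have [hp'' ip js] := test_derive2 Tp; have hp := test_sob10 Tp.
move: hp'' ip js; move: (derive1 (derive1 phi) : R -> R) => p2 hp'' ip js.
have Lp := sob10_L2 hp; have Lp2 := sob10_L2 hp''.
have h : (fun M => (sine_energy M (phi \- p2) - sine_energy M phi - sine_energy M p2) / 2)
    @ \oo --> (l2norm (phi \- p2) ^+ 2 - l2norm phi ^+ 2 - l2norm p2 ^+ 2) / 2.
  have hA := parseval (sob10B hp hp''); have hB := parseval hp; have hC := parseval hp''.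
  apply: cvgMl; exact: (cvgB (cvgB hA hB) hC).
move: h; rewrite l2norm_sqrB// ip (_ : (_ - _ - _) / 2 = l2norm (derive1 phi) ^+ 2); last by field.
apply: cvg_trans; apply: near_eq_cvg; near=> M.
rewrite /sine_energy -!sumrB mulr_suml; apply: eq_bigr => j _.
rewrite innerBl//; last exact: sine_L2.
have -> : inner (derive1 phi) (cosine j) = freq j * inner phi (sine j).
  rewrite -(inner_Dx_cosine j hp); apply: inner_ae; try exact: cosine_L2.
  - exact: test_derive1_L2.
  - exact: Dx_L2 (sob10_sob1 hp).
  - by apply: filterS (Dx_Ck1_ae (test_Ck 1 Tp)) => x e /e.
  - exact: aeW.
by rewrite js; field.
Unshelve. all: by end_near. Qed.

(** The cosines of positive index are not complete in [L^2], since they miss the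
    constants; the closure of their span contains the derivatives of test
    functions, hence those of [H^1_0]. *)
Lemma parseval_Dx f : sob10 f -> (fun M => cosine_energy M (Dx f)) @ \oo --> l2norm (Dx f) ^+ 2.
Proof.
move=> hf; have Lf' := Dx_L2 (sob10_sob1 hf); apply/cvgrPdist_le => e e0 /=.
have [p [Tp _ fp']] := sob10_approx hf.
pose s := Num.sqrt e; have s0 : 0 < s by rewrite sqrtr_gt0.
have s2 : 0 < s / 2 by rewrite divr_gt0.
move/cvgr0_norm_le : fp' => /(_ _ s2)/filter_ex[n].
rewrite ger0_norm ?l2norm_ge0// => fpn.
have Lp' := test_derive1_L2 (Tp n).
have := parseval_test_derive (Tp n) => /cvgrPdist_le /(_ _ (exprn_gt0 2 s2)) hM.
near=> M; rewrite ger0_norm ?subr_ge0 ?cosine_energy_le//.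
pose c j := inner (derive1 (p n)) (cosine j).
pose g x := \sum_(1 <= j < M.+1) c j * cosine j x.
have Lg : L2 g by apply: L2_sum => j _; apply: L2Z; exact: cosine_L2.
have h1 := orthonormal_dist c M (cosine_L2 R) cosine_orthonormal Lp'.
have h2 := orthonormal_dist c M (cosine_L2 R) cosine_orthonormal Lf'.
rewrite [X in _ + X]big1 ?addr0 -/(cosine_energy _ _) in h1; last first.
  by move=> j _; rewrite subrr expr0n.
have pg : l2norm (derive1 (p n) \- g) <= s / 2.
  rewrite -(@ler_pXn2r _ 2) ?nnegrE ?l2norm_ge0 ?(ltW s2)// h1.
  apply: le_trans (ler_norm _) _; near: M; exact: hM.
have fg : l2norm (Dx f \- g) <= s.
  rewrite (_ : Dx f \- g = (Dx f \- derive1 (p n)) \+ (derive1 (p n) \- g)); last first.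
    by apply/funext => x /=; rewrite addrA subrK.
  apply: (le_trans (l2normD (L2B Lf' Lp') (L2B Lp' Lg))).
  by rewrite [leRHS](_ : _ = s / 2 + s / 2); [exact: lerD|lra].
have fg2 : l2norm (Dx f \- g) ^+ 2 <= e.
  by rewrite -[leRHS](sqr_sqrtr (ltW e0)) lerXn2r ?nnegrE ?l2norm_ge0// ltW.
apply: le_trans fg2; rewrite h2 -/(cosine_energy _ _) lerDl; apply: sumr_ge0 => j _; exact: sqr_ge0.
Unshelve. all: by end_near. Qed.

End Completeness.

(** * The Dirichlet spectrum *)

Section Spectrum.
Variable R : realType.
Implicit Types (f g : R -> R).
Local Notation mu := (@leb R).
Local Notation I := (@I01 R).
Local Notation sine := (@sine R).
Local Notation cosine := (@cosine R).
Local Notation freq := (@freq R).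

Lemma inner_sine_Dx2 f j : sob10 f -> sob1 (Dx f) ->
  inner (sine j) (Dx (Dx f)) = - freq j ^+ 2 * inner f (sine j).
Proof.
move=> hf sf'; rewrite inner_sine_Dx// (innerC (cosine j)) inner_Dx_cosine//.
by ring.
Qed.

Lemma freq_inj i j : freq i = freq j -> i = j.
Proof. by move/(mulIf (lt0r_neq0 (pi_gt0 R)))/eqP; rewrite eqr_nat => /eqP. Qed.

Lemma freq_sqr_inj i j : freq i ^+ 2 = freq j ^+ 2 -> i = j.
Proof.
have f0 k : 0 <= freq k by rewrite mulr_ge0// pi_ge0.
by move/eqP; rewrite eqrXn2// => /eqP/freq_inj.
Qed.

(** An eigenfunction has at most one nonzero sine coefficient, as the
    coefficient of index [m] forces the eigenvalue [freq m ^+ 2]; by Parseval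
    it has at least one and is a multiple of that sine. *)
Lemma eigenpair_sine l f : dirichlet_eigenpair l f -> exists2 m, (0 < m)%N &
  [/\ l = freq m ^+ 2, l2norm f ^+ 2 = inner f (sine m) ^+ 2 &
   {ae mu, forall x, I x -> f x = inner f (sine m) * sine m x}].
Proof.
move=> [[_ sf'] hf fn0 eig]; have Lf := sob10_L2 hf.
have coef m : l * inner f (sine m) = freq m ^+ 2 * inner f (sine m).
  have := inner_sine_Dx2 m hf sf'.
  rewrite (inner_aer (g' := fun x => - l * f x) (sine_L2 R m) (Dx_L2 sf')).
  - rewrite innerZr//; last exact: sine_L2.
    by rewrite (innerC (sine m)) !mulNr => /oppr_inj.
  - exact: L2Z.
  - by apply: filterS eig => x h Ix; rewrite mulNr -h// opprK.
have [m m0 fm] : exists2 m, (0 < m)%N & inner f (sine m) != 0.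
  apply: contrapT => no; have z M : sine_energy M f = 0.
    rewrite /sine_energy big1_seq// => j; rewrite mem_index_iota => /and3P[_ j1 _].
    have [->|h] := eqVneq (inner f (sine j)) 0; first by rewrite expr0n.
    by exfalso; apply: no; exists j.
  have /cvg_lim := parseval hf.
  rewrite (_ : (fun M => sine_energy M f) = fun=> 0); last by apply/funext.
  move=> /(_ (@Rhausdorff R)); rewrite lim_cst// => /esym/eqP.
  by rewrite sqrf_eq0 (negbTE fn0).
have lE : l = freq m ^+ 2 by exact: (mulIf fm (coef m)).
have other j : j != m -> inner f (sine j) = 0.
  move=> jm; apply/eqP; move/eqP: (coef j); rewrite lE -subr_eq0 -mulrBl mulf_eq0.
  move=> /orP[|//]; rewrite subr_eq0 => /eqP/freq_sqr_inj e.
  by rewrite e eqxx in jm.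
have nf : l2norm f ^+ 2 = inner f (sine m) ^+ 2.
  have /cvg_lim := parseval hf; move=> /(_ (@Rhausdorff R)) <-.
  apply: cvg_lim => //; apply: cvg_near_cst; near=> M.
  have mM : (m <= M)%N by near: M; exact: nbhs_infty_ge.
  rewrite /sine_energy (bigD1_seq m) ?iota_uniq//=; last by rewrite mem_index_iota m0.
  by rewrite big1 ?addr0// => j jm; rewrite other// expr0n.
exists m => //; split => //.
have Ls := L2Z (inner f (sine m)) (sine_L2 R m).
have : l2norm (f \- (fun x => inner f (sine m) * sine m x)) = 0.
  apply/eqP; rewrite -sqrf_eq0 l2norm_sqrB// innerZr//; last exact: sine_L2.
  rewrite nf (sqr_l2norm (fun x => inner f (sine m) * sine m x)) innerZl//; last exact: sine_L2.
  rewrite innerZr; [|exact: sine_L2|exact: sine_L2].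
  by rewrite sine_orthonormal// eqxx mulr1n; apply/eqP; ring.
move=> /(l2norm_eq0_ae (L2B Lf Ls)); apply: filterS => x h Ix.
by apply/eqP; rewrite -subr_eq0; apply/eqP; exact: h.
Unshelve. all: by end_near. Qed.

(** Both sides enumerate the same set in increasing order. *)
Lemma spectrum_lam lam (w : nat -> R -> R) : dirichlet_spectrum lam w ->
  forall j, (0 < j)%N -> lam j = freq j ^+ 2.
Proof.
move=> [lam_lt eig all_eig _].
have fle i j : (freq i ^+ 2 < freq j ^+ 2) = (i < j)%N.
  by rewrite ltr_pXn2r ?nnegrE ?mulr_ge0 ?pi_ge0// ltr_pM2r ?pi_gt0// ltr_nat.
elim/ltn_ind => j IH j0.
have [m m0 [lm _ _]] := eigenpair_sine (eig j j0).
have jm : (j <= m)%N.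
  case: j j0 IH lm => // -[|j] _ IH lm; first by [].
  by rewrite -fle -lm -(IH j.+1)// lam_lt.
have [i i0 ji] := all_eig _ _ (sine_eigenpair R j0).
have ij : (j <= i)%N.
  rewrite leqNgt; apply/negP => ij; have := IH i ij i0; rewrite -ji => /freq_sqr_inj e.
  by rewrite e ltnn in ij.
have mj : (m <= j)%N.
  rewrite leqNgt -fle -lm ji -leNgt; move: ij; rewrite leq_eqVlt => /predU1P[->//|ij].
  by rewrite ltW// lam_lt.
by rewrite lm; congr (freq _ ^+ 2); apply/eqP; rewrite eqn_leq mj.
Qed.

(** [w j] is the sine up to its sign, which the projection on a line ignores. *)
Lemma spectrum_w lam (w : nat -> R -> R) : dirichlet_spectrum lam w ->
  forall j f, (0 < j)%N -> L2 f ->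
  {ae mu, forall x, I x -> inner f (w j) * w j x = inner f (sine j) * sine j x}.
Proof.
move=> sp j f j0 Lf; have [_ eig _ on] := sp.
have [m m0 [lm nf wE]] := eigenpair_sine (eig j j0).
have mj : m = j by apply: freq_sqr_inj; rewrite -lm (spectrum_lam sp).
rewrite {}mj {m0 lm} in nf wE.
have [_ /sob10_L2 Lw _ _] := eig j j0.
set a := inner (w j) (sine j) in nf wE.
have a2 : a ^+ 2 = 1 by rewrite -nf sqr_l2norm on// eqxx.
have -> : inner f (w j) = a * inner f (sine j).
  rewrite -innerZr//; last exact: sine_L2.
  by apply: inner_aer => //; apply: L2Z; exact: sine_L2.
by apply: filterS wE => x h Ix; rewrite h// mulrCA !mulrA -expr2 a2 mul1r mulrC.
Qed.

(** Term by term comparison of the two Parseval series. *)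
Lemma poincare f : sob10 f -> freq 1 ^+ 2 * l2norm f ^+ 2 <= l2norm (Dx f) ^+ 2.
Proof.
move=> hf; have h1 : (fun M => freq 1 ^+ 2 * sine_energy M f) @ \oo --> freq 1 ^+ 2 * l2norm f ^+ 2.
  by apply: cvgMr; exact: parseval.
have h2 := parseval_Dx hf.
apply: (ler_cvg_to h1 h2); apply: nearW => M.
rewrite cosine_energy_Dx// mulr_sumr; apply: ler_sum_nat => j /andP[j1 _].
by rewrite ler_wpM2r ?sqr_ge0// lerXn2r ?nnegrE ?mulr_ge0 ?pi_ge0// ler_pM2r ?pi_gt0// ler_nat.
Qed.

End Spectrum.

(** * Classical derivatives from weak ones *)

Section TimeIntegrals.
Variable R : realType.
Implicit Types (f g : R -> R) (D : set R).
Local Notation mu := (@leb R).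

Section ae_integral.
Import HBNNSimple.
Local Open Scope ereal_scope.

(** The integral, being a supremum over simple functions, depends only on the
    a.e. class of the integrand, measurable or not: a simple function may be
    cut off on a null set without changing its integral. *)
Lemma ge0_le_integral_ae D (f g : measurableTypeR R -> \bar R) :
  (forall x, D x -> 0 <= f x) -> (forall x, D x -> 0 <= g x) ->
  {ae mu, forall x, D x -> f x <= g x} ->
  \int[mu]_(x in D) f x <= \int[mu]_(x in D) g x.
Proof.
move=> f0 g0 [N [mN N0 subN]].
rewrite ge0_integralE// [leRHS]ge0_integralE//.
apply: ge_ereal_sup => _ [h /= hf <-].
have mA : measurable (setT `\` N) by exact: measurableD.
have -> : sintegral mu h = sintegral mu (proj_nnsfun h mA).
  rewrite -mrestrict -integral_nnsfun// -integralT_nnsfun.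
  apply: ge0_negligible_integral => //.
    by apply/measurable_EFinP; exact: measurable_funPT.
  by move=> x _; rewrite lee_fin; exact: fun_ge0.
apply: ereal_sup_ubound; exists (proj_nnsfun h mA) => // x /=.
have gD0 : 0 <= (g \_ D) x.
  by rewrite patchE; case: ifPn => // xD; apply: g0; rewrite inE in xD.
have -> : ((h x * \1_(setT `\` N) x)%R = (h \_ (setT `\` N)) x)%R.
  by rewrite mrestrict.
rewrite patchE; case: ifPn => // xN; apply: le_trans (hf x) _.
rewrite !patchE; case: ifPn => // xD; rewrite inE in xN; rewrite inE in xD.
have := xN.2; apply: contra_notP => fg; apply: subN => /= /(_ xD).
exact: fg.
Qed.

Lemma integral_ae_congr D (f g : measurableTypeR R -> \bar R) :
  {ae mu, forall x, D x -> f x = g x} ->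
  \int[mu]_(x in D) f x = \int[mu]_(x in D) g x.
Proof.
have le0 (u v : measurableTypeR R -> \bar R) : (forall x, 0 <= u x) -> (forall x, 0 <= v x) ->
    {ae mu, forall x, D x -> u x = v x} -> \int[mu]_(x in D) u x = \int[mu]_(x in D) v x.
  move=> u0 v0 uv; apply/eqP; rewrite eq_le; apply/andP; split.
    by apply: ge0_le_integral_ae => //; apply: filterS uv => x h /h ->.
  by apply: ge0_le_integral_ae => //; apply: filterS uv => x h /h ->.
move=> fg; rewrite integralE [RHS]integralE; congr (_ - _).
  apply: le0 => [x|x|]; [exact: funepos_ge0|exact: funepos_ge0|].
  by apply: filterS fg => x h Dx; rewrite !funeposE h.
apply: le0 => [x|x|]; [exact: funeneg_ge0|exact: funeneg_ge0|].
by apply: filterS fg => x h Dx; rewrite !funenegE h.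
Qed.

End ae_integral.

Lemma Rintegral_ae_congr D f g :
  {ae mu, forall x, D x -> f x = g x} ->
  \int[mu]_(x in D) f x = \int[mu]_(x in D) g x.
Proof.
move=> fg; congr fine; apply: integral_ae_congr.
by apply: filterS fg => x h Dx; rewrite h.
Qed.

Lemma Rintegral_supp D (E : set R) f : E `<=` D -> (forall x, D x -> ~ E x -> f x = 0) ->
  \int[mu]_(x in D) f x = \int[mu]_(x in E) f x.
Proof.
move=> ED f0; rewrite Rintegral_mkcond [RHS]Rintegral_mkcond.
apply: eq_Rintegral => x _; rewrite !patchE; case: ifPn => xD; case: ifPn => //.
  by rewrite notin_setE; apply: f0; rewrite inE in xD.
by move=> xE; exfalso; move: xD; rewrite notin_setE; apply; apply: ED; rewrite inE in xE.
Qed.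

Lemma continuous_in_integrable f (p q : R) : (forall x, p <= x <= q -> {for x, continuous f}) ->
  mu.-integrable `[p, q] (EFin \o f).
Proof.
move=> cf; apply: continuous_compact_integrable; first exact: segment_compact.
apply: continuous_in_subspaceT => x; rewrite inE /= in_itv /=; exact: cf.
Qed.

Lemma Rintegral_oo_cc f (p q : R) : mu.-integrable `[p, q] (EFin \o f) ->
  \int[mu]_(x in `]p, q[) f x = \int[mu]_(x in `[p, q]) f x.
Proof.
move=> fi; rewrite Rintegral_itv_bndo_bndc; last first.
  by apply: (@integrableS _ _ _ mu `[p, q]) => //; exact: subset_itv_oo_cc.
rewrite Rintegral_itv_obnd_cbnd//.
by apply: (@integrableS _ _ _ mu `[p, q]) => //; exact: subset_itv_oc_cc.
Qed.

Lemma continuous_in_integrable_oo f (p q a b : R) :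
  (forall x, p <= x <= q -> {for x, continuous f}) -> p <= a -> b <= q ->
  mu.-integrable `]a, b[ (EFin \o f).
Proof.
move=> cf pa bq; apply: (@integrableS _ _ _ mu `[p, q]) => //.
- move=> x; rewrite /= !in_itv/= => /andP[ax xb].
  by rewrite (le_trans pa (ltW ax)) (le_trans (ltW xb) bq).
- exact: continuous_in_integrable.
Qed.

Lemma zero_integral_eq0 f (p q : R) : p < q ->
  (forall x, p <= x <= q -> {for x, continuous f}) ->
  (forall a b, p <= a -> a <= b -> b <= q -> \int[mu]_(x in `]a, b[) f x = 0) ->
  forall x, p < x < q -> f x = 0.
Proof.
move=> pq cf f0 x /andP[px xq].
have fi : mu.-integrable [set` Interval (BRight p) (BRight q)] (EFin \o f).
  apply: (@integrableS _ _ _ mu `[p, q]) => //; first exact: subset_itv_oc_cc.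
  exact: continuous_in_integrable.
have [] := continuous_FTC1 xq fi px _; first by apply: cf; rewrite !ltW.
set F := (fun _ : R => _) => _; rewrite -/(derive1 _ x) => <-.
rewrite derive1E -(@near_eq_derive _ _ _ (fun=> 0) F); first by rewrite derive_cst.
near=> y; have py : p < y by near: y; exact: lt_nbhsr.
have yq : y < q by near: y; exact: lt_nbhsl.
rewrite /F -Rintegral_itv_bndo_bndc; first by rewrite f0// ltW.
by apply: (continuous_in_integrable_oo cf) => //; exact: ltW.
Unshelve. all: by end_near. Qed.

(** du Bois-Reymond: orthogonality to all smooth functions of zero mean forces
    constancy; the constant is the mean against a fixed bump of [`]p, q[]. *)
Lemma orthogonal_mean0_cst f (p q : R) : p < q ->
  (forall x, p <= x <= q -> {for x, continuous f}) ->
  (forall eta, (forall n, Ck n eta) -> (forall x, ~ (p < x < q) -> eta x = 0) ->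
     \int[mu]_(x in `]p, q[) eta x = 0 -> \int[mu]_(x in `]p, q[) (f x * eta x) = 0) ->
  exists k, forall x, p < x < q -> f x = k.
Proof.
move=> pq cf forth; have pq' := ltW pq.
have bump_out n a b x : p <= a -> a <= b -> b <= q -> ~ (p < x < q) -> bump n a b x = 0.
  move=> pa ab bq nx; apply/eqP; apply: contra_notT nx => /(bump_supp ab)/andP[ax xb].
  by rewrite (le_lt_trans pa ax) (lt_le_trans xb bq).
have ic g (a b : R) : continuous g -> mu.-integrable `]a, b[ (EFin \o g).
  exact: continuous_integrable_itvo.
have cb (n : nat) (a b : R) : continuous (bump n a b) by exact: Ck_continuous (bump_Ck 0 n a b).
have [n0 psi0] : exists n, 0 < \int[mu]_(x in `]p, q[) bump n p q x.
  have c1 : continuous (fun _ : R => 1 : R) by move=> x; exact: cvg_cst.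
  have := bump_integral_cvg pq' (@subset_refl _ `]p, q[%classic) (ic _ p q c1).
  under eq_fun do under eq_Rintegral do rewrite mul1r.
  have len : \int[mu]_(x in `]p, q[) 1 = q - p.
    have d1 (x : R) : is_derive x (1 : R) (fun x : R => x) 1 by exact: is_derive_id.
    by have := integral_derive1 pq (Ck_id R 1); rewrite (derive1_ext d1).
  rewrite len => h; have qp0 : 0 < q - p by rewrite subr_gt0.
  by apply: (@filter_ex _ \oo); exact: (cvgr_gt _ h).
set psi := bump n0 p q in psi0; set m := \int[mu]_(x in _) _ in psi0.
have icf g : continuous g -> mu.-integrable `]p, q[ (EFin \o (fun x => f x * g x)).
  move=> cg; apply: (@continuous_in_integrable_oo _ p q) => // x xpq.
  by apply: cvgM; [exact: cf|exact: cg].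
have ib (n : nat) (a b : R) : mu.-integrable `]p, q[ (EFin \o bump n a b) := ic _ p q (cb n a b).
have iZ (c : R) g : mu.-integrable `]p, q[ (EFin \o g) ->
    mu.-integrable `]p, q[ (EFin \o (fun x => c * g x)).
  by move=> gi; exact: (@integrableZl _ _ _ mu _ (measurable_itv _) c _ gi).
pose k := (\int[mu]_(x in `]p, q[) (f x * psi x)) / m.
exists k; suff : forall x, p < x < q -> f x - k = 0.
  by move=> h x /h/eqP; rewrite subr_eq0 => /eqP.
apply: (zero_integral_eq0 pq).
  by move=> x xpq; apply: cvgB; [exact: cf|exact: cvg_cst].
move=> a b pa ab bq.
have abpq : `]a, b[%classic `<=` `]p, q[%classic.
  by move=> x; rewrite /= !in_itv/= => /andP[ax xb]; rewrite (le_lt_trans pa ax) (lt_le_trans xb bq).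
have fki : mu.-integrable `]a, b[ (EFin \o (fun x => f x - k)).
  apply: (@continuous_in_integrable_oo _ p q) => // x xpq.
  by apply: cvgB; [exact: cf|exact: cvg_cst].
have /cvg_lim := bump_integral_cvg ab abpq fki.
move=> /(_ (@Rhausdorff R)) <-.
rewrite (_ : (fun n => _) = fun=> 0) ?lim_cst//; apply/funext => n.
(* the multiple of [psi] that brings the mean of the bump to zero *)
pose r := (\int[mu]_(x in `]p, q[) bump n a b x) / m.
have eta0 : \int[mu]_(x in `]p, q[) (bump n a b x - r * psi x) = 0.
  rewrite RintegralB//; last exact: iZ (ib _ _ _).
  rewrite RintegralZl//; last exact: ib.
  by rewrite -/m /r divfK ?subrr// gt_eqF.
have := forth (fun x => bump n a b x - r * psi x) _ _ eta0.
have -> : (fun x => f x * (bump n a b x - r * psi x)) =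
   (fun x => f x * bump n a b x - r * (f x * psi x)) by apply/funext => x; ring.
rewrite RintegralB//; [|exact: icf (cb _ _ _)|exact: iZ (icf _ (cb _ _ _))].
rewrite RintegralZl//; last exact: icf (cb _ _ _).
move=> h; have {h} : \int[mu]_(x in `]p, q[) (f x * bump n a b x) = r * \int[mu]_(x in `]p, q[) (f x * psi x).
  apply/eqP; rewrite -subr_eq0; apply/eqP; apply: h.
    move=> l; apply: (CkD (g := fun x => - (r * psi x))); first exact: bump_Ck.
    rewrite (_ : (fun x => _) = (fun=> - r) \* psi); last by apply/funext => x /=; rewrite mulNr.
    by apply: CkM; [exact: Ck_cst|exact: bump_Ck].
  by move=> x nx; rewrite /psi !bump_out// mulr0 subrr.
move=> h; under eq_Rintegral do rewrite mulrBl.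
rewrite RintegralB//; [|exact: icf (cb _ _ _)|exact: iZ (ib _ _ _)].
rewrite RintegralZl//.
by rewrite h /k /r; apply/eqP; rewrite subr_eq0; apply/eqP; field; rewrite gt_eqF.
Qed.

Lemma Rplus_itv (p q : R) : 0 < p -> `]p, q[ `<=` @Rplus R.
Proof.
by move=> p0 x; rewrite /Rplus /= !in_itv/= andbT => /andP[px _]; exact: lt_trans px.
Qed.

(** For a primitive [B] of [b], the difference [a - B] is orthogonal to the
    derivatives of smooth functions that vanish outside an interval, that is,
    to the smooth functions of zero mean that vanish there; it is constant. *)
Lemma weak_deriv_is_derive (a b : R -> R) :
  (forall t, 0 < t -> {for t, continuous a}) -> (forall t, 0 < t -> {for t, continuous b}) ->
  weak_deriv (@Rplus R) a b -> forall t : R, 0 < t -> is_derive t (1 : R) a (b t).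
Proof.
move=> ca cb wab t t0.
(* [p < t < q] bounds the interval of the argument, and [B] starts at [s < p] so
   as to be differentiable at [p] *)
pose s := t / 2; pose p := 3 / 4 * t; pose q := t + 1.
have s0 : 0 < s by rewrite /s; lra.
have sp : s < p by rewrite /s /p; lra.
have pt : p < t by rewrite /p; lra.
have tq : t < q by rewrite /q; lra.
have p0 : 0 < p := lt_trans s0 sp.
have pq : p < q := lt_trans pt tq.
pose B x := \int[mu]_(y in `[s, x]) b y.
have dB x : s < x -> is_derive x (1 : R) B (b x).
  move=> sx; have xu : x < x + 1 by rewrite ltrDl.
  have bi : mu.-integrable `[s, x + 1] (EFin \o b).
    apply: continuous_in_integrable => y /andP[sy _]; apply: cb; exact: lt_le_trans sy.
  have [d1 d2] := continuous_FTC1_closed xu bi sx (cb x (lt_trans s0 sx)).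
  by apply: DeriveDef; [exact: d1|rewrite -derive1E; exact: d2].
have cB x : s < x -> {for x, continuous B}.
  by move=> sx; apply/differentiable_continuous/derivable1_diffP; have [] := dB x sx.
have sW x : p <= x -> s < x by exact: lt_le_trans.
have W0 x : p <= x -> 0 < x by exact: lt_le_trans.
have [k akB] : exists k, forall x, p < x < q -> a x - B x = k.
  apply: (orthogonal_mean0_cst pq).
    by move=> x /andP[px _]; apply: cvgB; [apply: ca; exact: W0|apply: cB; exact: sW].
  move=> eta Ce eta_out eta0.
  have ceta : continuous eta := Ck_continuous (Ce 0%N).
  pose phi x := \int[mu]_(y in [set` `]-oo, x]]) eta y.
  have etaT : mu.-integrable setT (EFin \o eta).
    have := (@integrable_mkcond _ _ _ mu `[p, q] (EFin \o eta) (measurable_itv _)).1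
      (continuous_integrable_itv p q ceta).
    apply: eq_integrable => // x _; rewrite patchE; case: ifPn => // nx.
    rewrite /= eta_out// => /andP[px xq]; move: nx; rewrite notin_setE /= in_itv/=.
    by rewrite !ltW.
  have etaE x : x <= q -> phi x = \int[mu]_(y in `]p, x[) eta y.
    move=> xq; rewrite Rintegral_itv_bndo_bndc; last exact: integrableS etaT.
    apply: Rintegral_supp => y; rewrite /= !in_itv/=; first by case/andP.
    by move=> -> ny; apply: eta_out => /andP[py _]; apply: ny; rewrite py.
  have dphi x : is_derive x (1 : R) phi (eta x).
    have ei : mu.-integrable [set` Interval -oo%O (BRight (x + 1))] (EFin \o eta).
      exact: integrableS etaT.
    have xx1 : x < x + 1 by rewrite ltrDl.
    have [d1 d2] := continuous_FTC1 xx1 ei (ltNyr _) (ceta x).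
    by apply: DeriveDef; [exact: d1|rewrite -derive1E; exact: d2].
  have phi_out x : ~ (p < x < q) -> phi x = 0.
    move=> nx; have [xp|px] := leP x p.
      rewrite etaE ?(le_trans xp (ltW pq))// set_itv_ge ?Rintegral_set0//.
      by rewrite -leNgt bnd_simp.
    have qx : q <= x by rewrite leNgt; apply/negP => xq; apply: nx; rewrite px.
    rewrite /phi (Rintegral_supp (E := `]p, q[%classic))//.
      by move=> y; rewrite /= !in_itv/= => /andP[_ yq]; rewrite ltW// (lt_le_trans yq).
    by move=> y _; rewrite /= in_itv/= => /eta_out.
  have Cphi n : Ck n phi by apply: CkS; exact: Ck_ext dphi (Ce n).
  have Tphi : test_fun (@Rplus R) phi.
    apply: (@test_mk _ _ `[p, q]%classic) => //; first exact: segment_compact.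
      by move=> x; rewrite /Rplus/= !in_itv/= andbT => /andP[px _]; exact: W0.
    move=> x; apply: contraNP; rewrite /= in_itv/= => nx; apply/eqP; apply: phi_out.
    by move=> /andP[px xq]; apply: nx; rewrite !ltW.
  have := wab _ Tphi; rewrite (derive1_ext dphi).
  rewrite (@Rintegral_supp (@Rplus R) `]p, q[%classic (fun x => a x * eta x)); last 2 first.
  - exact: Rplus_itv.
  - by move=> x _; rewrite /= in_itv/= => nx; rewrite eta_out// mulr0.
  rewrite (@Rintegral_supp (@Rplus R) `]p, q[%classic (fun x => b x * phi x)); last 2 first.
  - exact: Rplus_itv.
  - by move=> x _; rewrite /= in_itv/= => nx; rewrite phi_out// mulr0.
  have cphi : continuous phi := Ck_continuous (Cphi 0%N).
  have bphi : mu.-integrable `[p, q] (EFin \o (fun x => b x * phi x)).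
    apply: continuous_in_integrable => x /andP[px _].
    by apply: cvgM; [apply: cb; exact: W0|exact: cphi].
  have Beta : mu.-integrable `[p, q] (EFin \o (fun x => B x * eta x)).
    apply: continuous_in_integrable => x /andP[px _].
    by apply: cvgM; [apply: cB; exact: sW|exact: ceta].
  have aeta : mu.-integrable `[p, q] (EFin \o (fun x => a x * eta x)).
    apply: continuous_in_integrable => x /andP[px _].
    by apply: cvgM; [apply: ca; exact: W0|exact: ceta].
  have LR (F f' : R -> R) : (forall x, p <= x -> is_derive x (1 : R) F (f' x)) ->
      derivable_oo_LRcontinuous F p q /\ {in `]p, q[, derive1 F =1 f'}.
    move=> dF; have cF x : p <= x -> {for x, continuous F}.
      by move=> px; apply/differentiable_continuous/derivable1_diffP; have [] := dF x px.
    split; last first.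
      move=> x; rewrite in_itv/= => /andP[/ltW px _].
      by rewrite derive1E; have [] := dF x px.
    split.
    - by move=> x; rewrite in_itv/= => /andP[/ltW px _]; have [] := dF x px.
    - by apply: cvg_at_right_filter; exact: cF (lexx p).
    - by apply: cvg_at_left_filter; exact: cF (ltW pq).
  have [B1 B2] := LR B b (fun x px => dB x (sW x px)).
  have [P1 P2] := LR phi eta (fun x _ => dphi x).
  have cbW : {within `[p, q], continuous b}.
    apply: continuous_in_subspaceT => x; rewrite inE /= in_itv /= => /andP[px _].
    by apply: cb; exact: W0.
  have := Rintegration_by_parts pq cbW B1 B2 (continuous_subspaceT ceta) P1 P2.
  rewrite (phi_out p) ?ltxx// (phi_out q) ?ltxx ?andbF// !mulr0 subr0 sub0r.
  rewrite -!Rintegral_oo_cc// => hB hA.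
  under eq_Rintegral do rewrite mulrBl.
  rewrite RintegralB//.
  - by rewrite hA; apply/eqP; rewrite subr_eq0; apply/eqP.
  - by apply: integrableS aeta => //; exact: subset_itv_oo_cc.
  - by apply: integrableS Beta => //; exact: subset_itv_oo_cc.
apply: (@is_derive_val _ t (0 + b t)); last by rewrite add0r.
apply: (@near_eq_is_derive _ _ _ ((fun=> k) \+ B)); last by apply: is_deriveD; exact: dB (lt_trans sp pt).
near=> x; rewrite /= -(akB x) ?subrK//; apply/andP; split; near: x; [exact: lt_nbhsr|exact: lt_nbhsl].
Unshelve. all: by end_near. Qed.

End TimeIntegrals.

(** * Coefficients of a solution *)

Section Coefficients.
Variable R : realType.
Implicit Types (f g : R -> R) (D : set R).
Local Notation mu := (@leb R).
Local Notation I := (@I01 R).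
Local Notation sine := (@sine R).
Local Notation cosine := (@cosine R).
Local Notation freq := (@freq R).

Lemma measurable_Rplus : measurable (@Rplus R : set (measurableTypeR R)).
Proof. exact: measurable_itv. Qed.
Hint Resolve measurable_Rplus : core.

Lemma sine_l2norm j : (0 < j)%N -> l2norm (sine j) = 1.
Proof. by move=> j0; rewrite /l2norm sine_orthonormal// eqxx sqrtr1. Qed.

(** Off a null set [N] the coefficients are limits of those of simple functions;
    cutting [N] off makes the limit Borel. *)
Lemma coef_measurable (h : R -> R -> R) j : (0 < j)%N ->
  L2_time (@Rplus R) (@L2 R) (@l2norm R) h ->
  exists eta : R -> R, [/\ measurable_fun (@Rplus R) eta,
    {ae mu, forall t, Rplus t -> inner (h t) (sine j) = eta t} &
    mu.-integrable (@Rplus R) (EFin \o (fun t => eta t ^+ 2))].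
Proof.
move=> j0 [[s [ss sh]] Lh hfin]; have Lj := sine_L2 R j.
have [N [mN N0 subN]] := filterI sh Lh.
have good t : Rplus t -> ~ N t -> (fun n => l2norm (h t \- s n t)) @ \oo --> 0 /\ L2 (h t).
  move=> Rt Nt; apply: contrapT => bad; apply: Nt; apply: subN => /= -[h1 h2].
  by apply: bad; split; [exact: h1|exact: h2].
pose E := @Rplus R `\` N.
have mE : measurable (E : set (measurableTypeR R)) by exact: measurableD.
pose eta := (fun t => inner (h t) (sine j)) \_ E.
have Ls n t : L2 (s n t).
  have [m [A [e [_ Le sE]]]] := ss n.
  have -> : s n t = (fun x => \sum_(i < m) \1_(A i) t * e i x) by apply/funext => x; rewrite sE.
  by apply: L2_sum => i _; exact: L2Z.
have meta : measurable_fun setT eta.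
  apply: (@measurable_fun_cvg _ _ _ _ (fun n => (fun t => inner (s n t) (sine j)) \_ E)).
    move=> n; apply/(measurable_restrictT _ _).1 => //.
    have [m [A [e [mA Le sE]]]] := ss n.
    rewrite (_ : (fun t => _) = (fun t => \sum_(i < m) \1_(A i) t * inner (e i) (sine j))).
      apply: measurable_sum => i; apply: measurable_funM; last exact: measurable_cst.
      exact: measurable_indic.
    apply/funext => t.
    have -> : s n t = (fun x => \sum_(i < m) \1_(A i) t * e i x) by apply/funext => x; rewrite sE.
    rewrite inner_suml//; last by move=> i _; exact: L2Z.
    by apply: eq_bigr => i _; rewrite innerZl.
  move=> t _; rewrite /eta patchE; case: ifPn => tE.
    rewrite inE in tE; have [h1 h2] := good t tE.1 tE.2.
    rewrite (_ : (fun n => _) = (fun n => inner (s n t) (sine j))).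
      exact: cvg_inner.
    by apply/funext => n; rewrite patchE mem_set.
  rewrite (_ : (fun n => _) = (fun n => 0)); first exact: cvg_cst.
  by apply/funext => n; rewrite patchE (negbTE tE).
exists eta; split.
- exact: measurable_funTS meta.
- exists N; split => // t /= nt; apply: contrapT => Nt; apply: nt => Rt.
  by rewrite /eta patchE mem_set.
- apply/integrableP; split.
    by apply/measurable_EFinP; apply: measurable_funX; exact: measurable_funTS meta.
  apply: le_lt_trans hfin; apply: ge0_le_integral_ae => [t _|t _|].
  + exact: abse_ge0.
  + by rewrite lee_fin sqr_ge0.
  + apply: aeW => t Rt /=; rewrite lee_fin ger0_norm ?sqr_ge0// /eta patchE.
    case: ifPn => tE; last by rewrite expr0n sqr_ge0.
    rewrite inE in tE; have [_ h2] := good t tE.1 tE.2.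
    rewrite -[leLHS]real_normK ?num_real// lerXn2r ?nnegrE ?l2norm_ge0//.
    by have := cauchy_schwarz h2 Lj; rewrite sine_l2norm// mulr1.
Qed.

Lemma test_Rplus_supp phi : test_fun (@Rplus R) phi ->
  exists p q : R, [/\ 0 < p, p < q & forall x, phi x != 0 -> p <= x <= q].
Proof.
move=> Tp; have [_ cK pD] := Tp; set K := closure _ in cK pD.
have KP x : phi x != 0 -> K x by move=> p0; exact: subset_closure.
have [M [_ /(_ (`|M| + 1))]] := compact_bounded cK.
rewrite (le_lt_trans (ler_norm _)) ?ltrDl// => /(_ isT) KM.
have : \forall y \near (0 : R), (~` K) y.
  apply: open_nbhs_nbhs; split; first by apply: closed_openC; exact: closed_closure.
  by move=> /pD; rewrite /Rplus/= in_itv/= ltxx.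
move=> /nbhs_ballP[r /= r0 rc].
exists (Num.min r 1), (`|M| + 2); split.
- by rewrite lt_min r0 /=.
- by rewrite gt_min; apply/orP; right; rewrite ltr_wpDl// ltr1n.
- move=> x /KP Kx; have := KM x Kx; have := pD x Kx.
  rewrite /Rplus/= in_itv/= andbT => x0; rewrite gtr0_norm// => xM; apply/andP; split.
    rewrite ge_min; apply/orP; left; rewrite leNgt; apply/negP => xr.
    by apply: (rc x) => //; rewrite /ball/= sub0r normrN gtr0_norm.
  by apply: le_trans xM _; rewrite lerD2l ler1n.
Qed.

Lemma integrable_supp D (E : set R) f : measurable (D : set (measurableTypeR R)) ->
  measurable (E : set (measurableTypeR R)) -> E `<=` D ->
  (forall x, D x -> ~ E x -> f x = 0) ->
  mu.-integrable E (EFin \o f) -> mu.-integrable D (EFin \o f).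
Proof.
move=> mD mE ED f0 fi.
apply: (@integrable_mkcond _ _ _ mu D (EFin \o f) mD).2.
have := (@integrable_mkcond _ _ _ mu E (EFin \o f) mE).1 fi.
apply: eq_integrable => // x _; rewrite !patchE; case: ifPn => xE.
  by rewrite ifT// inE; apply: ED; rewrite inE in xE.
by case: ifPn => // xD; rewrite /= f0//; [rewrite inE in xD|rewrite notin_setE in xE].
Qed.

Lemma integrable_mul_test (b phi : R -> R) : (forall t, 0 < t -> {for t, continuous b}) ->
  continuous phi -> (exists p q : R, [/\ 0 < p, p < q & forall x, phi x != 0 -> p <= x <= q]) ->
  mu.-integrable (@Rplus R) (EFin \o (fun x => b x * phi x)).
Proof.
move=> cb cp [p [q [p0 pq pP]]]; apply: (@integrable_supp _ `[p, q]%classic) => //.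
- by move=> x; rewrite /Rplus/= !in_itv/= andbT => /andP[px _]; exact: lt_le_trans px.
- move=> x _; rewrite /= in_itv/= => nx; have [->|/pP//] := eqVneq (phi x) 0.
  by rewrite mulr0.
- apply: continuous_in_integrable => x /andP[px _].
  by apply: cvgM; [apply: cb; exact: lt_le_trans px|exact: cp].
Qed.

(** The rough forcing [eta] is integrable against test functions, being square
    integrable, and cancels in the difference. *)
Lemma weak_deriv_diff (a1 a2 b1 b2 c1 c2 eta : R -> R) :
  (forall t, 0 < t -> {for t, continuous a1}) -> (forall t, 0 < t -> {for t, continuous a2}) ->
  (forall t, 0 < t -> {for t, continuous c1}) -> (forall t, 0 < t -> {for t, continuous c2}) ->
  measurable_fun (@Rplus R) eta ->
  mu.-integrable (@Rplus R) (EFin \o (fun t => eta t ^+ 2)) ->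
  {ae mu, forall t, Rplus t -> b1 t = c1 t + eta t} ->
  {ae mu, forall t, Rplus t -> b2 t = c2 t + eta t} ->
  weak_deriv (@Rplus R) a1 b1 -> weak_deriv (@Rplus R) a2 b2 ->
  weak_deriv (@Rplus R) (a1 \- a2) (c1 \- c2).
Proof.
move=> ca1 ca2 cc1 cc2 meta eta2 b1E b2E w1 w2 phi Tp.
have Tp' := test_derive1 Tp.
have [cp cp'] : continuous phi /\ continuous (derive1 phi).
  by split; [exact: Ck_continuous (test_Ck 0 Tp)|exact: Ck_continuous (test_Ck 0 Tp')].
have sp := test_Rplus_supp Tp; have sp' := test_Rplus_supp Tp'.
have c1cst t : 0 < t -> {for t, continuous phi} by move=> _; exact: cp.
have pi2 := integrable_mul_test c1cst cp sp.
have etai : mu.-integrable (@Rplus R) (EFin \o (fun t => eta t * phi t)).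
  have := integrableD measurable_Rplus eta2 pi2.
  apply: le_integrable => //.
    by apply/measurable_EFinP; apply: measurable_funM => //; apply: measurable_funTS; exact: continuous_measurable_fun.
  move=> x _ /=; rewrite lee_fin [leRHS]ger0_norm ?addr_ge0 -?expr2 ?sqr_ge0//.
  by rewrite ler_norml expr2; apply/andP; split; nra.
have i1 := integrable_mul_test cc1 cp sp; have i2 := integrable_mul_test cc2 cp sp.
have j1 := integrable_mul_test ca1 cp' sp'; have j2 := integrable_mul_test ca2 cp' sp'.
have E1 : \int[mu]_(t in @Rplus R) (b1 t * phi t) =
    \int[mu]_(t in @Rplus R) (c1 t * phi t) + \int[mu]_(t in @Rplus R) (eta t * phi t).
  rewrite -RintegralD//; apply: Rintegral_ae_congr.
  by apply: filterS b1E => t h Rt; rewrite h// mulrDl.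
have E2 : \int[mu]_(t in @Rplus R) (b2 t * phi t) =
    \int[mu]_(t in @Rplus R) (c2 t * phi t) + \int[mu]_(t in @Rplus R) (eta t * phi t).
  rewrite -RintegralD//; apply: Rintegral_ae_congr.
  by apply: filterS b2E => t h Rt; rewrite h// mulrDl.
have := w1 _ Tp; have := w2 _ Tp; rewrite E1 E2 => h2 h1.
transitivity (\int[mu]_(t in @Rplus R) (a1 t * derive1 phi t) -
    \int[mu]_(t in @Rplus R) (a2 t * derive1 phi t)).
  by rewrite -RintegralB//; apply: eq_Rintegral => x _; rewrite mulrBl.
rewrite h1 h2; transitivity (- (\int[mu]_(t in @Rplus R) (c1 t * phi t) -
    \int[mu]_(t in @Rplus R) (c2 t * phi t))); first by ring.
by congr (- _); rewrite -RintegralB//; apply: eq_Rintegral => x _ /=; rewrite mulrBl.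
Qed.

Lemma L2_mul_ae_bounded f g (M : R) : L2 f -> measurable_fun I g ->
  {ae mu, forall x, I x -> `|g x| <= M} -> L2 (fun x => f x * g x).
Proof.
move=> [mf f2] mg gM; split; first exact: measurable_funM.
apply/integrableP; split; first by apply/measurable_EFinP/measurable_funX; exact: measurable_funM.
have /integrableP[_] := integrableZl (@measurable_I01 R) (M ^+ 2) f2.
apply: le_lt_trans; apply: ge0_le_integral_ae => [x _|x _|]; [exact: abse_ge0|exact: abse_ge0|].
apply: filterS gM => x h Ix; have gxM := h Ix.
rewrite lee_fin [leRHS]ger0_norm; last by rewrite mulr_ge0 ?sqr_ge0.
rewrite [leLHS]ger0_norm ?sqr_ge0//.
have g2 : g x ^+ 2 <= M ^+ 2.
  by rewrite -[leLHS]real_normK ?num_real// lerXn2r ?nnegrE// (le_trans _ gxM).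
have -> : (f x * g x) ^+ 2 = g x ^+ 2 * f x ^+ 2 by rewrite mulrC exprMn.
by rewrite ler_wpM2r ?sqr_ge0.
Qed.

Lemma l2norm_mul_ae_bounded f g (M : R) : 0 <= M -> L2 f -> measurable_fun I g ->
  {ae mu, forall x, I x -> `|g x| <= M} -> l2norm (fun x => f x * g x) <= M * l2norm f.
Proof.
move=> M0 Lf mg gM; have Lfg := L2_mul_ae_bounded Lf mg gM.
have := l2norm_le Lfg (L2Z M Lf); rewrite l2normZ// (ger0_norm M0); apply.
apply: filterS gM => x h Ix; rewrite !normrM mulrC (ger0_norm M0).
by rewrite ler_wpM2r// h.
Qed.

Lemma cvg_inner2 (p q : nat -> R -> R) f g : L2 f -> L2 g ->
  (forall n, L2 (p n)) -> (forall n, L2 (q n)) ->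
  (fun n => l2norm (f \- p n)) @ \oo --> 0 ->
  (fun n => l2norm (g \- q n)) @ \oo --> 0 ->
  (fun n => inner (p n) (q n)) @ \oo --> inner f g.
Proof.
move=> Lf Lg Lp Lq fp gq.
have lim0 : (fun n => l2norm (f \- p n) * l2norm g + l2norm f * l2norm (g \- q n) +
    l2norm (f \- p n) * l2norm (g \- q n)) @ \oo --> 0.
  apply: cvgD0; last by rewrite -[X in _ --> X](mulr0 0); exact: cvgM.
  apply: cvgD0; first by rewrite -[X in _ --> X](mul0r (l2norm g)); exact: cvgMl.
  by rewrite -[X in _ --> X](mulr0 (l2norm f)); exact: cvgMr.
apply/cvgrPdist_le => e e0 /=.
move/cvgr0_norm_le : lim0 => /(_ _ e0); apply: filterS => n /(le_trans (ler_norm _)).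
apply: le_trans; have Lfp := L2B Lf (Lp n); have Lgq := L2B Lg (Lq n).
have -> : inner f g - inner (p n) (q n) =
   inner (f \- p n) g + inner f (g \- q n) - inner (f \- p n) (g \- q n).
  by rewrite !innerBl// !innerBr//; ring.
apply: (le_trans (ler_normB _ _)); apply: lerD; last exact: cauchy_schwarz.
by apply: (le_trans (ler_normD _ _)); apply: lerD; exact: cauchy_schwarz.
Qed.

Lemma sine_bound j x : `|sine j x| <= 2.
Proof.
rewrite /sine normrM ger0_norm ?sqrtr_ge0//.
have s2 : Num.sqrt 2 <= 2 :> R.
  by rewrite -[leRHS](@ger0_norm R 2)// -sqrtr_sqr ler_sqrt//; lra.
rewrite -[leRHS]mulr1; apply: ler_pM => //; exact: sin_max.
Qed.

Lemma cosine_bound j x : `|cosine j x| <= 2.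
Proof.
rewrite /cosine normrM ger0_norm ?sqrtr_ge0//.
have s2 : Num.sqrt 2 <= 2 :> R.
  by rewrite -[leRHS](@ger0_norm R 2)// -sqrtr_sqr ler_sqrt//; lra.
rewrite -[leRHS]mulr1; apply: ler_pM => //; exact: cos_max.
Qed.

Lemma measurable_cont_I01 f : continuous f -> measurable_fun I f.
Proof. by move=> cf; apply: measurable_funTS; exact: continuous_measurable_fun. Qed.

Lemma mul_cosine_L2 j f : L2 f -> L2 (fun x => f x * cosine j x).
Proof.
move=> Lf; apply: (@L2_mul_bounded _ _ _ 2) => // [|x _]; last exact: cosine_bound.
apply: measurable_cont_I01; exact: Ck_continuous (cosine_Ck R 0 j).
Qed.

Lemma mul_sine_L2 j f : L2 f -> L2 (fun x => f x * sine j x).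
Proof.
move=> Lf; apply: (@L2_mul_bounded _ _ _ 2) => // [|x _]; last exact: sine_bound.
apply: measurable_cont_I01; exact: Ck_continuous (sine_Ck R 0 j).
Qed.

(** The coefficient [(f ^ 2, cosine j)], as an inner product of two square
    integrable functions. *)
Definition quad j f := inner f (fun x => f x * cosine j x).

(** [(f f', e) = - (f ^ 2, e') / 2]; the right-hand side is continuous in [f] for
    the [L^2] norm. *)
Lemma convection_coef j f : sob10 f ->
  inner (Dx f) (fun x => f x * sine j x) = - (freq j / 2) * quad j f.
Proof.
move=> hf; have [p [Tp fp fp']] := sob10_approx hf.
have Lf := sob10_L2 hf; have Lf' := Dx_L2 (sob10_sob1 hf).
have Lp n := test_L2 (Tp n); have Lp' n := test_derive1_L2 (Tp n).
have mulcvg (e : R -> R) : continuous e -> (forall x, `|e x| <= 2) ->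
    (fun n => l2norm ((fun x => f x * e x) \- (fun x => p n x * e x))) @ \oo --> 0.
  move=> ce e2; have : (fun n => 2 * l2norm (f \- p n)) @ \oo --> 0.
    by rewrite -[X in _ --> X](mulr0 2); exact: cvgMr.
  apply: squeeze0 => n; first exact: l2norm_ge0.
  rewrite (_ : _ \- _ = (fun x => (f \- p n) x * e x)); last by apply/funext => x /=; ring.
  apply: l2norm_mul_ae_bounded => //; first exact: L2B.
    exact: measurable_cont_I01.
  by apply: aeW => x _; exact: e2.
have cs : continuous (sine j) := Ck_continuous (sine_Ck R 0 j).
have cc : continuous (cosine j) := Ck_continuous (cosine_Ck R 0 j).
have h1 := cvg_inner2 Lf' (mul_sine_L2 j Lf) Lp' (fun n => mul_sine_L2 j (Lp n)) fp'
  (mulcvg _ cs (sine_bound j)).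
have h2 := cvg_inner2 Lf (mul_cosine_L2 j Lf) Lp (fun n => mul_cosine_L2 j (Lp n)) fp
  (mulcvg _ cc (cosine_bound j)).
have pE n : inner (derive1 (p n)) (fun x => p n x * sine j x) =
    - (freq j / 2) * inner (p n) (fun x => p n x * cosine j x).
  have Cps : Ck 1 (p n \* sine j) by apply: CkM; [exact: test_Ck (Tp n)|exact: sine_Ck].
  have := weak_deriv_Ck1 Cps (Tp n); rewrite -/(inner _ _) -/(inner _ _).
  have -> : derive1 (p n \* sine j) =
      (fun x => p n x * (freq j * cosine j x)) \+ (fun x => derive1 (p n) x * sine j x).
    apply: derive1_ext => x.
    have := is_deriveM (derivable_is_derive (Ck_derivable (test_Ck 0 (Tp n)) x)) (is_derive_sine j x).
    by move/is_derive_val; apply; rewrite /GRing.scale /=; ring.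
  rewrite innerDl//; last 2 first.
    rewrite (_ : (fun x => _) = (fun x => freq j * (p n x * cosine j x))).
      by apply: L2Z; exact: mul_cosine_L2.
    by apply/funext => x; ring.
    exact: mul_sine_L2.
  rewrite (_ : (fun x => p n x * (freq j * cosine j x)) = (fun x => freq j * (p n x * cosine j x))); last first.
    by apply/funext => x; ring.
  rewrite innerZl//; last exact: mul_cosine_L2.
  have -> : inner (p n \* sine j) (derive1 (p n)) = inner (derive1 (p n)) (fun x => p n x * sine j x).
    by rewrite innerC.
  have -> : inner (fun x => derive1 (p n) x * sine j x) (p n) =
      inner (derive1 (p n)) (fun x => p n x * sine j x).
    by apply: eq_Rintegral => x _; ring.
  rewrite (innerC (fun x => p n x * cosine j x)); lra.
have h3 : (fun n => inner (derive1 (p n)) (fun x => p n x * sine j x)) @ \oo -->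
    - (freq j / 2) * quad j f.
  by rewrite (funext pE); apply: cvgMr; exact: h2.
by rewrite -(cvg_lim _ h1)// (cvg_lim _ h3).
Qed.

(** The right-hand side, without the forcing, of the ordinary differential
    equation satisfied by the coefficient of index [j] of a solution. *)
Definition coef_rhs (nu k r : R) j f :=
  - (nu * freq j ^+ 2) * inner f (sine j) + freq j * quad j f + r * inner f (sine j)
  - k * l2norm f ^+ 2 * inner f (sine j).

(** All derivatives of [f] are moved to the sine, so that the coefficient of
    [f_t] is, up to the forcing, continuous in [f] for the [L^2] norm. *)
Lemma equation_coef (nu k r c0 : R) j f ft F : sobolev_constant c0 ->
  sob10 f -> sob2 f -> L2 ft -> L2 F ->
  {ae mu, forall x, I x -> ft x - nu * Dx (Dx f) x + 2 * f x * Dx f x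
    - r * f x + k * l2norm f ^+ 2 * f x = F x} ->
  inner ft (sine j) = coef_rhs nu k r j f + inner F (sine j).
Proof.
move=> [c00 sob] hf [sf sf'] Lft LF eqn; have Lj := sine_L2 R j.
have Lf := sob1_L2 sf; have Lf' := Dx_L2 sf; have Lf'' := Dx_L2 sf'.
have [mf _] := Lf.
have Lc : L2 (fun x => Dx f x * f x) by apply: L2_mul_ae_bounded Lf' mf (sob _ hf).
pose G := (((fun x => nu * Dx (Dx f) x) \- (fun x => 2 * (Dx f x * f x))) \+
  (fun x => r * f x)) \- (fun x => k * l2norm f ^+ 2 * f x).
have LG : L2 (G \+ F).
  apply: L2D => //; apply: L2B; last exact: L2Z.
  by apply: L2D; last exact: L2Z; apply: L2B; exact: L2Z.
rewrite (inner_ae (f' := G \+ F) (g' := sine j))//; last 2 first.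
- by apply: filterS eqn => x h Ix; rewrite /G /= -h//; ring.
- exact: aeW.
have L1 := L2Z nu Lf''; have L2' := L2Z 2 Lc; have L3 := L2Z r Lf.
have L4 := L2Z (k * l2norm f ^+ 2) Lf.
have L5 := L2B L1 L2'; have L6 := L2D L5 L3; have L7 := L2B L6 L4.
rewrite innerDl// innerBl// innerDl// innerBl// !innerZl//.
rewrite (innerC (Dx (Dx f))) (inner_sine_Dx2 j hf sf').
have -> : inner (fun x => Dx f x * f x) (sine j) = inner (Dx f) (fun x => f x * sine j x).
  by apply: eq_Rintegral => x _; rewrite mulrA.
by rewrite (convection_coef j hf) /coef_rhs; field.
Qed.

(** The feedback acts on each sine coefficient separately. *)
Lemma projection_coef (w : nat -> R -> R) lam f N j : dirichlet_spectrum lam w -> L2 f -> (0 < j)%N ->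
  inner (fun x => \sum_(1 <= i < N.+1) inner f (w i) * w i x) (sine j) =
  (j <= N)%N%:R * inner f (sine j).
Proof.
move=> sp Lf j0; have Lw i : (0 < i)%N -> L2 (w i).
  by move=> i0; have [_ eig _ _] := sp; have [_ /sob10_L2] := eig i i0.
have Lj := sine_L2 R j.
elim: N => [|N IH].
  rewrite leqNgt j0 mul0r -[RHS](inner0l (sine j)); congr inner.
  by apply/funext => x; rewrite big_geq.
have Ls : L2 (fun x => \sum_(1 <= i < N.+1) inner f (w i) * w i x).
  rewrite (_ : (fun x => _) = (fun x => \sum_(i < N) inner f (w i.+1) * w i.+1 x)).
    by apply: L2_sum => i _; apply: L2Z; exact: Lw.
  by apply/funext => x; rewrite big_add1 big_mkord.
rewrite (_ : (fun x => _) = (fun x => \sum_(1 <= i < N.+1) inner f (w i) * w i x) \+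
    (fun x => inner f (w N.+1) * w N.+1 x)); last first.
  by apply/funext => x; rewrite big_nat_recr.
have LwN := L2Z (inner f (w N.+1)) (Lw N.+1 isT).
rewrite innerDl// IH.
have Lss := L2Z (inner f (sine N.+1)) (sine_L2 R N.+1).
rewrite (inner_ae LwN Lss Lj Lj (spectrum_w sp (ltn0Sn N) Lf)); last exact: aeW.
rewrite innerZl//; last exact: sine_L2.
rewrite sine_orthonormal// [(j <= N.+1)%N]leq_eqVlt ltnS [j == _]eq_sym.
have [e|jN] := eqVneq N.+1 j; first by rewrite -e ltnn /= mul0r add0r mulrC.
by rewrite mulr0 addr0.
Qed.

Section Continuity.
Variables (u : R -> R -> R).
Hypothesis Lu : forall t, 0 <= t -> L2 (u t).
Hypothesis cu : forall t, 0 <= t ->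
  l2norm (u s \- u t) @[s --> within `[0, +oo[ (nbhs t)] --> (0 : R).

Lemma curve_cvg t : 0 < t -> l2norm (u s \- u t) @[s --> t] --> (0 : R).
Proof.
move=> t0; have := cu (ltW t0); apply: cvg_trans; apply: cvg_app.
move=> A [e /= e0 h]; have : \forall s \near t, 0 < s by exact: lt_nbhsr.
move=> [d /= d0 hd]; exists (Num.min e d); first by rewrite /= lt_min e0.
move=> s /=; rewrite lt_min => /andP[se sd]; apply: h => //=.
by rewrite in_itv/= andbT ltW//; exact: hd.
Qed.

(** The factors besides [l2norm (f \- g)] admit functionals that are quadratic in
    [f], for which the modulus of continuity depends on the base point. *)
Lemma curve_continuous (Phi : (R -> R) -> R) (K : R -> R) t : 0 < t ->
  (forall f g, L2 f -> L2 g ->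
    `|Phi f - Phi g| <= K (l2norm g) * l2norm (f \- g) * (1 + l2norm (f \- g))) ->
  {for t, continuous (fun s => Phi (u s))}.
Proof.
move=> t0 PK; have c := curve_cvg t0.
have lim0 : (fun s => K (l2norm (u t)) * l2norm (u s \- u t) * (1 + l2norm (u s \- u t))) @ t --> 0.
  have e : K (l2norm (u t)) * 0 * (1 + 0) = 0 by rewrite mulr0 mul0r.
  rewrite -[X in _ --> X]e.
  by apply: cvgM; [exact: cvgMr|apply: cvgD => //; exact: cvg_cst].
apply/cvgrPdist_le => e e0.
have : \forall s \near t, 0 < s by exact: lt_nbhsr.
move/cvgr0_norm_le : lim0 => /(_ _ e0); apply: filterS2 => s h s0.
rewrite distrC; apply: le_trans (le_trans (ler_norm _) h).
by apply: PK; exact/Lu/ltW.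
Qed.

Lemma inner_continuous g t : L2 g -> 0 < t -> {for t, continuous (fun s => inner (u s) g)}.
Proof.
move=> Lg t0; apply: (@curve_continuous (fun f => inner f g) (fun=> l2norm g)) => // f f' Lf Lf'.
rewrite -innerBl//; apply: (le_trans (cauchy_schwarz (L2B Lf Lf') Lg)).
rewrite mulrC ler_peMr ?mulr_ge0 ?l2norm_ge0// lerDl; exact: l2norm_ge0.
Qed.

Lemma l2norm_continuous t : 0 < t -> {for t, continuous (fun s => l2norm (u s))}.
Proof.
move=> t0; apply: (@curve_continuous (@l2norm R) (fun=> 1)) => // f g Lf Lg.
apply: (le_trans (l2norm_dist Lf Lg)).
rewrite mul1r ler_peMr ?l2norm_ge0// lerDl; exact: l2norm_ge0.
Qed.

Lemma quad_continuous j t : 0 < t -> {for t, continuous (fun s => quad j (u s))}.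
Proof.
move=> t0; apply: (@curve_continuous (quad j) (fun n => 4 * (n + 1))) => // f g Lf Lg.
have Lfg := L2B Lf Lg; have Lfc := mul_cosine_L2 j Lf; have Lgc := mul_cosine_L2 j Lg.
have Lfgc := mul_cosine_L2 j Lfg.
have nc h : L2 h -> l2norm (fun x => h x * cosine j x) <= 2 * l2norm h.
  move=> Lh; apply: l2norm_mul_ae_bounded => //.
    by apply: measurable_cont_I01; exact: Ck_continuous (cosine_Ck R 0 j).
  by apply: aeW => x _; exact: cosine_bound.
have -> : quad j f - quad j g =
    inner (f \- g) (fun x => (f \- g) x * cosine j x) + 2 * inner (f \- g) (fun x => g x * cosine j x).
  have -> : (fun x => (f \- g) x * cosine j x) =
      (fun x => f x * cosine j x) \- (fun x => g x * cosine j x).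
    by apply/funext => x /=; rewrite mulrBl.
  have sym : inner g (fun x => f x * cosine j x) = inner f (fun x => g x * cosine j x).
    by apply: eq_Rintegral => x _; ring.
  by rewrite /quad innerBr// !innerBl// sym; ring.
have d0 := l2norm_ge0 (f \- g); have g0 := l2norm_ge0 g.
apply: (le_trans (ler_normD _ _)); rewrite normrM (@ger0_norm _ 2)//.
have b1 := le_trans (cauchy_schwarz Lfg Lfgc) (ler_wpM2l d0 (nc _ Lfg)).
have b2 := le_trans (cauchy_schwarz Lfg Lgc) (ler_wpM2l d0 (nc _ Lg)).
by move: b1 b2 d0 g0; move: (l2norm _) (l2norm g) `|_| `|_| => d n a b; nra.
Qed.

Lemma coef_rhs_continuous nu k r j t : 0 < t ->
  {for t, continuous (fun s => coef_rhs nu k r j (u s))}.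
Proof.
move=> t0; have ci := inner_continuous (sine_L2 R j) t0.
have cq := @quad_continuous j t t0; have cn := l2norm_continuous t0.
apply: cvgB; last by apply: cvgM => //; apply: cvgMr; rewrite expr2; apply: cvgM.
by apply: cvgD; [apply: cvgD; exact: cvgMr|exact: cvgMr].
Qed.

End Continuity.

End Coefficients.

(** * Energy estimate and decay *)

Section Decay.
Variable R : realType.
Implicit Types (f g : R -> R) (D : set R).
Local Notation mu := (@leb R).
Local Notation I := (@I01 R).
Local Notation sine := (@sine R).
Local Notation cosine := (@cosine R).
Local Notation freq := (@freq R).

Lemma eq_ler (x y : R) : x = y -> x <= y.
Proof. by move=> ->. Qed.

Lemma ae_Rplus_local (P : R -> Prop) :
  (forall T : R, 0 < T -> {ae mu, forall t, `]0, T[%classic t -> P t}) ->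
  {ae mu, forall t, Rplus t -> P t}.
Proof.
move=> h; have : {ae mu, forall t n, `]0, n.+1%:R[%classic t -> P t}.
  by apply/ae_foralln => n; apply: h.
apply: filterS => t Pt; rewrite /Rplus /= in_itv /= andbT => t0.
apply: (Pt (Num.truncn t)); rewrite /= in_itv /= t0 /=; exact: truncnS_gt.
Qed.

(** The equation, which holds for almost every time, tested with a sine. *)
Lemma solution_coef (nu k r c0 : R) (F u : R -> R -> R) (u0 : R -> R) j : sobolev_constant c0 ->
  strong_solution nu k r F u0 u -> {ae mu, forall t, Rplus t -> L2 (F t)} ->
  exists b, weak_deriv (@Rplus R) (fun t => inner (u t) (sine j)) b /\
   {ae mu, forall t, Rplus t -> b t = coef_rhs nu k r j (u t) + inner (F t) (sine j)}.
Proof.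
move=> sob [[hu _] reg [ut [Lut dt eqn]] _] LF.
exists (fun t => inner (ut t) (sine j)); split; first exact: dt (sine_L2 R j).
have s2 : {ae mu, forall t, Rplus t -> sob2 (u t)}.
  by apply: ae_Rplus_local => T T0; have [_ [_ + _]] := reg T T0.
have l2 : {ae mu, forall t, Rplus t -> L2 (ut t)}.
  by apply: ae_Rplus_local => T T0; have [_ + _] := Lut T T0.
near=> t => Rt; have t0 : 0 <= t.
  by move: Rt; rewrite /Rplus /= in_itv /= andbT => /ltW.
have e := @equation_coef R nu k r c0 j (u t) (ut t) (F t) sob (hu t t0).
refine (e _ _ _ _).
- by move: Rt; near: t.
- by move: Rt; near: t.
- by move: Rt; near: t.
- by move: Rt; near: t.
Unshelve. all: by end_near. Qed.

(** The limit [Y] is not known to be differentiable, and Gronwall's argument is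
    applied to the truncated energies [E M].  The remainder [K (Y - E M)] tends
    to zero pointwise and boundedly, hence drops out of the integrated
    inequality. *)
Lemma gronwall_limit (xi K B s : R) (E E' : nat -> R -> R) (Y : R -> R) (M0 : nat) :
  0 <= xi -> 0 <= K ->
  (forall M t, s <= t -> is_derive t (1 : R) (E M) (E' M t)) ->
  (forall M t, s <= t -> {for t, continuous (E' M)}) ->
  (forall t, s <= t -> E ^~ t @ \oo --> Y t) ->
  (forall M t, s <= t -> 0 <= E M t <= Y t) ->
  (forall t, s <= t -> Y t <= B) ->
  (forall M t, (M0 <= M)%N -> s <= t -> E' M t <= - xi * E M t + K * (Y t - E M t)) ->
  forall t, s <= t -> Y t <= Y s * expR (- xi * (t - s)).
Proof.
move=> xi0 K0 dE cE' EY E0Y YB ineq t; rewrite le_eqVlt => /predU1P[<-|st].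
  by rewrite subrr mulr0 expR0 mulr1.
have ws x : `[s, t]%classic x -> s <= x by rewrite /= in_itv/= => /andP[].
have cE M x : s <= x -> {for x, continuous (E M)}.
  by move=> sx; apply/differentiable_continuous/derivable1_diffP; have [] := dE M x sx.
have cexp x : {for x, continuous (fun y : R => expR (xi * y))}.
  apply: continuous_comp; [apply: cvgMr; exact: cvg_id|exact: continuous_expR].
pose W M x := expR (xi * x) * E M x.
pose w M x := expR (xi * x) * (xi * E M x + E' M x).
pose G M x := expR (xi * x) * (K * (Y x - E M x)).
have dW M x : s <= x -> is_derive x (1 : R) (W M) (w M x).
  move=> sx; have dm : is_derive x (1 : R) (fun x : R => xi * x) xi.
    have := is_deriveZ xi (is_derive_id x (1 : R)).
    by move/is_derive_val; apply; rewrite /GRing.scale /= mulr1.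
  have de := @is_derive1_comp _ expR (fun x : R => xi * x) _ _ _ (is_derive_expR _) dm.
  have := is_deriveM de (dE M x sx).
  by move/is_derive_val; apply; rewrite /w /GRing.scale /=; ring.
have cw M x : s <= x -> {for x, continuous (w M)}.
  move=> sx; apply: cvgM; first exact: cexp.
  by apply: cvgD; [apply: cvgMr; exact: cE|exact: cE'].
have cW M x : s <= x -> {for x, continuous (W M)}.
  by move=> sx; apply: cvgM; [exact: cexp|exact: cE].
have mst : measurable (`[s, t]%classic : set (measurableTypeR R)) by exact: measurable_itv.
have mcont f : (forall x, s <= x -> {for x, continuous f}) -> measurable_fun `[s, t] f.
  move=> cf; apply: subspace_continuous_measurable_fun; first exact: measurable_itv.
  by apply: continuous_in_subspaceT => x; rewrite inE => /ws; exact: cf.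
have mY : measurable_fun `[s, t] Y.
  apply: (@measurable_fun_cvg _ _ _ _ E) => [M|x /ws sx]; last exact: EY.
  by apply: mcont; exact: cE.
have mG M : measurable_fun `[s, t] (G M).
  apply: measurable_funM; first by apply: mcont => x _; exact: cexp.
  apply: measurable_funM; first exact: measurable_cst.
  by apply: measurable_funB => //; apply: mcont; exact: cE.
have GB M x : `[s, t]%classic x -> `|G M x| <= expR (xi * t) * (K * B).
  move=> xst; have sx := ws _ xst; have /andP[E0 EYx] := E0Y M x sx; have YBx := YB x sx.
  have xt : x <= t by move: xst; rewrite /= in_itv/= => /andP[].
  have YE : 0 <= Y x - E M x by rewrite subr_ge0.
  rewrite ger0_norm ?mulr_ge0 ?expR_ge0//; apply: ler_pM; rewrite ?mulr_ge0 ?expR_ge0//.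
    by rewrite ler_expR ler_wpM2l.
  by rewrite ler_wpM2l//; lra.
have cstint (c : R) : mu.-integrable `[s, t] (EFin \o (fun=> c)).
  apply: continuous_in_integrable => x _; exact: cvg_cst.
have iG M : mu.-integrable `[s, t] (EFin \o G M).
  have := cstint (expR (xi * t) * (K * B)).
  apply: (@le_integrable _ _ _ mu _ mst); first by apply/measurable_EFinP; exact: mG.
  by move=> x xst /=; rewrite lee_fin; apply: le_trans (GB M x xst) (ler_norm _).
have iw M : mu.-integrable `[s, t] (EFin \o w M).
  by apply: continuous_in_integrable => x /andP[sx _]; exact: cw.
have ftc M : \int[mu]_(x in `[s, t]) w M x = W M t - W M s.
  have LR : derivable_oo_LRcontinuous (W M) s t.
    split.
    - by move=> x; rewrite in_itv/= => /andP[/ltW sx _]; have [] := dW M x sx.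
    - by apply: cvg_at_right_filter; exact: cW (lexx s).
    - by apply: cvg_at_left_filter; exact: cW (ltW st).
  have dWE : {in `]s, t[, derive1 (W M) =1 w M}.
    by move=> x; rewrite in_itv/= => /andP[/ltW sx _]; rewrite derive1E; have [] := dW M x sx.
  have cww : {within `[s, t], continuous (w M)}.
    by apply: continuous_in_subspaceT => x; rewrite inE => /ws; exact: cw.
  by rewrite /Rintegral (continuous_FTC2 st cww LR dWE).
have step M : (M0 <= M)%N -> W M t - W M s <= \int[mu]_(x in `[s, t]) G M x.
  move=> MM; rewrite -ftc; apply: le_Rintegral => // x /ws sx.
  rewrite /w /G ler_wpM2l ?expR_ge0//; have := ineq M x MM sx; lra.
have limG : (fun M => \int[mu]_(x in `[s, t]) G M x) @ \oo --> 0.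
  have [] := @dominated_convergence _ _ _ mu `[s, t]%classic mst
    (fun M x => (G M x)%:E) (fun=> 0%E) (fun=> (expR (xi * t) * (K * B))%:E).
  - by move=> M; apply/measurable_EFinP; exact: mG.
  - exact: measurable_cst.
  - apply: aeW => x xst; apply: cvg_EFin; first by near=> n.
    have e : expR (xi * x) * (K * (Y x - Y x)) = 0 by rewrite subrr !mulr0.
    rewrite -[X in _ --> X]e; apply: cvgMr; apply: cvgMr; apply: cvgB; first exact: cvg_cst.
    by apply: EY; exact: ws.
  - exact: cstint.
  - by apply: aeW => x M xst; rewrite lee_fin; exact: GB.
  by move=> _ _; rewrite integral0 => /fine_cvg.
have limW x : s <= x -> W ^~ x @ \oo --> expR (xi * x) * Y x.
  by move=> sx; apply: cvgMr; exact: EY.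
have lim1 : (fun M => W M t - W M s) @ \oo --> expR (xi * t) * Y t - expR (xi * s) * Y s.
  by apply: cvgB; apply: limW => //; exact: ltW.
have : expR (xi * t) * Y t - expR (xi * s) * Y s <= 0.
  apply: (ler_cvg_to lim1 limG); near=> M; apply: step; near: M; exact: nbhs_infty_ge.
rewrite subr_le0 => h.
rewrite (_ : - xi * (t - s) = xi * s - xi * t); last by ring.
by rewrite expRB mulrA ler_pdivlMr ?expR_gt0// mulrC [Y s * _]mulrC.
Unshelve. all: by end_near. Qed.

(** [f f' - g g' = f' (f - g) + (f - g)' g], and the Sobolev inequality bounds the
    factors that are not differentiated. *)
Lemma convection_diff_bound c0 f g : sobolev_constant c0 -> sob10 f -> sob10 g ->
  let C := (fun x => Dx f x * f x) \- (fun x => Dx g x * g x) in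
  L2 C /\ l2norm C <= c0 * (l2norm (Dx f) + l2norm (Dx g)) * l2norm (Dx (f \- g)).
Proof.
move=> [c00 sob] hf hg C; have hz := sob10B hf hg.
have Lf := sob10_L2 hf; have Lg := sob10_L2 hg; have Lz := sob10_L2 hz.
have Lf' := Dx_L2 (sob10_sob1 hf); have Lg' := Dx_L2 (sob10_sob1 hg).
have Lz' := Dx_L2 (sob10_sob1 hz).
have Lff : L2 (fun x => Dx f x * f x) by apply: L2_mul_ae_bounded Lf' Lf.1 (sob _ hf).
have Lgg : L2 (fun x => Dx g x * g x) by apply: L2_mul_ae_bounded Lg' Lg.1 (sob _ hg).
have Lzf : L2 (fun x => Dx f x * (f \- g) x) by apply: L2_mul_ae_bounded Lf' Lz.1 (sob _ hz).
have Lgz : L2 (fun x => Dx (f \- g) x * g x) by apply: L2_mul_ae_bounded Lz' Lg.1 (sob _ hg).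
have LC : L2 C by exact: L2B.
split => //.
rewrite (@l2norm_ae _ _ ((fun x => Dx f x * (f \- g) x) \+ (fun x => Dx (f \- g) x * g x)))//.
- apply: (le_trans (l2normD Lzf Lgz)).
  have zb0 : 0 <= c0 * l2norm (Dx (f \- g)) by rewrite mulr_ge0 ?l2norm_ge0 ?ltW.
  have gb0 : 0 <= c0 * l2norm (Dx g) by rewrite mulr_ge0 ?l2norm_ge0 ?ltW.
  have b1 := l2norm_mul_ae_bounded zb0 Lf' Lz.1 (sob _ hz).
  have b2 := l2norm_mul_ae_bounded gb0 Lz' Lg.1 (sob _ hg).
  apply: (le_trans (lerD b1 b2)).
  move: (l2norm (Dx f)) (l2norm (Dx g)) (l2norm (Dx (f \- g))) => p q z.
  by apply: eq_ler; ring.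
- exact: L2D.
- apply: filterS (DxB_ae (sob10_sob1 hf) (sob10_sob1 hg)) => x h Ix.
  by rewrite /C /= h//=; ring.
Qed.

Lemma orthonormal_sqr_norm (e : nat -> R -> R) (c : nat -> R) M :
  (forall j, L2 (e j)) ->
  (forall i j, (0 < i)%N -> (0 < j)%N -> inner (e i) (e j) = (i == j)%:R) ->
  l2norm (fun x => \sum_(1 <= j < M.+1) c j * e j x) ^+ 2 = \sum_(1 <= j < M.+1) c j ^+ 2.
Proof.
move=> Le oe; have := orthonormal_dist c M Le oe (L2_0 R).
rewrite (_ : _ \- _ = fun x => - \sum_(1 <= j < M.+1) c j * e j x); last first.
  by apply/funext => x /=; rewrite sub0r.
rewrite l2normN => ->; rewrite {1}/l2norm inner0l sqrtr0 expr0n/= sub0r.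
rewrite big1 => [|j _]; last by rewrite inner0l expr0n.
by rewrite oppr0 add0r; apply: eq_bigr => j _; rewrite inner0l sub0r sqrrN.
Qed.

(** Young's inequality.  It is used with [P = - (f - g)''] truncated to [M] modes,
    whose norm the dissipation controls. *)
Lemma convection_energy (nu c0 H2 H4 : R) f g P :
  0 < nu -> sobolev_constant c0 -> sob10 f -> sob10 g ->
  l2norm (Dx f) ^+ 2 <= H4 -> l2norm (Dx g) ^+ 2 <= H2 -> L2 P ->
  - 4 * inner ((fun x => Dx f x * f x) \- (fun x => Dx g x * g x)) P <=
  nu * l2norm P ^+ 2 + 8 * c0 ^+ 2 / nu * (H4 + H2) * l2norm (Dx (f \- g)) ^+ 2.
Proof.
move=> nu0 sobc hf hg fH4 gH2 LP; have [LC] := convection_diff_bound sobc hf hg.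
have := cauchy_schwarz LC LP; move: (inner _ P) => cp; set C := _ \- _.
have := l2norm_ge0 C; have := l2norm_ge0 (Dx f); have := l2norm_ge0 (Dx g).
have := l2norm_ge0 (Dx (f \- g)); have [c00 _] := sobc.
move: (l2norm C) (l2norm P) (l2norm (Dx f)) (l2norm (Dx g)) (l2norm (Dx (f \- g))) fH4 gH2.
move=> c p a b y aH bH; clear -nu0 c00 aH bH => y0 b0 a0 cge0 cpb cb.
have h1 : - cp <= c * p by apply: le_trans cpb; rewrite -normrN ler_norm.
have h2 : 4 * (c * p) <= nu * p ^+ 2 + 4 / nu * c ^+ 2.
  have : 0 <= nu * (p - 2 / nu * c) ^+ 2 by rewrite mulr_ge0 ?sqr_ge0 ?ltW.
  rewrite (_ : nu * _ = nu * p ^+ 2 + 4 / nu * c ^+ 2 - 4 * (c * p)); last first.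
    by field; rewrite gt_eqF.
  by rewrite subr_ge0.
have h3 : c ^+ 2 <= c0 ^+ 2 * (2 * (H4 + H2)) * y ^+ 2.
  apply: (@le_trans _ _ ((c0 * (a + b) * y) ^+ 2)).
    by rewrite lerXn2r ?nnegrE ?mulr_ge0 ?addr_ge0// ltW.
  rewrite !exprMn ler_wpM2r ?sqr_ge0// ler_wpM2l ?sqr_ge0//.
  by have := sqr_ge0 (a - b); rewrite sqrrB sqrrD; lra.
have h4 : 4 / nu * c ^+ 2 <= 4 / nu * (c0 ^+ 2 * (2 * (H4 + H2)) * y ^+ 2).
  by rewrite ler_wpM2l// divr_ge0// ltW.
have -> : 8 * c0 ^+ 2 / nu * (H4 + H2) * y ^+ 2 = 4 / nu * (c0 ^+ 2 * (2 * (H4 + H2)) * y ^+ 2).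
  by field; rewrite gt_eqF.
by clear -h1 h2 h4; lra.
Qed.

Lemma poincare_l2norm f : sob10 f -> l2norm f <= (freq 1)^-1 * l2norm (Dx f).
Proof.
move=> hf; have fr1 : 0 < freq 1 := freq_gt0 R (ltn0Sn 0).
rewrite ler_pdivlMl// -(@ler_pXn2r _ 2) ?nnegrE ?mulr_ge0 ?l2norm_ge0 ?pi_ge0//.
by rewrite exprMn; exact: poincare.
Qed.

(** The cubic terms differ by [|f| ^ 2 (f - g)], which is dissipative, and by
    [(|f| ^ 2 - |g| ^ 2) g], which is bounded here.  [S] stands for a truncation of
    [(f - g)']. *)
Lemma cubic_energy (H1 H2 H3 : R) f g S :
  0 < H1 -> 0 < H2 -> 0 < H3 -> sob10 f -> sob10 g ->
  l2norm f <= H3 -> l2norm g <= H1 -> l2norm (Dx g) ^+ 2 <= H2 ->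
  L2 S -> l2norm S <= l2norm (Dx (f \- g)) ->
  - ((l2norm f ^+ 2 - l2norm g ^+ 2) * inner S (Dx g)) <=
  (freq 1)^-1 * (H1 + H3) * Num.sqrt H2 * l2norm (Dx (f \- g)) ^+ 2.
Proof.
move=> H10 H20 H30 hf hg fH3 gH1 gH2 LS Sy; have hz := sob10B hf hg.
have n0 := @l2norm_ge0 R; have Lg' := Dx_L2 (sob10_sob1 hg).
have h1 : `|l2norm f ^+ 2 - l2norm g ^+ 2| <= (freq 1)^-1 * l2norm (Dx (f \- g)) * (H1 + H3).
  rewrite subr_sqr normrM ler_pM ?normr_ge0//.
    exact: le_trans (l2norm_dist (sob10_L2 hf) (sob10_L2 hg)) (poincare_l2norm hz).
  by rewrite ger0_norm ?addr_ge0 ?n0// addrC lerD.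
have h2 : `|inner S (Dx g)| <= l2norm (Dx (f \- g)) * Num.sqrt H2.
  apply: (le_trans (cauchy_schwarz LS Lg')); rewrite ler_pM ?n0//.
  rewrite -[leLHS](@ger0_norm R) ?n0// -sqrtr_sqr ler_sqrt//; exact: ltW.
apply: (le_trans (ler_norm _)); rewrite normrN normrM.
apply: (le_trans (ler_pM (normr_ge0 _) (normr_ge0 _) h1 h2)).
by move: (l2norm (Dx (f \- g))) => y; apply: eq_ler; ring.
Qed.

(** Mode by mode: the feedback damps the modes up to [N], and viscosity damps
    the others. *)
Lemma mode_damping (nu m Q1 xi sigma : R) N j :
  0 < nu -> sigma = xi - freq 1 ^+ 2 * nu / 2 ->
  Q1 + sigma / 2 < m -> (freq N.+1 ^+ 2)^-1 * (sigma + 2 * Q1) < nu / 2 -> (0 < j)%N ->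
  - nu * freq j ^+ 2 + 2 * Q1 - 2 * m * (j <= N)%N%:R <= - xi.
Proof.
move=> nu0 sE m_large N_large j1.
have mono i : (0 < i)%N -> (i <= j)%N -> freq i ^+ 2 <= freq j ^+ 2.
  move=> i0 ij; rewrite lerXn2r ?nnegrE ?mulr_ge0 ?pi_ge0//.
  by rewrite /freq ler_wpM2r ?pi_ge0// ler_nat.
have l1 := ler_wpM2l (ltW nu0) (mono 1%N isT j1).
have l10 : 0 <= nu * freq 1 ^+ 2 by rewrite mulr_ge0 ?sqr_ge0// ltW.
have [jN|Nj] := leqP j N; first by rewrite mulr1; clear -l1 l10 m_large sE; lra.
have l2 := ler_wpM2l (ltW nu0) (mono N.+1 isT Nj).
move: N_large; rewrite mulrC ltr_pdivrMr ?exprn_gt0 ?freq_gt0// => l3.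
by rewrite mulr0; clear -l1 l10 l2 l3 sE; lra.
Qed.

(** The energy estimate: [a j] is the coefficient of index [j] of [f - g], and
    [b j] its time derivative when [f] and [g] are the controlled and the
    uncontrolled state. *)
Lemma energy_estimate (nu k r m c0 H1 H2 H3 H4 Q1 xi sigma : R) (N M : nat) f g
    (a b : nat -> R) :
  0 < nu -> 0 < k -> sobolev_constant c0 -> 0 < H1 -> 0 < H2 -> 0 < H3 ->
  sigma = xi - freq 1 ^+ 2 * nu / 2 ->
  Q1 = 4 * c0 ^+ 2 / nu * (H4 + H2) + r + k * (freq 1)^-1 * (H1 + H3) * Num.sqrt H2 ->
  Q1 + sigma / 2 < m -> (freq N.+1 ^+ 2)^-1 * (sigma + 2 * Q1) < nu / 2 ->
  sob10 f -> sob10 g -> l2norm f <= H3 -> l2norm (Dx f) ^+ 2 <= H4 ->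
  l2norm g <= H1 -> l2norm (Dx g) ^+ 2 <= H2 ->
  (forall j, a j = inner f (sine j) - inner g (sine j)) ->
  (forall j, b j = coef_rhs nu k r j f - m * (j <= N)%N%:R * a j - coef_rhs nu k r j g) ->
  \sum_(1 <= j < M.+1) freq j ^+ 2 * (2 * a j * b j) <=
  - xi * (\sum_(1 <= j < M.+1) freq j ^+ 2 * a j ^+ 2) +
  2 * (Q1 - r) * (l2norm (Dx (f \- g)) ^+ 2 - \sum_(1 <= j < M.+1) freq j ^+ 2 * a j ^+ 2).
Proof.
move=> nu0 k0 sobc H10 H20 H30 sE QE m_large N_large hf hg fH3 fH4 gH1 gH2 aE bE.
have hz := sob10B hf hg; have Lf := sob10_L2 hf; have Lg := sob10_L2 hg.
set E := (X in - xi * X + _); set Y := (X in X - E).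
have az j : a j = inner (f \- g) (sine j) by rewrite aE innerBl//; exact: sine_L2.
have EY : E <= Y.
  have := cosine_energy_le M (Dx_L2 (sob10_sob1 hz)); rewrite cosine_energy_Dx//.
  by apply: le_trans; apply: eq_ler; apply: eq_bigr => j _; rewrite az.
pose C := (fun x => Dx f x * f x) \- (fun x => Dx g x * g x).
have [LC _] := convection_diff_bound sobc hf hg; rewrite -/C in LC.
(* minus the second derivative of [f - g], and then its first derivative,
   truncated to [M] modes *)
pose P x := \sum_(1 <= j < M.+1) (freq j ^+ 2 * a j) * sine j x.
have LP : L2 P by apply: L2_sum => j _; apply: L2Z; exact: sine_L2.
have P2 : l2norm P ^+ 2 = \sum_(1 <= j < M.+1) (freq j ^+ 2 * a j) ^+ 2.
  exact: orthonormal_sqr_norm (sine_L2 R) (@sine_orthonormal R).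
have Cj j : freq j * quad j f - freq j * quad j g = - 2 * inner C (sine j).
  have [c00 sob] := sobc.
  have Lff : L2 (fun x => Dx f x * f x).
    by apply: L2_mul_ae_bounded (Dx_L2 (sob10_sob1 hf)) Lf.1 (sob _ hf).
  have Lgg : L2 (fun x => Dx g x * g x).
    by apply: L2_mul_ae_bounded (Dx_L2 (sob10_sob1 hg)) Lg.1 (sob _ hg).
  rewrite /C innerBl//; last exact: sine_L2.
  have ass (q : R -> R) : inner (fun x => Dx q x * q x) (sine j) = inner (Dx q) (fun x => q x * sine j x).
    by apply: eq_Rintegral => x _; rewrite mulrA.
  by rewrite !ass !convection_coef//; field.
have CP : \sum_(1 <= j < M.+1) (freq j ^+ 2 * a j) * inner C (sine j) = inner C P.
  rewrite innerC inner_suml//; last by move=> j _; apply: L2Z; exact: sine_L2.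
  by apply: eq_bigr => j _; rewrite innerZl//; [rewrite innerC|exact: sine_L2].
pose S x := \sum_(1 <= j < M.+1) (freq j * a j) * cosine j x.
have LS : L2 S by apply: L2_sum => j _; apply: L2Z; exact: cosine_L2.
have S2 : l2norm S ^+ 2 = E.
  rewrite (orthonormal_sqr_norm _ _ (cosine_L2 R) (@cosine_orthonormal R)).
  by apply: eq_bigr => j _; rewrite exprMn.
have Lg' := Dx_L2 (sob10_sob1 hg).
have gS : \sum_(1 <= j < M.+1) freq j ^+ 2 * a j * inner g (sine j) = inner S (Dx g).
  rewrite inner_suml//; last by move=> j _; apply: L2Z; exact: cosine_L2.
  apply: eq_bigr => j _; rewrite innerZl//; last exact: cosine_L2.
  by rewrite (innerC (cosine j)) inner_Dx_cosine//; ring.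
have Sy : l2norm S <= l2norm (Dx (f \- g)).
  by rewrite -(@ler_pXn2r _ 2) ?nnegrE ?l2norm_ge0// S2.
have convb := convection_energy nu0 sobc hf hg fH4 gH2 LP; rewrite -/C -/Y in convb.
have cubic := cubic_energy H10 H20 H30 hf hg fH3 gH1 gH2 LS Sy; rewrite -/Y in cubic.
have fpos : 0 <= k * (l2norm f ^+ 2 * E).
  by rewrite mulr_ge0 ?(ltW k0)// mulr_ge0 ?sqr_ge0// -S2 sqr_ge0.
have termwise : \sum_(1 <= j < M.+1)
      (- 2 * nu * freq j ^+ 2 + 2 * r - 2 * m * (j <= N)%N%:R) * (freq j ^+ 2 * a j ^+ 2)
    + nu * l2norm P ^+ 2 + 2 * (Q1 - r) * E <= - xi * E.
  rewrite P2 /E !mulr_sumr -!big_split /=; apply: ler_sum_nat => j /andP[j1 _].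
  move: (mode_damping nu0 sE m_large N_large j1); clear.
  move: (freq j) ((j <= N)%N%:R) (a j) => q e x h.
  rewrite [leLHS](_ : _ = (- nu * q ^+ 2 + 2 * Q1 - 2 * m * e) * (q ^+ 2 * x ^+ 2)); last by ring.
  by apply: ler_wpM2r h; rewrite mulr_ge0 ?sqr_ge0.
have split : \sum_(1 <= j < M.+1) freq j ^+ 2 * (2 * a j * b j) =
    \sum_(1 <= j < M.+1) (- 2 * nu * freq j ^+ 2 + 2 * r - 2 * m * (j <= N)%N%:R) * (freq j ^+ 2 * a j ^+ 2)
    - 4 * inner C P - 2 * (k * (l2norm f ^+ 2 * E))
    + 2 * (k * - ((l2norm f ^+ 2 - l2norm g ^+ 2) * inner S (Dx g))).
  rewrite -CP -gS /E !mulrN !mulr_sumr -!sumrN -!big_split /=.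
  apply: eq_bigr => j _; rewrite bE {}/coef_rhs; have := Cj j; have := aE j.
  move: (a j) (inner f _) (inner g _) (quad j f) (quad j g) (inner C _) (l2norm f) (l2norm g).
  move: (freq j) ((j <= N)%N%:R) => q e a_ fj gj qf qg cj nf ng; clear => ea /eqP.
  rewrite subr_eq => /eqP h.
  have -> : gj = fj - a_ by rewrite ea; ring.
  by rewrite h; ring.
have QE' : 2 * (Q1 - r) * Y = 8 * c0 ^+ 2 / nu * (H4 + H2) * Y +
   2 * (k * ((freq 1)^-1 * (H1 + H3) * Num.sqrt H2 * Y)).
  by rewrite QE; move: nu^-1 (freq 1)^-1 (Num.sqrt H2) (Y) => p q s y; clear; ring.
have cubic' := ler_wpM2l (ltW k0) cubic.
rewrite split mulrBr QE'; move: cubic' convb fpos termwise; clear.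
move: (k * - _) (k * (_ ^+ 2 * E)) (k * ((freq 1)^-1 * _ * _ * Y)) => A B D.
by move: (\sum_(_ <= _ < _) _ * _) (inner C P) (nu * _) (_ * Y) (Q1 - r) => *; lra.
Qed.

End Decay.

(** * The difference of the two solutions *)

Section Difference.
Variable R : realType.
Local Notation mu := (@leb R).
Local Notation I := (@I01 R).
Local Notation sine := (@sine R).
Local Notation freq := (@freq R).

(** The forcing, only square integrable in time, is common to both equations:
    it cancels in the difference, whose coefficients are then continuously
    differentiable. *)
Lemma coef_diff_derive (nu k r m c0 : R) N (lam : nat -> R) (w : nat -> R -> R)
    (h u v : R -> R -> R) (u0 v0 : R -> R) j (t : R) :
  sobolev_constant c0 -> dirichlet_spectrum lam w ->
  L2_time (@Rplus R) (@L2 R) (@l2norm R) h ->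
  uncontrolled_solution nu k r h v0 v -> controlled_solution nu k r m N w h v u0 u ->
  (0 < j)%N -> 0 < t ->
  let a := fun s => inner (u s) (sine j) - inner (v s) (sine j) in
  let b := fun s => coef_rhs nu k r j (u s) - m * (j <= N)%N%:R * a s - coef_rhs nu k r j (v s) in
  is_derive t (1 : R) a (b t) /\ {for t, continuous b}.
Proof.
move=> sob sp hL2 solv solu j0 t0 a b.
have [[hu cu] _ _ _] := solu; have [[hv cv] _ _ _] := solv.
have Lu s : 0 <= s -> L2 (u s) by move=> s0; exact: sob10_L2 (hu s s0).
have Lv s : 0 <= s -> L2 (v s) by move=> s0; exact: sob10_L2 (hv s s0).
have [_ Lh _] := hL2; have Lj := sine_L2 R j.
have Lw i : (0 < i)%N -> L2 (w i).
  by move=> i0; have [_ eig _ _] := sp; have [_ /sob10_L2] := eig i i0.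
pose fb s x := \sum_(1 <= i < N.+1) inner (u s \- v s) (w i) * w i x.
pose F s x := - m * fb s x + h s x.
have Lfb s : L2 (fb s).
  rewrite (_ : fb s = fun x => \sum_(i < N) inner (u s \- v s) (w i.+1) * w i.+1 x).
    by apply: L2_sum => i _; apply: L2Z; exact: Lw.
  by apply/funext => x; rewrite /fb big_add1 big_mkord.
have LF : {ae mu, forall s, Rplus s -> L2 (F s)}.
  by apply: filterS Lh => s Ls /Ls Lhs; apply: L2D => //; exact: L2Z.
have [b1 [w1 b1E]] := solution_coef j sob solu LF.
have [b2 [w2 b2E]] := solution_coef j sob solv Lh.
have [eta [meta hE eta2]] := coef_measurable j0 hL2.
have ca1 s : 0 < s -> {for s, continuous (fun s => inner (u s) (sine j))}.
  exact: inner_continuous.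
have ca2 s : 0 < s -> {for s, continuous (fun s => inner (v s) (sine j))}.
  exact: inner_continuous.
have ca s : 0 < s -> {for s, continuous a}.
  by move=> s0; apply: cvgB; [exact: ca1|exact: ca2].
have cc2 s : 0 < s -> {for s, continuous (fun s => coef_rhs nu k r j (v s))}.
  exact: coef_rhs_continuous.
pose c1 s := coef_rhs nu k r j (u s) - m * (j <= N)%N%:R * a s.
have cc1 s : 0 < s -> {for s, continuous c1}.
  move=> s0; apply: cvgB; first exact: (coef_rhs_continuous Lu cu).
  by apply: cvgMr; exact: ca.
have cb s : 0 < s -> {for s, continuous b}.
  by move=> s0; apply: cvgB; [exact: cc1|exact: cc2].
split; last exact: cb.
apply: (weak_deriv_is_derive ca cb _ t0).
apply: (weak_deriv_diff ca1 ca2 cc1 cc2 meta eta2 _ _ w1 w2).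
- near=> s => Rs; have s0 : 0 <= s by move: Rs; rewrite /Rplus/= in_itv/= andbT => /ltW.
  have Lhs : L2 (h s) by move: Rs; near: s.
  have -> : b1 s = coef_rhs nu k r j (u s) + inner (F s) (sine j) by move: Rs; near: s.
  have <- : inner (h s) (sine j) = eta s by move: Rs; near: s.
  rewrite (_ : F s = (fun x => - m * fb s x) \+ h s)// innerDl//; last exact: L2Z.
  have Lz := L2B (Lu s s0) (Lv s s0).
  rewrite innerZl// (projection_coef N sp Lz j0) innerBl//; [|exact: Lu|exact: Lv].
  by rewrite /c1 /a; move: ((j <= N)%N%:R) => e; ring.
- near=> s => Rs.
  have -> : b2 s = coef_rhs nu k r j (v s) + inner (h s) (sine j) by move: Rs; near: s.
  by congr (_ + _); move: Rs; near: s.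
Unshelve. all: by end_near. Qed.

Lemma is_derive_energy (a b : nat -> R -> R) (t : R) M :
  (forall j, (0 < j)%N -> is_derive t (1 : R) (a j) (b j t) /\ {for t, continuous (b j)}) ->
  is_derive t (1 : R) (fun s => \sum_(1 <= j < M.+1) freq j ^+ 2 * a j s ^+ 2)
    (\sum_(1 <= j < M.+1) freq j ^+ 2 * (2 * a j t * b j t)) /\
  {for t, continuous (fun s => \sum_(1 <= j < M.+1) freq j ^+ 2 * (2 * a j s * b j s))}.
Proof.
move=> ab; pose e j s := freq j ^+ 2 * a j s ^+ 2.
pose e' j s := freq j ^+ 2 * (2 * a j s * b j s).
have de j : (0 < j)%N -> is_derive t (1 : R) (e j) (e' j t) /\ {for t, continuous (e' j)}.
  move=> /ab[d c]; split.
    have := is_deriveZ (freq j ^+ 2) (is_deriveM d d).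
    by move/is_derive_val; apply; rewrite /e' /GRing.scale /=; ring.
  apply: cvgMr; apply: cvgM => //; apply: cvgMr.
  by apply/differentiable_continuous/derivable1_diffP; have [] := d.
rewrite -/(e _ _) -/(e' _ _); elim: M => [|M [dM cM]].
  rewrite (_ : (fun s => \sum_(1 <= j < 1) e j s) = cst 0); last first.
    by apply/funext => s; rewrite big_geq.
  rewrite big_geq//; split; first exact: is_derive_cst.
  suff h : (fun s => \sum_(1 <= j < 1) e' j s) = cst 0 by rewrite /prop_for h; exact: cvg_cst.
  by apply/funext => s; rewrite big_geq.
have [d c] := de M.+1 isT.
have sumS (f : nat -> R -> R) : (fun s => \sum_(1 <= j < M.+2) f j s) =
    (fun s => \sum_(1 <= j < M.+1) f j s) + f M.+1.
  by apply/funext => s; rewrite big_nat_recr.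
rewrite sumS big_nat_recr//=; split; first exact: is_deriveD.
by rewrite /prop_for sumS; exact: cvgD.
Qed.

End Difference.

Theorem theorem3p2 (R : realType) (nu k r mu : R) (N : nat)
    (h : R -> R -> R) (u0 v0 : R -> R)
    (lam : nat -> R) (w : nat -> R -> R)
    (c0 H1 H2 H3 H4 Q1 xi sigma : R)
    (nu_gt0 : 0 < nu) (k_gt0 : 0 < k) (r_gt0 : 0 < r) (mu_gt0 : 0 < mu)
    (N_gt0 : (0 < N)%N)
    (h_L2 : L2_time (@Rplus R) (@L2 R) (@l2norm R) h)
    (u0_H10 : sob10 u0) (v0_H10 : sob10 v0)
    (spec : dirichlet_spectrum lam w)
    (c0_sobolev : sobolev_constant c0)
    (H12_bounds : uncontrolled_bounds nu k r (energy h) H1 H2)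
    (H34_bounds : controlled_bounds nu k r mu w (energy h) H3 H4)
    (xi_gt : lam 1%N * nu / 2 < xi)
    (sigmaE : sigma = xi - lam 1%N * nu / 2)
    (Q1E : Q1 = 4 * c0 ^+ 2 / nu * (H4 + H2) + r
                + k * (Num.sqrt (lam 1%N))^-1 * (H1 + H3) * Num.sqrt H2)
    (mu_large : Q1 + sigma / 2 < mu)
    (N_large : (lam N.+1)^-1 * (sigma + 2 * Q1) < nu / 2)
    (v : R -> R -> R) (v_sol : uncontrolled_solution nu k r h v0 v)
    (u : R -> R -> R) (u_sol : controlled_solution nu k r mu N w h v u0 u) :
  exists t0 C : R, 0 < t0 /\ 0 <= C /\
    forall t : R, t0 <= t -> h1norm (u t \- v t) ^+ 2 <= C * expR (- xi * t).
Proof.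
have [H10 H20 vbounds] := H12_bounds; have [H30 H40 ubounds] := H34_bounds.
have [Tv Tv0 vB] := vbounds h v0 v h_L2 erefl v0_H10 v_sol.
have [Tu Tu0 uB] := ubounds N h v u u0 v0 N_gt0 h_L2 erefl v0_H10 v_sol u0_H10 u_sol.
(* from the time [s] on, both solutions satisfy the asymptotic bounds *)
pose s := Num.max Tu Tv.
have s0 : 0 < s by rewrite lt_max Tu0.
have pos t : s <= t -> 0 < t by move=> st; exact: lt_le_trans st.
have uBs t : s <= t -> l2norm (u t) <= H3 /\ l2norm (Dx (u t)) ^+ 2 <= H4.
  by move=> st; apply: uB; apply: le_trans st; rewrite le_max lexx.
have vBs t : s <= t -> l2norm (v t) <= H1 /\ l2norm (Dx (v t)) ^+ 2 <= H2.
  by move=> st; apply: vB; apply: le_trans st; rewrite le_max lexx orbT.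
have hu t : s <= t -> sob10 (u t) by move=> /pos/ltW t0; have [[hu _] _ _ _] := u_sol; exact: hu.
have hv t : s <= t -> sob10 (v t) by move=> /pos/ltW t0; have [[hv _] _ _ _] := v_sol; exact: hv.
have hz t : s <= t -> sob10 (u t \- v t) by move=> st; apply: sob10B; [exact: hu|exact: hv].
have f1 : 0 < freq R 1 := freq_gt0 R (ltn0Sn 0).
rewrite (spectrum_lam spec)// in xi_gt sigmaE Q1E.
rewrite (spectrum_lam spec)// in N_large.
rewrite sqrtr_sqr gtr0_norm// in Q1E.
have xi0 : 0 <= xi.
  by apply: le_trans (ltW xi_gt); rewrite mulr_ge0 ?invr_ge0// mulr_ge0 ?sqr_ge0// ltW.
pose a j t := inner (u t) (sine j) - inner (v t) (sine j).
pose b j t := coef_rhs nu k r j (u t) - mu * (j <= N)%N%:R * a j t - coef_rhs nu k r j (v t).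
pose E M t := \sum_(1 <= j < M.+1) freq R j ^+ 2 * a j t ^+ 2.
pose E' M t := \sum_(1 <= j < M.+1) freq R j ^+ 2 * (2 * a j t * b j t).
pose Y t := l2norm (Dx (u t \- v t)) ^+ 2.
have dE M t : s <= t -> is_derive t (1 : R) (E M) (E' M t) /\ {for t, continuous (E' M)}.
  move=> /pos t0; apply: is_derive_energy => j j0.
  exact: (coef_diff_derive c0_sobolev spec h_L2 v_sol u_sol j0 t0).
have EE M t : s <= t -> E M t = cosine_energy M (Dx (u t \- v t)).
  move=> st; rewrite cosine_energy_Dx; last exact: hz.
  apply: eq_bigr => j _; rewrite (innerBl (sob10_L2 (hu t st)) (sob10_L2 (hv t st)))//.
  exact: sine_L2.
have Lu t : s <= t -> L2 (Dx (u t)) by move=> st; exact: Dx_L2 (sob10_sob1 (hu t st)).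
have Lv t : s <= t -> L2 (Dx (v t)) by move=> st; exact: Dx_L2 (sob10_sob1 (hv t st)).
have Lz t : s <= t -> L2 (Dx (u t \- v t)) by move=> st; exact: Dx_L2 (sob10_sob1 (hz t st)).
have EY t : s <= t -> E ^~ t @ \oo --> Y t.
  move=> st; rewrite (_ : E ^~ t = fun M => cosine_energy M (Dx (u t \- v t))).
    exact: parseval_Dx (hz t st).
  by apply/funext => M; rewrite EE.
have E0Y M t : s <= t -> 0 <= E M t <= Y t.
  move=> st; rewrite {2}EE// cosine_energy_le ?andbT; last exact: Lz.
  by apply: sumr_ge0 => j _; rewrite mulr_ge0 ?sqr_ge0.
have YB t : s <= t -> Y t <= 2 * (H4 + H2).
  move=> st; have [_ u4] := uBs t st; have [_ v2] := vBs t st.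
  have : l2norm (Dx (u t \- v t)) <= l2norm (Dx (u t)) + l2norm (Dx (v t)).
    rewrite (l2norm_ae (Lz t st) (L2B (Lu t st) (Lv t st))); first exact: l2normB (Lu t st) (Lv t st).
    exact: DxB_ae (sob10_sob1 (hu t st)) (sob10_sob1 (hv t st)).
  rewrite /Y; move: (l2norm_ge0 (Dx (u t \- v t))) u4 v2.
  move: (l2norm _) (l2norm (Dx (u t))) (l2norm (Dx (v t))) => y p q; clear => y0 pH qH ypq.
  have : y ^+ 2 <= (p + q) ^+ 2 by rewrite lerXn2r ?nnegrE// (le_trans y0).
  by have := sqr_ge0 (p - q); rewrite sqrrB sqrrD; lra.
have K0 : 0 <= 2 * (Q1 - r).
  have [c00 _] := c0_sobolev.
  rewrite Q1E mulr_ge0// (_ : _ - r = 4 * c0 ^+ 2 / nu * (H4 + H2) +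
    k * (freq R 1)^-1 * (H1 + H3) * Num.sqrt H2); last by move: (_ / nu * _) (_ * Num.sqrt _); clear => *; ring.
  rewrite addr_ge0// !mulr_ge0 ?invr_ge0 ?sqrtr_ge0 ?sqr_ge0 ?addr_ge0//; exact: ltW.
have decay := gronwall_limit (M0 := 0%N) xi0 K0 (fun M t st => (dE M t st).1)
  (fun M t st => (dE M t st).2) EY E0Y YB.
have YC t : s <= t -> Y t <= Y s * expR (- xi * (t - s)).
  apply: decay => M t' _ st; have [u3 u4] := uBs t' st; have [v1 v2] := vBs t' st.
  exact: (energy_estimate M nu_gt0 k_gt0 c0_sobolev H10 H20 H30 sigmaE Q1E mu_large N_large
    (hu t' st) (hv t' st) u3 u4 v1 v2).
have D0 : 0 <= 1 + (freq R 1)^-1 ^+ 2 by rewrite addr_ge0// sqr_ge0.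
exists s, ((1 + (freq R 1)^-1 ^+ 2) * Y s * expR (xi * s)); split => //; split.
  by rewrite mulr_ge0 ?expR_ge0// mulr_ge0// sqr_ge0.
move=> t st; rewrite sqr_sqrtr ?addr_ge0 ?sqr_ge0//.
apply: (@le_trans _ _ ((1 + (freq R 1)^-1 ^+ 2) * Y t)).
  rewrite mulrDl mul1r addrC lerD2l /Y -exprMn lerXn2r ?nnegrE ?mulr_ge0 ?invr_ge0 ?l2norm_ge0 ?(ltW f1)//.
  exact: poincare_l2norm (hz t st).
rewrite -2!mulrA ler_wpM2l// -[leRHS]mulrA -expRD (_ : xi * s + - xi * t = - xi * (t - s)); last by clear; ring.
exact: YC.
Qed.
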